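(* Let $X=(X_1,X_2,\ldots)$ be the limit relative age-ordered frequencies generated by an exchangeable Gibbs partition EGP$(\alpha,V)$ with $\alpha<1$, and let $m\ge1$. Conditionally on the $m$-th record index $i_m$, one has the representation (equality in law) $$-\log X_m=\sum_{j=2}^{m}Y^*_j+\sum_{i=m+1}^{i_m}Y^{(m)}_i+\sum_{l=i_m+1}^{\infty}Z_l,$$ where: $\{Y^*_j\}$ are independent random variables with distributions, respectively, $$f^{(\alpha)}_j(y)\,dy=\frac{e^{-y(j-1-\alpha(j-1))}(1-e^{-y})^{-\alpha}}{B(j-1-\alpha(j-1),1-\alpha)}\,\mathbb{I}(y>0)\,dy;$$ $\{Y^{(m)}_i\}$ are independent random variables with distributions, respectively, $$f^{(\alpha,m)}_i(y)\,dy=(i-\alpha m-1)\,e^{-y(i-1-\alpha m)}\,\mathbb{I}(y>0)\,dy;$$ and $\{Z_l\}$ are such that: (i) $Z_l$ is conditionally independent of $Z_{l-1}$, given $K_{l-1}$; (ii) conditionally on $\{K_{l-1}=k,K_l=v\}$ (with $v\in\{k,k+1\}$), the distribution of $Z_l$ is a unit point mass at $0$ if $v=k$, and if $v=k+1$ it has density $$\frac{e^{-z(l-1-\alpha k)}(1-e^{-z})^{-\alpha}}{B(l-1-\alpha k,1-\alpha)}\,\mathbb{I}(z>0)\,dz.$$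
   Context: $B(a,b)=\Gamma(a)\Gamma(b)/\Gamma(a+b)$ is the Beta function; $-\log 0=\infty$. A random partition of $[n]=\{1,\ldots,n\}$ is written $\Pi_n=(\Pi_{n1},\ldots,\Pi_{nk})$ with classes ordered by their least elements. For a consistent family $\Pi=(\Pi_n)$ (a random partition of $\mathbb{N}$), the record indices $1=i_1<i_2<\cdots$ are the least elements of its classes, the limit age-ordered frequencies are $X_j=\lim_{n\to\infty}|\Pi_{nj}|/n$, and $K_n$ is the number of classes of $\Pi_n$. Conditioning on $i_m$ is for finite values of $i_m$ taken with positive probability. Let $\alpha\in(-\infty,1]$ and let $V=(V_{n,k}:1\le k\le n)$ be nonnegative coefficients with $V_{1,1}=1$ and $V_{n,k}=(n-\alpha k)V_{n+1,k}+V_{n+1,k+1}$. The exchangeable Gibbs partition EGP$(\alpha,V)$ is the random partition $\Pi=(\Pi_n)$ of $\mathbb{N}$ generated by: $\Pi_1=(\{1\})$; for $n\ge1$, given $\Pi_n=(\pi_{n1},\ldots,\pi_{nk})$ with class sizes $n_j=|\pi_{nj}|$, the element $n+1$ starts a new class with probability $V_{n+1,k+1}/V_{n,k}$, and joins the class $\pi_{nj}$ with probability $\frac{n_j-\alpha}{n-\alpha k}\left(1-\frac{V_{n+1,k+1}}{V_{n,k}}\right)$, $j=1,\ldots,k$. In particular $K=(K_n)$ is a Markov chain with $K_1=1$ and, for $j>1$, $\mathbb{P}(K_j=k+1\mid K_{j-1}=k)=1-\mathbb{P}(K_j=k\mid K_{j-1}=k)=V_{j,k+1}/V_{j-1,k}$;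 given $i_m$, one has $K_{i_m}=m$. *)

(* Defs.v *)
From HB Require Import structures.
From mathcomp Require Import all_boot all_order all_algebra.
From mathcomp Require Import all_classical all_reals all_analysis.
From mathcomp Require Import measurable_realfun.

Set Implicit Arguments.
Unset Strict Implicit.
Unset Printing Implicit Defensive.

Import Order.TTheory GRing.Theory Num.Theory.
Import numFieldNormedType.Exports.

Local Open Scope classical_set_scope.
Local Open Scope ring_scope.

Definition Gamma (R : realType) (a : R) : R :=
  (\int[lebesgue_measure]_(x in `]0, +oo[) (x `^ (a - 1) * expR (- x)))%R.

Definition Beta (R : realType) (a b : R) : R :=
  Gamma a * Gamma b / Gamma (a + b).

Definition cprob d (T : measurableType d) (R : realType)
    (P : probability T R) (A B : set T) : R :=
  fine (P (A `&` B)) / fine (P B).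

(* Conditional independence of the events A and B given the event C, in
   product form, so that nothing is required when C is negligible. *)
Definition cond_indep d (T : measurableType d) (R : realType)
    (P : probability T R) (A B C : set T) : Prop :=
  (P (A `&` B `&` C) * P C = P (A `&` C) * P (B `&` C))%E.

(* A partition is the list of its classes by increasing least element; each
   class is an increasing list, so its least element is its head. *)
Definition age_ordered_partition (n : nat) (pi : seq (seq nat)) : Prop :=
  [/\ all (fun c => c != [::]) pi,
      all (sorted ltn) pi,
      sorted ltn [seq head 0%N c | c <- pi] &
      perm_eq (flatten pi) (iota 1 n)].

Definition restrict (n : nat) (pi : seq (seq nat)) : seq (seq nat) :=
  [seq c <- [seq [seq x <- c | (x <= n)%N] | c <- pi] | c != [::]].

Record random_partition d (T : measurableType d)
    (Pi : nat -> T -> seq (seq nat)) : Prop := RandomPartition {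
  rp_partition : forall n w, age_ordered_partition n (Pi n w);
  rp_consistent : forall n w, restrict n (Pi n.+1 w) = Pi n w;
  rp_measurable : forall n pi, measurable [set w | Pi n w = pi] }.

Definition open_class (n : nat) (pi : seq (seq nat)) : seq (seq nat) :=
  rcons pi [:: n.+1].

(* The class number j, counted from 0, receives n + 1. *)
Definition join_class (n : nat) (pi : seq (seq nat)) (j : nat) :
    seq (seq nat) :=
  set_nth [::] pi j (rcons (nth [::] pi j) n.+1).

Definition num_classes (T : Type) (Pi : nat -> T -> seq (seq nat))
    (n : nat) (w : T) : nat := size (Pi n w).

(* The event that the j-th record index (j >= 1) equals r; the record index is
   infinite where no Pi n has j classes. *)
Definition record_event (T : Type) (Pi : nat -> T -> seq (seq nat))
    (j r : nat) : set T :=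
  [set w | exists n, (j <= size (Pi n w))%N /\
                     head 0%N (nth [::] (Pi n w) j.-1) = r].

(* The frequency of the j-th class (j >= 1); it is 0 where no Pi n has j
   classes. *)
Definition age_frequency (R : realType) (T : Type)
    (Pi : nat -> T -> seq (seq nat)) (j : nat) (w : T) : R :=
  limn (fun n => (size (nth [::] (Pi n w) j.-1))%:R / n%:R : R).

Record gibbs_coefficients (R : realType) (alpha : R) (V : nat -> nat -> R) :
    Prop := GibbsCoefficients {
  gc_ge0 : forall n k, (1 <= k <= n)%N -> 0 <= V n k;
  gc_init : V 1%N 1%N = 1;
  gc_rec : forall n k, (1 <= k <= n)%N ->
    V n k = (n%:R - alpha * k%:R) * V n.+1 k + V n.+1 k.+1 }.

(* Pi 1 = [:: [:: 1]] is forced by rp_partition. *)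
Record EGP d (T : measurableType d) (R : realType) (P : probability T R)
    (alpha : R) (V : nat -> nat -> R) (Pi : nat -> T -> seq (seq nat)) :
    Prop := ExchangeableGibbsPartition {
  egp_alpha : alpha <= 1;
  egp_coef : gibbs_coefficients alpha V;
  egp_partition : random_partition Pi;
  egp_open : forall n pi, (1 <= n)%N -> P [set w | Pi n w = pi] != 0%E ->
    cprob P [set w | Pi n.+1 w = open_class n pi] [set w | Pi n w = pi] =
    V n.+1 (size pi).+1 / V n (size pi);
  egp_join : forall n pi j, (1 <= n)%N -> P [set w | Pi n w = pi] != 0%E ->
    (j < size pi)%N ->
    cprob P [set w | Pi n.+1 w = join_class n pi j] [set w | Pi n w = pi] =
    ((size (nth [::] pi j))%:R - alpha) / (n%:R - alpha * (size pi)%:R) *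
    (1 - V n.+1 (size pi).+1 / V n (size pi)) }.

Definition density_law (R : realType) (f : R -> R) (A : set R) : \bar R :=
  (\int[lebesgue_measure]_(y in A) (f y)%:E)%E.

Definition Ystar_pdf (R : realType) (alpha : R) (j : nat) (y : R) : R :=
  expR (- y * (j%:R - 1 - alpha * (j%:R - 1))) *
  (1 - expR (- y)) `^ (- alpha) /
  Beta (j%:R - 1 - alpha * (j%:R - 1)) (1 - alpha) * (0 < y)%R%:R.

Definition Y_pdf (R : realType) (alpha : R) (m i : nat) (y : R) : R :=
  (i%:R - alpha * m%:R - 1) *
  expR (- y * (i%:R - 1 - alpha * m%:R)) * (0 < y)%R%:R.

Definition Z_pdf (R : realType) (alpha : R) (l k : nat) (z : R) : R :=
  expR (- z * (l%:R - 1 - alpha * k%:R)) *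
  (1 - expR (- z)) `^ (- alpha) /
  Beta (l%:R - 1 - alpha * k%:R) (1 - alpha) * (0 < z)%R%:R.

(* The event K_l = k_l for r <= l <= n and Z_l \in A_l for r < l <= n. *)
Definition path_event (T : Type) (R : realType) (r n : nat)
    (K : nat -> T -> nat) (Z : nat -> T -> R)
    (k : nat -> nat) (A : nat -> set R) : set T :=
  [set w | (forall l, (r <= l <= n)%N -> K l w = k l) /\
           (forall l, (r < l <= n)%N -> A l (Z l w))].

(* zp_indep: given K_{l-1}, the pair (K_l, Z_l) is independent of
   (K_r, ..., K_{l-1}, Z_{r+1}, ..., Z_{l-1}). Independence of Z_l from Z_{l-1}
   alone would not determine the joint law of (K, Z). *)
Record Z_process d (T : measurableType d) (R : realType)
    (P : probability T R) (alpha : R) (r : nat)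
    (K : nat -> {RV P >-> nat}) (Z : nat -> {RV P >-> R}) :
    Prop := ZProcess {
  zp_indep : forall (l v : nat) (k : nat -> nat) (A : nat -> set R),
    (r < l)%N -> (forall i, measurable (A i)) ->
    cond_indep P
      [set w | K l w = v /\ A l (Z l w)]
      (path_event r l.-1 (fun i => K i) (fun i => Z i) k A)
      [set w | K l.-1 w = k l.-1];
  zp_stay : forall (l k : nat) (A : set R), (r < l)%N -> measurable A ->
    P [set w | K l.-1 w = k /\ K l w = k] != 0%E ->
    (cprob P (Z l @^-1` A) [set w | K l.-1 w = k /\ K l w = k])%:E =
    \d_(0 : R) A;
  zp_jump : forall (l k : nat) (A : set R), (r < l)%N -> measurable A ->
    P [set w | K l.-1 w = k /\ K l w = k.+1] != 0%E ->
    (cprob P (Z l @^-1` A) [set w | K l.-1 w = k /\ K l w = k.+1])%:E =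
    density_law (Z_pdf alpha l k) A }.

(* Mutual independence of Ystar_2, ..., Ystar_m, Y_{m+1}, ..., Y_r and of the
   process (K, Z), the latter tested on the pi-system of path events. *)
Definition summands_indep d (T : measurableType d) (R : realType)
    (P : probability T R) (m r : nat)
    (Ystar Y : nat -> {RV P >-> R})
    (K : nat -> {RV P >-> nat}) (Z : nat -> {RV P >-> R}) : Prop :=
  forall (n : nat) (k : nat -> nat) (A B C : nat -> set R),
    (r <= n)%N ->
    (forall i, measurable (A i)) -> (forall i, measurable (B i)) ->
    (forall i, measurable (C i)) ->
    P ([set w | forall j, (2 <= j <= m)%N -> A j (Ystar j w)] `&`
       [set w | forall i, (m < i <= r)%N -> B i (Y i w)] `&`
       path_event r n (fun i => K i) (fun i => Z i) k C) =
    ((\prod_(2 <= j < m.+1) P (Ystar j @^-1` A j)) *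
     (\prod_(m.+1 <= i < r.+1) P (Y i @^-1` B i)) *
     P (path_event r n (fun i => K i) (fun i => Z i) k C))%E.

(* Main.v *)
Require Import Defs.
From HB Require Import structures.
From mathcomp Require Import all_boot all_order all_algebra.
From mathcomp Require Import all_classical all_reals all_analysis.
From mathcomp Require Import measurable_realfun.
From mathcomp Require Import ring lra zify.
Set Implicit Arguments.
Unset Strict Implicit.
Unset Printing Implicit Defensive.
Import Order.TTheory GRing.Theory Num.Theory.
Import numFieldNormedType.Exports.
Local Open Scope classical_set_scope.
Local Open Scope ring_scope.

(* On the event that the m-th record index is r, let D_n be the size of the m-th
   class at time n and W_n = n - alpha K_n, so that M_n = (D_n - alpha) / W_n is
   the probability that n + 1 joins this class if it opens no new one. The ratio
   of rising factorials (D_n - alpha)_p / (W_n)_p is conserved in mean at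
   non-record steps, and at a record is multiplied by (W_n)_p / (W_(n+1))_p, the
   p-th moment of the beta law with parameters (W_n, 1 - alpha). Along each path
   of K its mean is therefore a product which, since
   (1 - alpha)_p / (r - alpha m)_p telescopes into moments of beta laws, equals
   E exp(- p (sum of the Ystar, Y and Z up to time n)).
     Adding to M_n the mass it loses at records gives a martingale whose
   increments are O(1/n), hence converges almost surely along the cubes, and then
   along all n. The losses are summable; this forces K_n = o(n) wherever
   lim M_n > 0, so D_n / n and M_n have the same limit X_m. Letting n go to
   infinity, X_m and exp(- total sum) have the same moments, which determine a
   law on [0, 1]. *)

(** * Partitions and record indices *)

(** The Z are coupled through K, so the right-hand side is not a sum of independent terms. Given a
    finite path of K it is one, and along the same path the class share has explicit moments. The
    two sides are therefore compared path by path at each finite time. The transition probabilities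
    of K enter both sides through the same path probability and are never computed; the limit is
    taken after summing over the countably many paths. Rising factorials replace powers because they
    make the one-step identity exact; as W_n grows linearly, the difference vanishes in the limit.
    Why cubes: second moments of martingale increments add up, so the mean absolute increment from
    k^3 to (k+1)^3 is O(k^-2), hence summable, while inside such a block a path moves by O(1/k)
    only. The comparison is made for exp(- sum), which stays in [0, 1] even where the sum of the Z
    diverges; those points correspond to X_m = 0, in accord with - log 0 = infinity. No normalising
    constant is evaluated: the moments follow from total mass 1 and B(a + 1, b) = a / (a + b) B(a,
    b). *)

Lemma mem_age_ordered n pi c x : age_ordered_partition n pi ->
  c \in pi -> x \in c -> (0 < x <= n)%N.
Proof.
move=> [_ _ _ pe] cpi xc.
have : x \in flatten pi by apply/flattenP; exists c.
by rewrite (perm_mem pe) mem_iota; lia.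
Qed.

(** As the largest element, n + 1 ends its class. Deleting it either empties that class, which must
    then be the last one because least elements increase, or shortens the class without moving
    it. *)
Lemma age_ordered_step n pi : age_ordered_partition n.+1 pi ->
  pi = open_class n (Defs.restrict n pi) \/
  exists2 j, (j < size (Defs.restrict n pi))%N &
             pi = join_class n (Defs.restrict n pi) j.
Proof.
move=> ap; have [ne so sh pe] := ap.
have : n.+1 \in flatten pi by rewrite (perm_mem pe) mem_iota; lia.
move=> /flattenP[c cpi nc].
have uf : uniq (flatten pi) by rewrite (perm_uniq pe) iota_uniq.
have cle : forall e x, e \in pi -> x \in e -> (x <= n.+1)%N.
  by move=> e x epi xe; have := mem_age_ordered ap epi xe; lia.
have [c' cE] : exists c', c = rcons c' n.+1.
  case/lastP: c cpi nc => // c' x cpi.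
  rewrite mem_rcons inE => /orP[/eqP <-|nc']; first by exists c'.
  have := allP so _ cpi; rewrite -cats1.
  rewrite (sorted_pairwise ltn_trans) pairwise_cat => /andP[/allrelP lt _].
  have /= := lt n.+1 x nc' (mem_head _ _).
  have := cle _ x cpi; rewrite mem_rcons mem_head => /(_ isT); lia.
have c'n : all (fun x => x <= n)%N c'.
  apply/allP => x xc'.
  have := allP so _ cpi; rewrite cE -cats1.
  rewrite (sorted_pairwise ltn_trans) pairwise_cat => /andP[/allrelP lt _].
  by have := lt x n.+1 xc' (mem_head _ _); rewrite /= ltnS.
have [p1 [p2 piE]] : exists p1 p2, pi = p1 ++ c :: p2.
  by case/splitPr: cpi => p1 p2; exists p1, p2.
have un : forall e, e \in p1 ++ p2 -> n.+1 \notin e.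
  move=> e ee; apply/negP => ne1; move: uf.
  have -> : uniq (flatten pi) = uniq (flatten (c :: p1 ++ p2)).
    apply: perm_uniq; apply: perm_flatten.
    by rewrite piE -[c :: p2]cat1s perm_catCA.
  rewrite /= cat_uniq => /and3P[_ /negP + _]; apply.
  by apply/hasP; exists n.+1 => //; apply/flattenP; exists e.
have rid : forall s, {subset s <= p1 ++ p2} -> Defs.restrict n s = s.
  move=> s ss; rewrite /Defs.restrict.
  rewrite (_ : [seq _ | _ <- s] = s).
    apply/all_filterP/allP => e /ss es.
    by apply: (allP ne); rewrite piE mem_cat inE orbCA -mem_cat es orbT.
  rewrite -[RHS]map_id; apply/eq_in_map => e /ss es.
  apply/all_filterP/allP => x xe.
  have epi : e \in pi by rewrite piE mem_cat inE orbCA -mem_cat es orbT.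
  have := cle e x epi xe; rewrite leq_eqVlt => /orP[/eqP xn|//].
  by move: (un _ es); rewrite -xn xe.
have rE : Defs.restrict n pi = p1 ++ (if c' is [::] then [::] else [:: c']) ++ p2.
  rewrite piE /Defs.restrict map_cat filter_cat -/(Defs.restrict n p1) rid; last first.
    by move=> e; rewrite mem_cat => ->.
  rewrite /= -/(Defs.restrict n p2) cE filter_rcons ltnn (all_filterP c'n).
  rewrite rid; last by move=> e; rewrite mem_cat => ->; rewrite orbT.
  by case: (c').
case: c' cE c'n rE => [|y c'] cE c'n rE.
- left; suff p20 : p2 = [::].
    by rewrite rE p20 piE p20 cE cats0 /= /open_class cats1.
  case: p2 piE {un rid rE} => // c2 p2 piE.
  have c2pi : c2 \in pi by rewrite piE mem_cat !inE eqxx !orbT.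
  have hc2 : head 0%N c2 \in c2.
    by have := allP ne _ c2pi; case: (c2) => //= ? ? _; rewrite mem_head.
  have := cle _ _ c2pi hc2.
  move: sh; rewrite piE map_cat cE /= => /cat_sorted2[_] /= /andP[]; lia.
- right; exists (size p1); first by rewrite rE size_cat /=; lia.
  rewrite rE /join_class nth_cat ltnn subnn /= piE cE /=.
  by elim: (p1) => //= a l ->.
Qed.

Section RandomPartition.
Context d (T : measurableType d) (Pi : nat -> T -> seq (seq nat)).
Hypothesis rp : random_partition Pi.

Local Notation K := (num_classes Pi).

Lemma rp_step n w :
  Pi n.+1 w = open_class n (Pi n w) \/
  exists2 j, (j < K n w)%N & Pi n.+1 w = join_class n (Pi n w) j.
Proof.
by have := age_ordered_step (rp_partition rp n.+1 w); rewrite (rp_consistent rp).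
Qed.

Lemma rp0 w : Pi 0%N w = [::].
Proof.
have [ne _ _ /perm_size] := rp_partition rp 0%N w.
rewrite size_flatten /=; case: (Pi 0%N w) ne => //= c s /andP[].
by case: c.
Qed.

Lemma size_open_class n pi : size (open_class n pi) = (size pi).+1.
Proof. by rewrite size_rcons. Qed.

Lemma size_join_class n pi j : (j < size pi)%N ->
  size (join_class n pi j) = size pi.
Proof. by move=> jp; rewrite size_set_nth; exact/maxn_idPr. Qed.

Lemma nth_join_class n pi j i :
  nth [::] (join_class n pi j) i =
  if i == j then rcons (nth [::] pi j) n.+1 else nth [::] pi i.
Proof. by rewrite nth_set_nth /=. Qed.

Lemma num_classesS n w :
  (K n w <= K n.+1 w <= (K n w).+1)%N.
Proof.
rewrite /num_classes; case: (rp_step n w) => [->|[j jp ->]].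
  by rewrite size_open_class leqnSn leqnn.
by rewrite size_join_class// leqnSn leqnn.
Qed.

Lemma num_classes_homo w : {homo K ^~ w : i j / (i <= j)%N}.
Proof.
apply: homo_leq => [//|y x z|i]; first exact: leq_trans.
by case/andP: (num_classesS i w).
Qed.

Lemma num_classes_le n w : (K n w <= n)%N.
Proof.
elim: n => [|n IH]; first by rewrite /num_classes rp0.
by have /andP[_ /leq_trans->] := num_classesS n w.
Qed.

Lemma num_classes1 w : K 1%N w = 1%N.
Proof.
rewrite /num_classes; have [->|[j]] := rp_step 0%N w.
  by rewrite rp0.
by rewrite /num_classes rp0.
Qed.

Lemma num_classes_gt0 n w : (0 < n)%N -> (0 < K n w)%N.
Proof. by move=> n0; rewrite -(num_classes1 w); exact: num_classes_homo. Qed.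

Lemma rp_history i n w w' : (i <= n)%N -> Pi n w = Pi n w' -> Pi i w = Pi i w'.
Proof.
move=> /subnK <-; elim: (n - i)%N => [//|k IH]; rewrite addSn => e.
by apply: IH; rewrite -(rp_consistent rp) e (rp_consistent rp).
Qed.

Lemma rp_class_neq0 n w j : (j < K n w)%N -> nth [::] (Pi n w) j != [::].
Proof.
have [ne _ _ _] := rp_partition rp n w => jp.
exact: (allP ne _ (mem_nth _ jp)).
Qed.

Lemma nth_open_class n w j : (j < K n w)%N ->
  nth [::] (open_class n (Pi n w)) j = nth [::] (Pi n w) j.
Proof. by move=> jp; rewrite nth_rcons; move: jp; rewrite /num_classes => ->. Qed.

(* The least element h of a class is the time at which the class was opened. *)
Lemma head_class n w j : (j < K n w)%N ->
  let h := head 0%N (nth [::] (Pi n w) j) in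
  [/\ (0 < h <= n)%N, K h w = j.+1 & nth [::] (Pi h w) j = [:: h]].
Proof.
elim: n j => [j|n IH j]; first by rewrite /num_classes rp0.
have [oE jn h|[i iK jE]] := rp_step n w.
- have [jK|Kj] := ltnP j (K n w).
    have hE : h = head 0%N (nth [::] (Pi n w) j) by rewrite /h oE nth_open_class.
    by have := IH _ jK; rewrite -hE => -[hn -> ->]; split=> //; lia.
  have jE : j = K n w.
    by move: jn Kj; rewrite /num_classes oE size_open_class; lia.
  have nE : nth [::] (Pi n.+1 w) j = [:: n.+1].
    by rewrite oE /open_class nth_rcons jE ltnn eqxx.
  have -> : h = n.+1 by rewrite /h nE.
  split=> //; first by lia.
  by rewrite /num_classes oE size_open_class -/(K n w) jE.
- move=> jn h; have jK : (j < K n w)%N.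
    by move: jn; rewrite /num_classes jE size_join_class.
  have hE : h = head 0%N (nth [::] (Pi n w) j).
    rewrite /h jE nth_join_class; case: eqP => // ->.
    by have := rp_class_neq0 iK; case: (nth _ _ i).
  by have := IH _ jK; rewrite -hE => -[hn -> ->]; split=> //; lia.
Qed.

(** The quantifier over n disappears: the event can be read off at time r alone, which makes it
    known at every later time. *)
Lemma record_eventE m r : (0 < m)%N -> record_event Pi m r =
  [set w | (0 < r)%N /\ K r w = m /\ nth [::] (Pi r w) m.-1 = [:: r]].
Proof.
move=> m0; apply/seteqP; split=> w /=.
  move=> [n [mn hr]]; have [] := @head_class n w m.-1.
    by rewrite prednK.
  by rewrite hr prednK// => /andP[-> _].
by move=> [_ [Kr nr]]; exists r; rewrite nr; split=> //; rewrite -Kr.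
Qed.

(** Plays the role of measurability with respect to the sigma-algebra generated by [Pi n]; by
    consistency ([rp_history]) these sigma-algebras form a filtration. *)
Definition determined n {U} (a : T -> U) :=
  forall w w', Pi n w = Pi n w' -> a w = a w'.

Lemma determinedW i n U (a : T -> U) : (i <= n)%N ->
  determined i a -> determined n a.
Proof. by move=> ij ai w w' e; apply: ai; exact: rp_history e. Qed.

(** Partitions are countably many, so a determined set is a countable union of atoms of [Pi n]. *)
Lemma measurable_determined n (A : set T) : determined n A -> measurable A.
Proof.
move=> An; pose F k := [set w | A w /\ pickle (Pi n w) = k].
have -> : A = \bigcup_k F k.
  apply/seteqP; split=> w; first by move=> Aw; exists (pickle (Pi n w)).
  by move=> [k _ []].
apply: bigcupT_measurable => k.
have [[w0 [Aw0 k0]]|nF] := pselect (exists w, F k w).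
  suff -> : F k = [set w | Pi n w = Pi n w0] by exact: rp_measurable.
  apply/seteqP; split=> w /= => [[_]|e].
    by rewrite -k0 => /(pcan_inj (@pickleK _)).
  by rewrite /F /= e k0 -(An _ _ (esym e)).
by rewrite (_ : F k = set0) // -subset0 => w Fw; apply: nF; exists w.
Qed.

Lemma measurable_fun_determined d' (U : measurableType d') n (a : T -> U) :
  determined n a -> measurable_fun setT a.
Proof.
move=> an _ B mB; rewrite setTI; apply: (@measurable_determined n) => w w' e.
by rewrite /preimage /= (an _ _ e).
Qed.

Lemma determined_num_classes i n : (i <= n)%N -> determined n (K i).
Proof.
by move=> ij; apply: (determinedW ij) => w w'; rewrite /num_classes => ->.
Qed.

Definition class_size (m n : nat) (w : T) : nat :=
  size (nth [::] (Pi n w) m.-1).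

Lemma determined_record m r n : (0 < m)%N -> (r <= n)%N ->
  determined n (record_event Pi m r).
Proof.
move=> m0 rn; apply: (determinedW rn) => w w' e.
by rewrite record_eventE//= /num_classes e.
Qed.

(** Expressed through the class count, so that the records can be read off the path of K. *)
Definition opens n w : bool := K n.+1 w == (K n w).+1.
Definition grows m n w : bool := Pi n.+1 w == join_class n (Pi n w) m.-1.

Lemma opensP n w : reflect (Pi n.+1 w = open_class n (Pi n w)) (opens n w).
Proof.
rewrite /opens /num_classes; apply: (iffP eqP) => [|->].
  have [//|[j jp ->]] := rp_step n w.
  by rewrite size_join_class// => e; exfalso; move: e; lia.
by rewrite size_open_class.
Qed.

Section Record.
Variables (m r : nat) (m0 : (0 < m)%N) (w : T).
Hypothesis rw : record_event Pi m r w.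

Lemma record_gt0 : (0 < r)%N.
Proof. by move: rw; rewrite record_eventE//= => -[]. Qed.

Lemma record_num_classes : K r w = m.
Proof. by move: rw; rewrite record_eventE//= => -[_ []]. Qed.

Lemma record_le : (m <= r)%N.
Proof. by rewrite -record_num_classes num_classes_le. Qed.

Lemma record_class_size : class_size m r w = 1%N.
Proof.
by move: rw; rewrite record_eventE//= /class_size => -[_ [_ ->]].
Qed.

Lemma record_num_classes_ge n : (r <= n)%N -> (m <= K n w)%N.
Proof. by move=> rn; rewrite -{1}record_num_classes num_classes_homo. Qed.

Lemma record_stepK n : K n.+1 w = if opens n w then (K n w).+1 else K n w.
Proof.
case: ifPn => [/eqP//|]; rewrite /opens.
by have := num_classesS n w; lia.
Qed.

Lemma grows_nopens n : (r <= n)%N -> grows m n w -> opens n w = false.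
Proof.
move=> rn /eqP gE; apply/negP; rewrite /opens /num_classes gE.
rewrite size_join_class; first by move=> /eqP; lia.
by have := record_num_classes_ge rn; rewrite /num_classes; lia.
Qed.

Lemma record_stepD n : (r <= n)%N -> class_size m n.+1 w =
  if opens n w then class_size m n w
  else if grows m n w then (class_size m n w).+1 else class_size m n w.
Proof.
move=> rn; have mK := record_num_classes_ge rn.
case: ifPn => [/opensP oE|no].
  by rewrite /class_size oE nth_open_class//; lia.
case: ifPn => [/eqP gE|ng].
  by rewrite /class_size gE nth_join_class eqxx size_rcons.
have [/opensP|[j jK jE]] := rp_step n w; first by rewrite (negbTE no).
rewrite /class_size jE nth_join_class; case: eqP => // mj.
by move: ng; rewrite /grows mj jE eqxx.
Qed.

(** The other K - 1 classes hold at least one element each. This inequality later bounds the weight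
    of the class by the total weight. *)
Lemma record_size_bounds n : (r <= n)%N ->
  (0 < class_size m n w)%N /\ (class_size m n w + K n w <= n.+1)%N.
Proof.
move=> /subnK <-; elim: (n - r)%N => [|k [IH1 IH2]].
  by rewrite record_class_size record_num_classes; have := record_le; lia.
rewrite addSn record_stepK record_stepD ?leq_addl//.
by case: ifP => _; [lia|case: ifP => _; lia].
Qed.

End Record.
End RandomPartition.

(** * The urn seen from the m-th class *)

(** Compares integrals over two different spaces. It serves twice: for one step of the urn, with the
    fibres of [Pi n] on both sides, and to pass from P to Q, with the fibres of the path of K. *)
Lemma eq_integral_fibers (R : realType) (I : countType)
    d1 (T1 : measurableType d1) (mu1 : {measure set T1 -> \bar R})
    d2 (T2 : measurableType d2) (mu2 : {measure set T2 -> \bar R})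
    (h1 : T1 -> I) (h2 : T2 -> I) (D1 : set T1) (D2 : set T2)
    (g1 : T1 -> \bar R) (g2 : T2 -> \bar R) :
  measurable D1 -> (forall i, measurable (h1 @^-1` [set i])) ->
  measurable D2 -> (forall i, measurable (h2 @^-1` [set i])) ->
  measurable_fun D1 g1 -> (forall x, D1 x -> (0 <= g1 x)%E) ->
  measurable_fun D2 g2 -> (forall x, D2 x -> (0 <= g2 x)%E) ->
  (forall i, \int[mu1]_(x in D1 `&` h1 @^-1` [set i]) g1 x =
             \int[mu2]_(x in D2 `&` h2 @^-1` [set i]) g2 x)%E ->
  (\int[mu1]_(x in D1) g1 x = \int[mu2]_(x in D2) g2 x)%E.
Proof.
have fibers d (T : measurableType d) (mu : {measure set T -> \bar R})
    (h : T -> I) (D : set T) (g : T -> \bar R) : measurable D ->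
    (forall i, measurable (h @^-1` [set i])) ->
    measurable_fun D g -> (forall x, D x -> (0 <= g x)%E) ->
    let F k := oapp (fun i => D `&` h @^-1` [set i]) set0 (pickle_inv k) in
    (\int[mu]_(x in D) g x =
     \sum_(k <oo) \int[mu]_(x in F k) g x)%E.
  move=> mD mh mg g0 F.
  have DE : D = \bigcup_k F k.
    apply/seteqP; split=> x.
      by move=> Dx; exists (pickle (h x)) => //; rewrite /F pickleK_inv.
    by move=> [k _]; rewrite /F; case: (pickle_inv k) => //= i [].
  rewrite [in LHS]DE ge0_integral_bigcup -?DE//.
    by move=> k; rewrite /F; case: (pickle_inv k) => //= i; exact: measurableI.
  (* Disjointness holds because [pickle_inv] is defined on actual codes only, so distinct indices
     never decode to the same value. *)
  apply/trivIsetP => i j _ _ ij; rewrite -subset0 => x [].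
  rewrite /F; case iE: (pickle_inv i) => [a|]//=; case jE: (pickle_inv j) => [b|]//=.
  move=> [_ ax] [_ bx]; move/negP: ij; apply; apply/eqP.
  have := @pickle_invK I i; have := @pickle_invK I j.
  by rewrite iE jE /= -ax -bx => -> ->.
move=> mD1 mh1 mD2 mh2 mg1 g10 mg2 g20 eqf.
rewrite (fibers _ _ mu1 h1)// (fibers _ _ mu2 h2)//.
apply: eq_eseriesr => k _; case: (pickle_inv k) => [i|] /=; first exact: eqf.
by rewrite !integral_set0.
Qed.

Section OneStep.
Context d (T : measurableType d) (R : realType) (P : probability T R).
Variables (alpha : R) (V : nat -> nat -> R) (Pi : nat -> T -> seq (seq nat)).
Hypothesis (alpha1 : alpha < 1) (hPi : EGP P alpha V Pi).

Local Notation K := (num_classes Pi).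
Local Notation D := (class_size Pi).
Let rp : random_partition Pi := egp_partition hPi.

Definition open_prob n k : R := V n.+1 k.+1 / V n k.

Lemma weight_gt0 n k : (0 < k <= n)%N -> 0 < n%:R - alpha * k%:R.
Proof.
move=> /andP[k0 kn].
have : k%:R <= n%:R :> R by rewrite ler_nat.
have k1 : 0 < k%:R :> R by rewrite ltr0n.
have : 0 < (1 - alpha) * k%:R by rewrite mulr_gt0// subr_gt0.
by lra.
Qed.

Lemma open_prob_itv n k : (0 < k <= n)%N -> 0 <= open_prob n k <= 1.
Proof.
move=> kn; rewrite /open_prob; have hc := egp_coef hPi.
have V0 : 0 <= V n k by exact: gc_ge0 hc _ _ _.
have V1 : 0 <= V n.+1 k.+1 by apply: gc_ge0 hc _ _ _; lia.
have V2 : 0 <= V n.+1 k by apply: gc_ge0 hc _ _ _; lia.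
have Vr := gc_rec hc kn; have w0 := weight_gt0 kn.
(* Where [V n k] vanishes, the ratio is 0 by the convention on inverses; elsewhere the recursion
   gives V (n+1) (k+1) <= V n k. *)
rewrite divr_ge0//=; have [->|Vn0] := eqVneq (V n k) 0.
  by rewrite invr0 mulr0.
rewrite ler_pdivrMr ?lt0r ?Vn0// mul1r Vr lerDr.
by rewrite mulr_ge0// ltW.
Qed.

(** The product form also covers a negligible B, where both sides are 0 and the hypothesis says
    nothing. *)
Lemma fine_cprob (A B : set T) x : measurable A -> measurable B ->
  (P B != 0%E -> cprob P A B = x) -> P (A `&` B) = (x%:E * P B)%E.
Proof.
move=> mA mB; have [PB0|PB0 /(_ isT)] := eqVneq (P B) 0%E => [_|].
  rewrite PB0 mule0; apply/eqP; rewrite -measure_le0.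
  by rewrite -[leRHS]PB0 le_measure ?inE//; exact: measurableI.
have mAB : measurable (A `&` B) by exact: measurableI.
have fAB := fin_num_measure P _ mAB; have fB := fin_num_measure P _ mB.
rewrite /cprob => <-; rewrite -[P B in RHS]fineK// -EFinM mulfVK ?fineK//.
by rewrite fine_eq0.
Qed.

Local Notation M m n w :=
  (((D m n w)%:R - alpha) / (n%:R - alpha * (K n w)%:R)).
Local Notation atom n w0 := [set w | Pi n w = Pi n w0].

Lemma measurable_atom n w0 : measurable (atom n w0).
Proof. exact: rp_measurable. Qed.

Lemma determined_opens n : determined Pi n.+1 (opens Pi n).
Proof.
move=> w w' e; have e' : Pi n w = Pi n w' by exact: (rp_history rp _ e).
by rewrite /opens /num_classes e e'.
Qed.

Lemma determined_grows m n : determined Pi n.+1 (grows Pi m n).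
Proof.
move=> w w' e; have e' : Pi n w = Pi n w' by exact: (rp_history rp _ e).
by rewrite /grows e e'.
Qed.

Lemma measurable_opens n : measurable [set w | opens Pi n w].
Proof.
apply: (@measurable_determined _ _ _ rp n.+1) => w w' e /=.
by rewrite (determined_opens e).
Qed.

Lemma measurable_grows m n : measurable [set w | grows Pi m n w].
Proof.
apply: (@measurable_determined _ _ _ rp n.+1) => w w' e /=.
by rewrite (determined_grows m e).
Qed.

Lemma prob_opens n w0 : (0 < n)%N ->
  P ([set w | opens Pi n w] `&` atom n w0) =
  ((open_prob n (K n w0))%:E * P (atom n w0))%E.
Proof.
move=> n0.
rewrite -(@fine_cprob [set w | Pi n.+1 w = open_class n (Pi n w0)]); first last.
- exact: (egp_open hPi).
- exact: measurable_atom.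
- exact: rp_measurable.
by congr (P _); apply/seteqP; split=> w /= [oE e]; split=> //;
  [rewrite -e|]; apply/(opensP rp) => //; rewrite e.
Qed.

Lemma prob_grows m n w0 : (0 < n)%N -> (0 < m <= K n w0)%N ->
  P ([set w | grows Pi m n w] `&` atom n w0) =
  ((M m n w0 * (1 - open_prob n (K n w0)))%:E * P (atom n w0))%E.
Proof.
move=> n0 mK.
rewrite -(@fine_cprob [set w | Pi n.+1 w = join_class n (Pi n w0) m.-1]);
  first last.
- by move=> ?; apply: (egp_join hPi) => //; rewrite -/(K n w0); lia.
- exact: measurable_atom.
- exact: rp_measurable.
congr (P _); apply/seteqP; split=> w /= [gE e]; split=> //.
  by rewrite (eqP gE) e.
by rewrite /grows gE e.
Qed.

(** The integrated form of conditioning on [Pi n]: on an atom a, b and c are constant, and the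
    probabilities of opening a class and of joining class m are those of [egp_open] and [egp_join].
    All the other choices are lumped into c. *)
Lemma integral_step m r n (a b c : T -> R) : (0 < m)%N -> (r <= n)%N ->
  determined Pi n a -> determined Pi n b -> determined Pi n c ->
  (forall w, record_event Pi m r w -> 0 <= a w) ->
  (forall w, record_event Pi m r w -> 0 <= b w) ->
  (forall w, record_event Pi m r w -> 0 <= c w) ->
  (\int[P]_(w in record_event Pi m r)
     (if opens Pi n w then a w else if grows Pi m n w then b w else c w)%:E =
   \int[P]_(w in record_event Pi m r)
     (open_prob n (K n w) * a w + (1 - open_prob n (K n w)) *
      (M m n w * b w + (1 - M m n w) * c w))%:E)%E.
Proof.
move=> m0 rn da db dc a0 b0 c0.
have mE : measurable (record_event Pi m r).
  apply: (@measurable_determined _ _ _ rp r).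
  exact: determined_record.
have E0 w : record_event Pi m r w -> (0 < n)%N /\ (0 < m <= K n w)%N.
  move=> Ew; split; first by have := record_gt0 rp m0 Ew; lia.
  by rewrite m0 (record_num_classes_ge rp m0 Ew).
have M01 w : record_event Pi m r w -> 0 <= M m n w <= 1.
  move=> Ew; have [D0 DK] := record_size_bounds rp m0 Ew rn.
  have [n0 mK] := E0 _ Ew.
  have w0 : 0 < n%:R - alpha * (K n w)%:R.
    by apply: weight_gt0; rewrite num_classes_le//; lia.
  have D1 : 1 <= (D m n w)%:R :> R by rewrite ler1n.
  have K1 : 1 <= (K n w)%:R :> R by rewrite ler1n; lia.
  have DK1 : (D m n w)%:R + (K n w)%:R <= n%:R + 1 :> R.
    by rewrite -natrD natr1 ler_nat.
  have Da : 0 <= (D m n w)%:R - alpha by rewrite subr_ge0 (le_trans (ltW alpha1) D1).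
  rewrite (divr_ge0 Da (ltW w0))/= ler_pdivrMr// mul1r.
  (* This product is the gap between n - alpha K and n + 1 - K - alpha, the latter being an upper
     bound for D - alpha. *)
  have : 0 <= (1 - alpha) * ((K n w)%:R - 1).
    by rewrite mulr_ge0// subr_ge0// ltW.
  by lra.
have q01 w : record_event Pi m r w -> 0 <= open_prob n (K n w) <= 1.
  move=> Ew; apply: open_prob_itv; have [n0 mK] := E0 _ Ew.
  by rewrite num_classes_le//; lia.
have mdet U (f : T -> U) : determined Pi n f -> determined Pi n.+1 f.
  by apply: determinedW.
apply: (eq_integral_fibers (h1 := Pi n) (h2 := Pi n)) => //; try exact: rp_measurable.
- apply: measurable_funTS; apply/measurable_EFinP.
  apply: (@measurable_fun_determined _ _ _ rp _ _ n.+1) => w w' e.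
  rewrite (determined_opens e) (determined_grows m e).
  by rewrite (mdet _ _ da _ _ e) (mdet _ _ db _ _ e) (mdet _ _ dc _ _ e).
- move=> w Ew; rewrite lee_fin; case: ifP => _; first exact: a0.
  by case: ifP => _; [exact: b0|exact: c0].
- apply: measurable_funTS; apply/measurable_EFinP.
  apply: (@measurable_fun_determined _ _ _ rp _ _ n) => w w' e.
  by rewrite (da _ _ e) (db _ _ e) (dc _ _ e) /class_size /num_classes e.
- move=> w Ew; rewrite lee_fin.
  have := M01 _ Ew; have := q01 _ Ew.
  have := a0 _ Ew; have := b0 _ Ew; have := c0 _ Ew.
  move: (open_prob _ _) (M m n w) (a w) (b w) (c w) => q M a1 b1 c1.
  move=> c10 b10 a10 /andP[q0 q1] /andP[M0 M1].
  apply: addr_ge0; first exact: mulr_ge0.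
  apply: mulr_ge0; first by rewrite subr_ge0.
  by apply: addr_ge0; apply: mulr_ge0; rewrite ?subr_ge0.
move=> pi.
have [[w0 [Ew0 /= e0]]|nw] :=
    pselect (exists w, (record_event Pi m r `&` Pi n @^-1` [set pi]) w); last first.
  rewrite (_ : _ `&` _ = set0) ?integral_set0// -subset0 => w Ew.
  by apply: nw; exists w.
have -> : record_event Pi m r `&` Pi n @^-1` [set pi] = atom n w0.
  apply/seteqP; split=> w /=; first by move=> [_ ->].
  by move=> e; split; [rewrite (determined_record rp m0 rn e)|rewrite e].
set B := atom n w0.
have mB : measurable B by exact: measurable_atom.
pose O := [set w | opens Pi n w] `&` B.
pose J := [set w | grows Pi m n w] `&` B.
have mO : measurable O by apply: measurableI => //; exact: measurable_opens.
have mJ : measurable J by apply: measurableI => //; exact: measurable_grows.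
have EB w : B w -> record_event Pi m r w.
  by move=> Bw; rewrite (determined_record rp m0 rn Bw).
have OJ : O `&` J = set0.
  rewrite -subset0 => w [[/= ow Bw] [gw _]].
  by move: ow; rewrite (grows_nopens rp m0 (EB _ Bw) rn gw).
have [n0 mK] := E0 _ Ew0.
transitivity ((a w0)%:E * P O + (b w0)%:E * P J + (c w0)%:E * P (B `\` (O `|` J)))%E.
  have BE : B = (O `|` J) `|` (B `\` (O `|` J)).
    by rewrite setDUK// subUset; split; apply: subIsetr.
  have mOJ : measurable (O `|` J) by exact: measurableU.
  have mf (S : set T) : measurable_fun S (fun w => (if opens Pi n w then a w
      else if grows Pi m n w then b w else c w)%:E).
    apply: measurable_funTS; apply/measurable_EFinP.
    apply: (@measurable_fun_determined _ _ _ rp _ _ n.+1) => w w' e.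
    rewrite (determined_opens e) (determined_grows m e).
    by rewrite (mdet _ _ da _ _ e) (mdet _ _ db _ _ e) (mdet _ _ dc _ _ e).
  have f0 w : B w -> (0 <= (if opens Pi n w then a w
      else if grows Pi m n w then b w else c w)%:E)%E.
    move=> /EB Ew; rewrite lee_fin; case: ifP => _; first exact: a0.
    by case: ifP => _; [exact: b0|exact: c0].
  rewrite [in LHS]BE ge0_integral_setU//; last first.
  - by apply/disj_set2P; rewrite setDE setICA setICr setI0.
  - by rewrite -BE.
  - exact: measurableD.
  rewrite ge0_integral_setU//; last first.
  - exact/disj_set2P.
  - by move=> w [] [_ /f0].
  congr (_ + _ + _)%E.
  - rewrite -(integral_cst P mO); apply: eq_integral => w.
    by rewrite inE => -[/= -> Bw]; rewrite /cst (da _ _ Bw).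
  - rewrite -(integral_cst P mJ); apply: eq_integral => w.
    rewrite inE => -[/= gw Bw].
    by rewrite (grows_nopens rp m0 (EB _ Bw) rn gw) gw /cst (db _ _ Bw).
  - rewrite -(integral_cst P); last exact: measurableD.
    apply: eq_integral => w; rewrite inE => -[Bw nOJ].
    rewrite ifF; last by apply/negP => ow; apply: nOJ; left.
    rewrite ifF; last by apply/negP => gw; apply: nOJ; right.
    by rewrite /cst (dc _ _ Bw).
have -> : P (B `\` (O `|` J)) = (P B - (P O + P J))%E.
  rewrite measureD//; [|exact: measurableU|by rewrite ltey_eq fin_num_measure].
  rewrite setIidr; last by rewrite subUset; split; apply: subIsetr.
  by congr (_ - _)%E; exact: measureU.
have -> : P O = ((open_prob n (K n w0))%:E * P B)%E by exact: prob_opens.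
have -> : P J = ((M m n w0 * (1 - open_prob n (K n w0)))%:E * P B)%E.
  exact: prob_grows.
under eq_integral => w.
  rewrite inE => Bw; rewrite (da _ _ Bw) (db _ _ Bw) (dc _ _ Bw).
  have -> : K n w = K n w0 by rewrite /num_classes Bw.
  have -> : D m n w = D m n w0 by rewrite /class_size Bw.
  over.
rewrite /= (integral_cst P mB (_%:E)).
have fB := fin_num_measure P _ mB.
apply: (@etrans _ _ (_ * (fine (P B))%:E)%E); last first.
  by congr (_ * _)%E; exact: fineK.
rewrite -(fineK fB) -!(EFinM, EFinD, EFinB); congr EFin.
by ring.
Qed.

End OneStep.

(** * Rising factorials and the urn identity *)

Definition rising (R : numDomainType) (x : R) (p : nat) : R :=
  \prod_(i < p) (x + i%:R).

Lemma rising_gt0 (R : numDomainType) (x : R) p : 0 < x -> 0 < rising x p.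
Proof. by move=> x0; apply: prodr_gt0 => i _; rewrite ltr_wpDr. Qed.

Lemma risingS (R : numDomainType) (x : R) p :
  rising x p.+1 = rising x p * (x + p%:R).
Proof. exact: big_ord_recr. Qed.

(** Both sides are the rising factorial with p + 1 factors, with the first or the last factor split
    off. *)
Lemma rising_shift (R : numDomainType) (x : R) p :
  x * rising (x + 1) p = rising x p * (x + p%:R).
Proof.
rewrite -risingS /rising [RHS]big_ord_recl addr0; congr (_ * _).
by apply: eq_bigr => i _; rewrite lift0 -addrA -[in RHS]natr1 (addrC 1).
Qed.

(* One non-record step of the urn in which x is the weight of the distinguished
   class and w the total weight preserves the ratio of rising factorials. *)
Lemma rising_urn (R : numFieldType) (x w : R) p : 0 < w ->
  x / w * (rising (x + 1) p / rising (w + 1) p) +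
  (1 - x / w) * (rising x p / rising (w + 1) p) = rising x p / rising w p.
Proof.
move=> w0; have w1 : w != 0 by rewrite gt_eqF.
have r0 : rising w p != 0 by rewrite gt_eqF// rising_gt0.
have wp : w + p%:R != 0 by rewrite gt_eqF// ltr_wpDr.
have -> : rising (w + 1) p = rising w p * (w + p%:R) / w.
  by rewrite -(rising_shift w) mulrC mulKf.
have -> : x / w * (rising (x + 1) p / (rising w p * (w + p%:R) / w)) =
          rising x p * (x + p%:R) / (rising w p * (w + p%:R)).
  by rewrite -(rising_shift x); field; rewrite r0 wp w1.
by field; rewrite r0 wp w1.
Qed.

(** * The share of the m-th class and its compensation *)

Section Martingale.
Context d (T : measurableType d) (R : realType) (P : probability T R).
Variables (alpha : R) (V : nat -> nat -> R) (Pi : nat -> T -> seq (seq nat)).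
Hypothesis (alpha1 : alpha < 1) (hPi : EGP P alpha V Pi).
Variables (m r : nat) (m0 : (0 < m)%N).

Local Notation K := (num_classes Pi).
Local Notation D := (class_size Pi m).
Local Notation E := (record_event Pi m r).
Let rp : random_partition Pi := egp_partition hPi.

(** The sum of n_j - alpha over the k classes, that is, the normalising constant of the joining
    probabilities. *)
Definition weight (n k : nat) : R := n%:R - alpha * k%:R.
Local Notation W n w := (weight n (K n w)).
Definition share n w : R := ((D n w)%:R - alpha) / W n w.
(* The share only loses mass in the mean at record times; adding back the losses
   gives a martingale with increments O(1/n). *)
Definition loss n w : R :=
  if opens Pi n w then share n w * (1 - alpha) / (W n w + 1 - alpha) else 0.
Definition compensator n w : R := \sum_(r <= i < n) loss i w.
Definition compensated n w : R := share n w + compensator n w.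

Lemma measurable_record : measurable E.
Proof.
apply: (@measurable_determined _ _ _ rp r).
exact: (determined_record rp).
Qed.

Lemma weightS n k : weight n.+1 k = weight n k + 1.
Proof. by rewrite /weight -natr1; ring. Qed.

Lemma weightSS n k : weight n.+1 k.+1 = weight n k + 1 - alpha.
Proof. by rewrite /weight -!natr1; ring. Qed.

(** For alpha <= 0 the weight is at least n; for alpha > 0 it is at least (1 - alpha) n because k <=
    n. This linear growth makes the martingale increments O(1/n). *)
Lemma weight_ge n k : (0 < k <= n)%N -> Num.min 1 (1 - alpha) * n%:R <= weight n k.
Proof.
move=> /andP[k0 kn]; rewrite /weight.
have kn' : k%:R <= n%:R :> R by rewrite ler_nat.
have k1 : 0 < k%:R :> R by rewrite ltr0n.
rewrite minEle; case: ifPn; rewrite -?ltNge => h.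
  have a0 : 0 <= - alpha by lra.
  by have := mulr_ge0 a0 (ltW k1); lra.
have a0 : 0 <= alpha by lra.
have nk : 0 <= n%:R - k%:R :> R by lra.
by have := mulr_ge0 a0 nk; lra.
Qed.

Lemma weight_le n k : (k <= n)%N -> weight n k <= (1 + `|alpha|) * n%:R.
Proof.
move=> kn; rewrite /weight mulrDl mul1r lerD2l.
rewrite (le_trans (ler_norm _))// normrN normrM ler_wpM2l//.
by rewrite ger0_norm ?ler_nat.
Qed.

Lemma determined_share n : determined Pi n (share n).
Proof. by move=> w w' e; rewrite /share /class_size /num_classes e. Qed.

Lemma determined_loss n : determined Pi n.+1 (loss n).
Proof.
move=> w w' e; have e' : Pi n w = Pi n w' by exact: (rp_history rp _ e).
rewrite /loss (determined_opens hPi e) (determined_share e').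
by rewrite /num_classes e'.
Qed.

Lemma determined_compensator n : determined Pi n (compensator n).
Proof.
move=> w w' e; rewrite /compensator; apply: eq_big_nat => i /andP[_ i_n].
by apply: determined_loss; exact: (rp_history rp i_n e).
Qed.

Lemma determined_compensated n : determined Pi n (compensated n).
Proof.
move=> w w' e; rewrite /compensated.
by rewrite (determined_share e) (determined_compensator e).
Qed.

Section Pathwise.
Variables (w : T) (Ew : E w) (n : nat) (rn : (r <= n)%N).

Lemma record_weight_gt0 : 0 < W n w.
Proof.
have n0 : (0 < n)%N by have := record_gt0 rp m0 Ew; lia.
by apply: weight_gt0 => //; rewrite num_classes_le// num_classes_gt0.
Qed.

Lemma record_weight_ge : Num.min 1 (1 - alpha) * n%:R <= W n w.
Proof.
have n0 : (0 < n)%N by have := record_gt0 rp m0 Ew; lia.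
by apply: weight_ge => //; rewrite num_classes_le// num_classes_gt0.
Qed.

Lemma class_weight_gt0 : 0 < (D n w)%:R - alpha.
Proof.
have [D0 _] := record_size_bounds rp m0 Ew rn.
have D1 : 1 <= (D n w)%:R :> R by rewrite ler1n.
by rewrite subr_gt0 (lt_le_trans alpha1 D1).
Qed.

Lemma class_weight_le : (D n w)%:R - alpha <= W n w.
Proof.
have [D0 DK] := record_size_bounds rp m0 Ew rn.
have K0 : (m <= K n w)%N by exact: (record_num_classes_ge rp m0 Ew rn).
have K1 : 1 <= (K n w)%:R :> R by rewrite ler1n; lia.
have DK1 : (D n w)%:R + (K n w)%:R <= n%:R + 1 :> R.
  by rewrite -natrD natr1 ler_nat.
have : 0 <= (1 - alpha) * ((K n w)%:R - 1).
  by rewrite mulr_ge0// subr_ge0// ltW.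
by rewrite /weight; lra.
Qed.

Lemma share_itv : 0 <= share n w <= 1.
Proof.
have W0 := record_weight_gt0; rewrite /share ler_pdivrMr// mul1r.
by rewrite class_weight_le divr_ge0// ltW// class_weight_gt0.
Qed.

Lemma loss_ge0 : 0 <= loss n w.
Proof.
rewrite /loss; case: ifP => // _; have /andP[M0 _] := share_itv.
have := record_weight_gt0; have := alpha1 => a1 W0.
have a0 : 0 <= 1 - alpha by lra.
by apply: divr_ge0; [exact: (mulr_ge0 M0 a0)|lra].
Qed.

Lemma record_weightS : W n.+1 w =
  if opens Pi n w then W n w + 1 - alpha else W n w + 1.
Proof. by rewrite (record_stepK rp m0 w n); case: ifP; rewrite (weightSS, weightS). Qed.

(** At a record the denominator grows from W to W + 1 - alpha and the share drops by exactly [loss].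
    At other times it grows to W + 1, and the increments (1 - M) / (W + 1) and - M / (W + 1), taken
    with probabilities M and 1 - M, cancel in mean. *)
Lemma compensatedS : compensated n.+1 w =
  if opens Pi n w then compensated n w
  else if grows Pi m n w then compensated n w + (1 - share n w) / (W n w + 1)
  else compensated n w - share n w / (W n w + 1).
Proof.
have W0 := record_weight_gt0.
have W1 : W n w + 1 - alpha != 0 by rewrite gt_eqF//; have := alpha1; lra.
have W2 : W n w + 1 != 0 by rewrite gt_eqF//; lra.
have W3 : W n w != 0 by rewrite gt_eqF.
rewrite /compensated /compensator big_nat_recr//=.
rewrite {1}/share record_weightS (record_stepD rp m0 Ew rn) {2}/loss.
case: ifP => _; last case: ifP => _.
- by rewrite /share; field; rewrite W1 W3.
- by rewrite -natr1 /share; field; rewrite W2 W3.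
- by rewrite /share; field; rewrite W2 W3.
Qed.

End Pathwise.

Lemma compensator_ge0 w n : E w -> 0 <= compensator n w.
Proof.
move=> Ew; rewrite /compensator big_nat_cond.
by apply: sumr_ge0 => i /andP[/andP[ri _] _]; exact: loss_ge0.
Qed.

End Martingale.

(** * Moments of the share along a path of the class count *)

Section PathMoments.
Context d (T : measurableType d) (R : realType) (P : probability T R).
Variables (alpha : R) (V : nat -> nat -> R) (Pi : nat -> T -> seq (seq nat)).
Hypothesis (alpha1 : alpha < 1) (hPi : EGP P alpha V Pi).
Variables (m r : nat) (m0 : (0 < m)%N).

Local Notation K := (num_classes Pi).
Local Notation D := (class_size Pi m).
Local Notation E := (record_event Pi m r).
Local Notation W n w := (weight alpha n (K n w)).
Let rp : random_partition Pi := egp_partition hPi.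

Definition K_path (k : nat -> nat) n : set T :=
  [set w | forall l, (r <= l <= n)%N -> K l w = k l].

Lemma determined_K_path k n : determined Pi n (K_path k n).
Proof.
move=> w w' e; apply/propext; split=> h l rl; rewrite -(h l)//.
- by apply: esym; apply: (determined_num_classes rp _ e); case/andP: rl.
- by apply: (determined_num_classes rp _ e); case/andP: rl.
Qed.

Lemma K_pathS k n w : (r <= n)%N ->
  K_path k n.+1 w <-> K_path k n w /\ K n.+1 w = k n.+1.
Proof.
move=> rn; split=> [h|[h hn] l rl].
  by split=> [l rl|]; apply: h; lia.
have [->//|ln] := eqVneq l n.+1; apply: h; lia.
Qed.

(** A substitute for the p-th power of the share: it lies in [0, 1] and has the same limit, but
    obeys an exact one-step identity. *)
Definition rising_share p n w : R :=
  rising ((D n w)%:R - alpha) p / rising (W n w) p.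

Definition path_share k p n w : R :=
  if `[< K_path k n w >] then rising_share p n w else 0.

Definition path_factor p n k k' : R :=
  if k' == k.+1 then rising (weight alpha n k) p / rising (weight alpha n.+1 k') p
  else 1.

Let step_prob (k : nat -> nat) n : R :=
  if k n.+1 == (k n).+1 then open_prob V n (k n)
  else if k n.+1 == k n then 1 - open_prob V n (k n) else 0.

Lemma rising_share_ge0 p n w : E w -> (r <= n)%N -> 0 <= rising_share p n w.
Proof.
move=> Ew rn; rewrite /rising_share divr_ge0// ltW// rising_gt0//.
  exact: (class_weight_gt0 alpha1 hPi m0 Ew rn).
exact: (record_weight_gt0 alpha1 hPi m0 Ew rn).
Qed.

Lemma path_share_ge0 k p n w : E w -> (r <= n)%N -> 0 <= path_share k p n w.
Proof.
by move=> Ew rn; rewrite /path_share; case: ifP => // _; exact: rising_share_ge0.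
Qed.

Lemma determined_rising_share p n : determined Pi n (rising_share p n).
Proof. by move=> w w' e; rewrite /rising_share /class_size /num_classes e. Qed.

Lemma determined_path_share k p n : determined Pi n (path_share k p n).
Proof.
move=> w w' e; rewrite /path_share (determined_K_path k e).
by rewrite (determined_rising_share p e).
Qed.

(** After an opening only the total weight changes, which produces the path factor; otherwise
    [rising_urn] applies, with x the weight of the class and w the total weight. The transition
    probability of K splits off and does not depend on p. *)
Let integral_path_shareS k p n : (r <= n)%N ->
  (\int[P]_(w in E) (path_share k p n.+1 w)%:E =
   (step_prob k n * path_factor p n (k n) (k n.+1))%:E *
   \int[P]_(w in E) (path_share k p n w)%:E)%E.
Proof.
move=> rn.
(* A value of k n outside 1..n is never attained, and then both sides vanish. *)
have [kn|kn] := boolP (0 < k n <= n)%N; last first.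
  have nopath w : E w -> ~ K_path k n w.
    move=> Ew h; move/negP: kn; apply; rewrite -h ?rn ?leqnn//.
    rewrite (num_classes_le rp) andbT (num_classes_gt0 rp)//.
    by have := record_gt0 rp m0 Ew; lia.
  rewrite integral0_eq; last first.
    move=> w Ew; rewrite /path_share ifF//; apply/negP => /asboolP.
    by move=> /(K_pathS _ _ rn)[+ _]; exact: nopath.
  rewrite [X in (_ * X)%E]integral0_eq ?mule0// => w Ew.
  by rewrite /path_share ifF//; apply/negP => /asboolP; exact: nopath.
pose v (w : T) := (D n w)%:R - alpha.
pose a w : R := if `[< K_path k n w >] && (k n.+1 == (K n w).+1) then
  rising (v w) p / rising (W n w + 1 - alpha) p else 0.
pose b w : R := if `[< K_path k n w >] && (k n.+1 == K n w) then
  rising (v w + 1) p / rising (W n w + 1) p else 0.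
pose c w : R := if `[< K_path k n w >] && (k n.+1 == K n w) then
  rising (v w) p / rising (W n w + 1) p else 0.
have v0 w : E w -> 0 < v w by move=> Ew; apply: (class_weight_gt0 alpha1 hPi m0 Ew rn).
have W0 w : E w -> 0 < W n w by move=> Ew; apply: (record_weight_gt0 alpha1 hPi m0 Ew rn).
have a1 := alpha1.
have q01 := open_prob_itv alpha1 hPi kn.
rewrite -ge0_integralZl_EFin; first last.
- rewrite /step_prob /path_factor mulr_ge0//.
    by case: ifP => _; [|case: ifP => // _]; lra.
  case: ifP => // /eqP ->; have wn : 0 < weight alpha n (k n) by exact: weight_gt0.
  by rewrite divr_ge0// ltW// rising_gt0// weightSS; lra.
- apply: measurable_funTS; apply/measurable_EFinP.
  apply: (@measurable_fun_determined _ _ _ rp _ _ n).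
  exact: determined_path_share.
- by move=> w Ew; rewrite lee_fin path_share_ge0.
- exact: (measurable_record hPi r m0).
transitivity (\int[P]_(w in E) (if opens Pi n w then a w
    else if grows Pi m n w then b w else c w)%:E)%E.
  apply: eq_integral => w; rewrite inE => Ew; congr EFin.
  rewrite /path_share /rising_share (record_weightS hPi m0 w n).
  rewrite (record_stepD rp m0 Ew rn).
  have -> : `[< K_path k n.+1 w >] =
      `[< K_path k n w >] && (k n.+1 == K n.+1 w).
    apply/asboolP/andP => [/(K_pathS _ _ rn)[h ->]|[/asboolP h /eqP e]].
      by split=> //; exact/asboolP.
    exact/(K_pathS _ _ rn).
  rewrite (record_stepK rp m0 w n) /a /b /c.
  by case: (opens Pi n w) => //; case: (grows Pi m n w); rewrite // -natr1 /v addrAC.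
rewrite (integral_step alpha1 hPi)//; first last.
- move=> w Ew; rewrite /c; case: ifP => // _; rewrite divr_ge0// ltW// rising_gt0 ?v0//.
  by have := W0 _ Ew; lra.
- move=> w Ew; rewrite /b; case: ifP => // _; have := v0 _ Ew; have := W0 _ Ew => ? ?.
  by rewrite divr_ge0// ltW// rising_gt0//; lra.
- move=> w Ew; rewrite /a; case: ifP => // _; rewrite divr_ge0// ltW// rising_gt0 ?v0//.
  by have := W0 _ Ew; lra.
- by move=> w w' e; rewrite /c (determined_K_path k e) /v /class_size /num_classes e.
- by move=> w w' e; rewrite /b (determined_K_path k e) /v /class_size /num_classes e.
- by move=> w w' e; rewrite /a (determined_K_path k e) /v /class_size /num_classes e.
apply: eq_integral => w; rewrite inE => Ew; rewrite -EFinM; congr EFin.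
rewrite /a /b /c /path_share; case: asboolP => /= [h|_]; last by rewrite !mulr0 addr0 mulr0 addr0.
have Kk : K n w = k n by apply: h; rewrite rn leqnn.
rewrite /step_prob /path_factor /rising_share Kk.
have [->|k1] := eqVneq (k n.+1) (k n).+1.
  have wn : 0 < weight alpha n (k n) by exact: weight_gt0.
  have -> : ((k n).+1 == k n) = false by apply/eqP; lia.
  have wn0 : rising (weight alpha n (k n)) p != 0 by rewrite gt_eqF// rising_gt0.
  have wn1 : rising (weight alpha n (k n) + 1 - alpha) p != 0.
    by rewrite gt_eqF// rising_gt0//; lra.
  by rewrite !(mulr0, addr0) weightSS /v; field; rewrite wn0 wn1.
case: ifP => _; last by rewrite !(mulr0, mul0r, addr0).
rewrite mulr0 add0r mulr1; congr (_ * _).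
by apply: rising_urn; rewrite -Kk W0.
Qed.

(** For p = 0 the one-step identity describes the probability of the path itself. Comparing it with
    general p absorbs the transition probabilities into that probability and leaves the path
    factors. The initial ratio comes from D_r = 1 and K_r = m. *)
Lemma integral_path_share k p n : (r <= n)%N ->
  (\int[P]_(w in E) (path_share k p n w)%:E =
   (rising (1 - alpha) p / rising (weight alpha r m) p *
    \prod_(r <= i < n) path_factor p i (k i) (k i.+1))%:E * P (K_path k n `&` E))%E.
Proof.
have [Ene|nE] := pselect (exists w, E w); last first.
  have -> : E = set0 by rewrite -subset0 => w Ew; apply: nE; exists w.
  by rewrite integral_set0 setI0 measure0 mule0.
have mE : measurable E by exact: (measurable_record hPi r m0).
have mK j : measurable (K_path k j).
  by apply: (measurable_determined rp); exact: determined_K_path.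
have P0 j : (r <= j)%N ->
    (\int[P]_(w in E) (path_share k 0 j w)%:E = P (K_path k j `&` E))%E.
  move=> rj; rewrite -(integral_indic P mE (mK j)).
  apply: eq_integral => w _.
  rewrite /path_share /rising_share /rising !big_ord0 divr1 indicE.
  by case: asboolP => [h|h]; [rewrite mem_set|rewrite memNset].
move=> /subnKC <-; elim: (n - r)%N => [|j IH]; last first.
  have rj : (r <= r + j)%N by rewrite leq_addr.
  rewrite addnS integral_path_shareS// IH -(P0 _ (leqW rj)).
  rewrite integral_path_shareS// P0// big_nat_recr//= /path_factor.
  case: ifP => _; rewrite /rising ?big_ord0 ?divr1 ?mulr1.
    by rewrite !muleA -!EFinM; congr (_%:E * _)%E; ring.
  by rewrite !muleA -!EFinM; congr (_%:E * _)%E; ring.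
rewrite addn0 big_geq// mulr1 -P0// -ge0_integralZl_EFin//; first last.
- have [w Ew] := Ene; have := rising_share_ge0 p Ew (leqnn r); rewrite /rising_share.
  by rewrite (record_class_size rp m0 Ew) (record_num_classes rp m0 Ew).
- apply: measurable_funTS; apply/measurable_EFinP.
  apply: (@measurable_fun_determined _ _ _ rp _ _ r).
  exact: determined_path_share.
- by move=> w Ew; rewrite lee_fin path_share_ge0.
apply: eq_integral => w; rewrite inE => Ew; rewrite -EFinM; congr EFin.
rewrite /path_share; case: ifP => _; last by rewrite mulr0.
rewrite /rising_share (record_class_size rp m0 Ew) (record_num_classes rp m0 Ew).
by rewrite /rising !big_ord0 divr1 mulr1.
Qed.

End PathMoments.

(** * Almost sure convergence of the frequencies *)

(** By monotone convergence the sum of the series is integrable, hence finite almost everywhere. *)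
Lemma ae_cvg_series d (T : measurableType d) (R : realType)
    (mu : {measure set T -> \bar R}) (D : set T) (u : nat -> T -> R) (B : R) :
  measurable D -> (forall n, measurable_fun D (u n)) ->
  (forall n x, D x -> 0 <= u n x) ->
  (forall n, \int[mu]_(x in D) (\sum_(i < n) u i x)%:E <= B%:E)%E ->
  {ae mu, forall x, D x -> cvgn (series (u ^~ x))}.
Proof.
move=> mD mu_ u0 uB.
pose f x := (\sum_(0 <= i <oo) (u i x)%:E)%E.
have u0' n x : D x -> (0 <= (u n x)%:E)%E by move=> Dx; rewrite lee_fin u0.
have mf : measurable_fun D f.
  apply: ge0_emeasurable_sum => //; first by move=> n x Dx _; exact: u0'.
  by move=> n _; apply/measurable_EFinP; exact: mu_.
have intf : mu.-integrable D f.
  apply/integrableP; split => //; apply: (@le_lt_trans _ _ B%:E); last exact: ltry.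
  under eq_integral => x.
    rewrite inE => Dx; rewrite gee0_abs; last first.
      by apply: nneseries_ge0 => n _ _; exact: u0'.
    over.
  rewrite integral_nneseries//; last by move=> n; apply/measurable_EFinP; exact: mu_.
  apply: lime_le.
    by apply: is_cvg_nneseries => n _ _; apply: integral_ge0 => x; exact: u0'.
  near=> n; rewrite -ge0_integral_sum//; last first.
    by move=> i; apply/measurable_EFinP; exact: mu_.
  apply: le_trans (uB n); rewrite le_eqVlt; apply/orP; left; apply/eqP.
  by apply: eq_integral => x _; rewrite sumEFin big_mkord.
have := integrable_ae mD intf; apply: filterS => x fx Dx.
have {}fx := fx Dx.
apply: nondecreasing_is_cvgn.
  by apply: nondecreasing_series => n _ _; exact: u0.
exists (fine (f x)) => _ [n _ <-]; rewrite -lee_fin fineK// /series/= -sumEFin.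
by apply: nneseries_lim_ge => i *; exact: u0'.
Unshelve. all: by end_near. Qed.

Section SlowSequence.
Variables (R : realType) (u : nat -> R) (C : R) (r : nat).
Hypotheses (C0 : 0 <= C) (r0 : (0 < r)%N).
Hypothesis du : forall n, (r <= n)%N -> `|u n.+1 - u n| <= C / n%:R.

Lemma slow_dist n j : (r <= n)%N -> `|u (n + j)%N - u n| <= j%:R * (C / n%:R).
Proof.
move=> rn; have n0 : 0 < n%:R :> R by rewrite ltr0n; lia.
elim: j => [|j IH]; first by rewrite addn0 subrr normr0 mul0r.
rewrite addnS -natr1 mulrDl mul1r.
have -> : u (n + j).+1 - u n = (u (n + j)%N - u n) + (u (n + j).+1 - u (n + j)%N).
  by ring.
apply: le_trans (ler_normD _ _) _; apply: lerD => //.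
apply: le_trans (du _) _; first by lia.
by rewrite ler_wpM2l// lef_pV2 ?posrE ?ltr0n ?ler_nat//; lia.
Qed.

(** After k^3 and before the next cube there are at most 7 k^2 steps, each of size at most C / k^3,
    so the sequence moves by at most 7 C / k. *)
Lemma cvg_slow_cubes : cvgn (fun k => u ((k + r) ^ 3)%N) -> cvgn u.
Proof.
move=> /cvg_ex[/= l ul]; apply/cvg_ex; exists l; apply/cvgrPdist_le => e e0.
move/cvgrPdist_le: ul => /(_ (e / 2)); rewrite divr_gt0// => /(_ isT)[N1 _ hN1].
(* Chosen so that 7 C / k <= e / 2 as soon as k >= N2. *)
pose N2 := (Num.truncn (14%:R * C / e)).+1.
have hN2 : 14%:R * C / e < N2%:R by rewrite truncnS_gt.
pose N := (N1 + N2)%N.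
exists ((N + r) ^ 3)%N => // n /= Nn.
have ex0 : exists k, (k ^ 3 <= n)%N by exists 0%N.
have ub k : (k ^ 3 <= n)%N -> (k <= n)%N.
  by case: k => // k; apply: leq_trans; rewrite -{1}(expn1 k.+1) leq_pexp2l.
have [k kn kmax] := ex_maxnP ex0 ub.
have Nk : (N + r <= k)%N by exact: kmax.
have nk : (n < k.+1 ^ 3)%N.
  by rewrite ltnNge; apply/negP => /kmax; rewrite ltnn.
have k0 : 0 < k%:R :> R by rewrite ltr0n; lia.
have rk : (r <= k ^ 3)%N.
  have : (k ^ 1 <= k ^ 3)%N by rewrite leq_pexp2l//; lia.
  by rewrite expn1; lia.
have nE : n = (k ^ 3 + (n - k ^ 3))%N by rewrite subnKC.
have h1 : `|l - u (k ^ 3)%N| <= e / 2.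
  by have := hN1 (k - r)%N; rewrite /= subnK; [apply; rewrite /=; lia|lia].
have h2 : `|u n - u (k ^ 3)%N| <= e / 2.
  rewrite {1}nE; apply: le_trans (slow_dist _ rk) _.
  have : (n - k ^ 3)%:R <= 7%:R * k%:R ^+ 2 :> R.
    rewrite -natrX -natrM ler_nat.
    have k1 : (0 < k)%N by lia.
    have : (n < k ^ 3 + 3 * k ^ 2 + 3 * k + 1)%N.
      by apply: leq_trans nk _; rewrite !expnS !expn0; nia.
    by rewrite !expnS !expn0; nia.
  move=> h; apply: (@le_trans _ _ (7%:R * k%:R ^+ 2 * (C / (k ^ 3)%:R))).
    by rewrite ler_wpM2r// divr_ge0.
  have -> : 7%:R * k%:R ^+ 2 * (C / (k ^ 3)%:R) = 7%:R * C / k%:R.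
    by rewrite natrX; field; rewrite gt_eqF.
  rewrite ler_pdivrMr//.
  have : 14%:R * C / e <= k%:R.
    by apply: le_trans (ltW hN2) _; rewrite ler_nat; lia.
  by rewrite ler_pdivrMr//; lra.
have -> : l - u n = (l - u (k ^ 3)%N) - (u n - u (k ^ 3)%N) by ring.
by apply: le_trans (ler_normB _ _) _; lra.
Qed.

End SlowSequence.

Section AlmostSureLimit.
Context d (T : measurableType d) (R : realType) (P : probability T R).
Variables (alpha : R) (V : nat -> nat -> R) (Pi : nat -> T -> seq (seq nat)).
Hypothesis (alpha1 : alpha < 1) (hPi : EGP P alpha V Pi).
Variables (m r : nat) (m0 : (0 < m)%N).

Local Notation K := (num_classes Pi).
Local Notation D := (class_size Pi m).
Local Notation E := (record_event Pi m r).
Local Notation W n w := (weight alpha n (K n w)).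
Local Notation M := (share alpha Pi m).
Local Notation A := (compensator alpha Pi m r).
Local Notation L := (compensated alpha Pi m r).
Local Notation c0 := (Num.min 1 (1 - alpha)).
Let rp : random_partition Pi := egp_partition hPi.

Let c0_gt0 : 0 < c0.
Proof. by rewrite lt_min ltr01 subr_gt0. Qed.

Let mE : measurable E.
Proof. exact: (measurable_record hPi r m0). Qed.

Let W0 w n : E w -> (r <= n)%N -> 0 < W n w.
Proof. by move=> Ew rn; exact: (record_weight_gt0 alpha1 hPi m0 Ew rn). Qed.

Let M01 w n : E w -> (r <= n)%N -> 0 <= M n w <= 1.
Proof. by move=> Ew rn; exact: (share_itv alpha1 hPi m0 Ew rn). Qed.

Let q01 w n : E w -> (r <= n)%N -> 0 <= open_prob V n (K n w) <= 1.
Proof.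
move=> Ew rn; apply: (open_prob_itv alpha1 hPi).
rewrite (num_classes_le rp) andbT (num_classes_gt0 rp)//.
by have := record_gt0 rp m0 Ew; lia.
Qed.

Let E_gt0 w n : E w -> (r <= n)%N -> 0 < n%:R :> R.
Proof. by move=> Ew rn; rewrite ltr0n; have := record_gt0 rp m0 Ew; lia. Qed.

Let invW w n : E w -> (r <= n)%N -> 0 <= (W n w + 1)^-1 <= c0^-1 / n%:R.
Proof.
move=> Ew rn; have w0 := W0 Ew rn; have n0 := E_gt0 Ew rn.
rewrite invr_ge0 ltW/=; last by lra.
rewrite -invfM lef_pV2 ?posrE ?mulr_gt0//; last by lra.
by have := record_weight_ge alpha1 hPi m0 Ew rn; lra.
Qed.

Let measurable_L n : (r <= n)%N -> measurable_fun E (L n).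
Proof.
move=> rn; apply: measurable_funTS.
apply: (@measurable_fun_determined _ _ _ rp _ _ n).
exact: (determined_compensated hPi).
Qed.

Lemma compensated_step w n : E w -> (r <= n)%N ->
  `|L n.+1 w - L n w| <= c0^-1 / n%:R.
Proof.
move=> Ew rn; rewrite (compensatedS alpha1 hPi m0 Ew rn).
have /andP[i0 ile] := invW Ew rn.
have /andP[M0 M1] := M01 Ew rn.
case: ifP => _; first by rewrite subrr normr0; exact: le_trans i0 ile.
case: ifP => _; rewrite addrC addKr.
  have M1' : 0 <= 1 - M n w by rewrite subr_ge0.
  rewrite (ger0_norm (mulr_ge0 M1' i0)); apply: (le_trans _ ile).
  by rewrite ler_piMl// gerBl.
have p0 : 0 <= M n w / (W n w + 1) by exact: mulr_ge0 M0 i0.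
rewrite normrN (ger0_norm p0); apply: (le_trans _ ile).
by rewrite ler_piMl.
Qed.

Lemma integral_compensated n : (r <= n)%N ->
  (\int[P]_(w in E) (L n w)%:E = \int[P]_(w in E) (L r w)%:E)%E.
Proof.
move=> /subnK <-; elim: (n - r)%N => [//|j IH].
have rj : (r <= j + r)%N by rewrite leq_addl.
rewrite addSn -IH; move: (j + r)%N rj {IH} => {}n rn.
have dM : determined Pi n (M n) by exact: determined_share.
have dL : determined Pi n (L n) by exact: (determined_compensated hPi).
pose b w := L n w + (1 - M n w) / (W n w + 1).
pose c w := L n w - M n w / (W n w + 1).
have A0 w : E w -> 0 <= A n w by move=> Ew; exact: (compensator_ge0 alpha1 hPi m0).
transitivity (\int[P]_(w in E) (if opens Pi n w then L n w
    else if grows Pi m n w then b w else c w)%:E)%E.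
  apply: eq_integral => w; rewrite inE => Ew.
  by rewrite (compensatedS alpha1 hPi m0 Ew rn).
rewrite (integral_step alpha1 hPi)//.
- apply: eq_integral => w; rewrite inE => Ew; congr EFin.
  rewrite -/(weight alpha n (K n w)) -/(M n w) /b /c.
  by have := W0 Ew rn => w0; field; rewrite gt_eqF//; lra.
- by move=> w w' e; rewrite /b (dL _ _ e) (dM _ _ e) /num_classes e.
- by move=> w w' e; rewrite /c (dL _ _ e) (dM _ _ e) /num_classes e.
- by move=> w Ew; rewrite addr_ge0 ?A0//; case/andP: (M01 Ew rn).
- move=> w Ew; have /andP[M0 M1] := M01 Ew rn; rewrite /b /compensated.
  rewrite !addr_ge0 ?A0// mulr_ge0 ?subr_ge0//.
  by case/andP: (invW Ew rn).
- move=> w Ew; have /andP[M0 M1] := M01 Ew rn; have w0 := W0 Ew rn.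
  rewrite /c /compensated addrAC addr_ge0 ?A0// subr_ge0.
  by rewrite ler_piMr// invf_le1; lra.
Qed.

Lemma integral_compensated_le1 n : (r <= n)%N ->
  (\int[P]_(w in E) (L n w)%:E <= 1)%E.
Proof.
move=> rn; rewrite integral_compensated//.
apply: (@le_trans _ _ (\int[P]_(w in E) (cst 1 w))%E).
  apply: ge0_le_integral => //.
  - move=> w Ew; rewrite lee_fin addr_ge0//; last exact: (compensator_ge0 alpha1 hPi m0).
    by case/andP: (M01 Ew (leqnn r)).
  - by apply/measurable_EFinP; exact: measurable_L.
  - move=> w Ew; rewrite lee_fin /compensated /compensator big_geq// addr0.
    by case/andP: (M01 Ew (leqnn r)).
by rewrite (integral_cst P mE) mul1e probability_le1.
Qed.

(** Martingale increments are orthogonal, so their second moments add up; the step at time n + j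
    contributes (1 - q) M (1 - M) / (W + 1)^2, which is at most (c0^-1 / n)^2. *)
Lemma integral_compensated_sq n j : (r <= n)%N ->
  (\int[P]_(w in E) ((L (n + j)%N w - L n w) ^+ 2)%:E <=
   (j%:R * (c0^-1 / n%:R) ^+ 2)%:E)%E.
Proof.
move=> rn; elim: j => [|j IH].
  rewrite addn0 mul0r integral0_eq// => w _.
  by rewrite subrr expr0n.
have rj : (r <= n + j)%N by rewrite (leq_trans rn)// leq_addr.
pose x w := L (n + j)%N w - L n w.
pose u w := 1 / (W (n + j) w + 1).
have dM : determined Pi (n + j) (M (n + j)%N) by exact: determined_share.
have dx : determined Pi (n + j) x.
  move=> w w' e; rewrite /x (determined_compensated hPi _ _ e).
  by rewrite (determined_compensated hPi _ _ (rp_history rp (leq_addr j n) e)).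
have du : determined Pi (n + j) u by move=> w w' e; rewrite /u /num_classes e.
rewrite addnS.
have -> : (\int[P]_(w in E) ((L (n + j).+1 w - L n w) ^+ 2)%:E =
    \int[P]_(w in E) (if opens Pi (n + j) w then x w ^+ 2
    else if grows Pi m (n + j) w then (x w + (1 - M (n + j)%N w) * u w) ^+ 2
    else (x w - M (n + j)%N w * u w) ^+ 2)%:E)%E.
  apply: eq_integral => w; rewrite inE => Ew; congr EFin.
  rewrite (compensatedS alpha1 hPi m0 Ew rj) /x /u !mul1r.
  by case: ifP => // _; case: ifP => // _; congr (_ ^+ 2); ring.
rewrite (integral_step alpha1 hPi)//; first last.
- by move=> w _; exact: sqr_ge0.
- by move=> w _; exact: sqr_ge0.
- by move=> w _; exact: sqr_ge0.
- by move=> w w' e; rewrite (dx _ _ e) (dM _ _ e) (du _ _ e).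
- by move=> w w' e; rewrite (dx _ _ e) (dM _ _ e) (du _ _ e).
- by move=> w w' e; rewrite (dx _ _ e).
have mx : measurable_fun E (fun w => (x w ^+ 2)%:E).
  apply/measurable_EFinP; apply: measurable_funX.
  exact: (measurable_funB (measurable_L rj) (measurable_L rn)).
apply: (@le_trans _ _ (\int[P]_(w in E) ((x w ^+ 2)%:E + cst ((c0^-1 / n%:R) ^+ 2)%:E w))%E).
  apply: ge0_le_integral => //.
  - move=> w Ew; rewrite lee_fin.
    have /andP[M0 M1] := M01 Ew rj; have /andP[q0 q1] := q01 Ew rj.
    rewrite -/(weight alpha (n + j) (K (n + j) w)) -/(M (n + j) w).
    apply: addr_ge0; first by apply: mulr_ge0 => //; exact: sqr_ge0.
    apply: mulr_ge0; first by rewrite subr_ge0.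
    by apply: addr_ge0; apply: mulr_ge0; rewrite ?sqr_ge0 ?subr_ge0.
  - apply: measurable_funTS; apply/measurable_EFinP.
    apply: (@measurable_fun_determined _ _ _ rp _ _ (n + j)) => w w' e.
    by rewrite (dx _ _ e) (dM _ _ e) (du _ _ e) /class_size /num_classes e.
  - by apply: emeasurable_funD => //; exact: measurable_cst.
  - move=> w Ew; rewrite -EFinD lee_fin.
    have /andP[M0 M1] := M01 Ew rj; have /andP[q0 q1] := q01 Ew rj.
    rewrite -/(weight alpha (n + j) (K (n + j) w)) -/(M (n + j) w).
    have /andP[u0 ule] := invW Ew rj.
    rewrite -(div1r (W _ _ + 1)) -/(u w) in u0 ule.
    have ule' : u w <= c0^-1 / n%:R.
      apply: le_trans ule _; apply: ler_wpM2l; first by rewrite invr_ge0 ltW.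
      rewrite lef_pV2 ?posrE ?(E_gt0 Ew rj) ?(E_gt0 Ew rn)//.
      by rewrite ler_nat leq_addr.
    have u2 : u w ^+ 2 <= (c0^-1 / n%:R) ^+ 2 by rewrite lerXn2r ?nnegrE// (le_trans u0).
    move: (open_prob _ _ _) (M (n + j)%N w) (x w) (u w) q0 q1 M0 M1 u2 {u0 ule ule'}.
    move=> q p y v q0 q1 p0 p1 v2.
    have -> : q * y ^+ 2 + (1 - q) * (p * (y + (1 - p) * v) ^+ 2 +
        (1 - p) * (y - p * v) ^+ 2) = y ^+ 2 + ((1 - q) * (p * (1 - p))) * v ^+ 2.
      by ring.
    rewrite lerD2l; apply: le_trans v2; rewrite ler_piMl ?sqr_ge0//.
    by rewrite !mulr_ile1 ?mulr_ge0 ?subr_ge0// gerBl.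
rewrite ge0_integralD//; last first.
  by move=> w _; rewrite lee_fin sqr_ge0.
  by move=> w _; rewrite lee_fin sqr_ge0.
rewrite (integral_cst P mE) -natr1 mulrDl mul1r EFinD; apply: leeD => //.
rewrite -[leRHS]mule1; apply: lee_wpmul2l; last exact: probability_le1.
by rewrite lee_fin sqr_ge0.
Qed.

(** The inequality 2 |x| <= k^2 x^2 + k^-2 turns the second-moment bound into one on the first
    moment. With at most 7 k^2 steps of second moment at most (c0^-1 / k^3)^2 each, both terms are
    O(k^-2). *)
Lemma integral_compensated_cube k : (r <= k)%N -> (0 < k)%N ->
  (\int[P]_(w in E) (`|L (k.+1 ^ 3)%N w - L (k ^ 3)%N w|)%:E <=
   ((7%:R * c0^-1 ^+ 2 + 1) / k%:R ^+ 2)%:E)%E.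
Proof.
move=> rk k0; have k0' : 0 < k%:R :> R by rewrite ltr0n.
have rk3 : (r <= k ^ 3)%N.
  have : (k ^ 1 <= k ^ 3)%N by rewrite leq_pexp2l.
  by rewrite expn1; lia.
have kk : (k ^ 3 <= k.+1 ^ 3)%N by rewrite leq_exp2r.
pose x w := L (k.+1 ^ 3)%N w - L (k ^ 3)%N w.
have mx : measurable_fun E x.
  exact: (measurable_funB (measurable_L (leq_trans rk3 kk)) (measurable_L rk3)).
have mx2 : measurable_fun E (fun w => (x w ^+ 2)%:E).
  by apply/measurable_EFinP; exact: measurable_funX.
have k2 : 0 <= k%:R ^+ 2 :> R by exact: sqr_ge0.
have mkx : measurable_fun E (fun w => ((k%:R ^+ 2)%:E * (x w ^+ 2)%:E)%E).
  by apply: emeasurable_funM => //; exact: measurable_cst.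
apply: (@le_trans _ _ (\int[P]_(w in E)
    ((k%:R ^+ 2)%:E * (x w ^+ 2)%:E + cst ((k%:R ^+ 2)^-1)%:E w))%E).
  apply: ge0_le_integral => //.
  - by apply/measurable_EFinP; exact: measurableT_comp.
  - by apply: emeasurable_funD => //; exact: measurable_cst.
  - move=> w Ew; rewrite -EFinM -EFinD lee_fin -/(x w).
    have h : 0 <= (k%:R * `|x w| - k%:R^-1) ^+ 2 by exact: sqr_ge0.
    have kV : k%:R * k%:R^-1 = 1 :> R by rewrite mulfV// gt_eqF.
    have e : (k%:R * `|x w| - k%:R^-1) ^+ 2 =
        k%:R ^+ 2 * x w ^+ 2 + (k%:R ^+ 2)^-1 - 2 * `|x w|.
      rewrite -(real_normK (num_real (x w))); field; rewrite gt_eqF//.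
    by move: h; rewrite e; have := normr_ge0 (x w); lra.
rewrite ge0_integralD//; first last.
- by move=> w _; rewrite lee_fin invr_ge0.
- by move=> w _; rewrite -EFinM lee_fin mulr_ge0// sqr_ge0.
rewrite ge0_integralZl_EFin//; last by move=> w _; rewrite lee_fin sqr_ge0.
rewrite (integral_cst P mE) mulrDl mul1r EFinD; apply: leeD; last first.
  rewrite -[leRHS]mule1; apply: lee_wpmul2l; last exact: probability_le1.
  by rewrite lee_fin invr_ge0.
have := integral_compensated_sq (k.+1 ^ 3 - k ^ 3) rk3; rewrite subnKC// => h.
apply: (le_trans (lee_wpmul2l _ h)); first by rewrite lee_fin.
rewrite -EFinM lee_fin.
have jk : (k.+1 ^ 3 - k ^ 3)%:R <= 7%:R * k%:R ^+ 2 :> R.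
  rewrite -natrX -natrM ler_nat.
  have : (k.+1 ^ 3 = k ^ 3 + 3 * k ^ 2 + 3 * k + 1)%N by rewrite !expnS !expn0; nia.
  by rewrite !expnS !expn0; nia.
apply: (@le_trans _ _ (k%:R ^+ 2 * (7%:R * k%:R ^+ 2 * (c0^-1 / (k ^ 3)%:R) ^+ 2))).
  by rewrite ler_wpM2l// ler_wpM2r// sqr_ge0.
rewrite natrX le_eqVlt; apply/orP; left; apply/eqP; field.
by rewrite !gt_eqF.
Qed.

(** For x >= 1 the telescoping difference 2 / x - 2 / (x + 1) dominates 1 / x^2. Only the uniform
    bound 2 matters afterwards. *)
Lemma sum_inv_sq_le n : (0 < r)%N ->
  \sum_(i < n) ((i + r)%:R ^+ 2)^-1 <= 2 - 2 / (n + r)%:R :> R.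
Proof.
move=> r0; elim: n => [|n IH].
  rewrite big_ord0 add0n subr_ge0 ler_pdivrMr ?ltr0n//.
  by rewrite ler_peMr// ler1n.
rewrite big_ord_recr/= addSn -[(n + r).+1%:R]natr1.
have x1 : 1 <= (n + r)%:R :> R by rewrite ler1n; lia.
move: IH x1; move: ((n + r)%:R) => x IH x1.
apply: le_trans (lerD IH (lexx _)) _; rewrite -subr_ge0.
have -> : 2 - 2 / (x + 1) - (2 - 2 / x + (x ^+ 2)^-1) = (x - 1) / (x ^+ 2 * (x + 1)).
  by field; rewrite !gt_eqF//; lra.
by rewrite divr_ge0 ?subr_ge0// mulr_ge0 ?sqr_ge0//; lra.
Qed.

(** The compensator is at most L because the share is nonnegative, so the losses have bounded total
    mean. The increments of L along the cubes are absolutely summable, and the small steps of L fill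
    the gaps. *)
Lemma ae_cvg_compensated : (0 < r)%N ->
  {ae P, forall w, E w -> cvgn (L ^~ w) /\ cvgn (A ^~ w)}.
Proof.
move=> r0; pose dL i w := `|L ((i + r).+1 ^ 3)%N w - L ((i + r) ^ 3)%N w|.
have rk i : (r <= (i + r) ^ 3)%N.
  have : ((i + r) ^ 1 <= (i + r) ^ 3)%N by rewrite leq_pexp2l//; lia.
  by rewrite expn1; lia.
have mdL i : measurable_fun E (dL i).
  apply: measurableT_comp => //.
  by apply: measurable_funB; apply: measurable_L; [exact: (rk i.+1)|exact: rk].
have mloss i : measurable_fun E (loss alpha Pi m (i + r)%N).
  apply: measurable_funTS; apply: (@measurable_fun_determined _ _ _ rp _ _ (i + r).+1).
  exact: (determined_loss hPi).
have loss0 i w : E w -> 0 <= loss alpha Pi m (i + r)%N w.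
  by move=> Ew; apply: (loss_ge0 alpha1 hPi m0 Ew); rewrite leq_addl.
have AE n w : A (n + r)%N w = \sum_(i < n) loss alpha Pi m (i + r)%N w.
  by rewrite /compensator -{1}(add0n r) big_addn addnK big_mkord.
have aeA : {ae P, forall w, E w -> cvgn (series (fun i => loss alpha Pi m (i + r)%N w))}.
  apply: (ae_cvg_series (u := fun i => loss alpha Pi m (i + r)%N) (B := 1)) => // n.
  apply: le_trans (integral_compensated_le1 (leq_addl n r)).
  apply: ge0_le_integral => //.
  - by move=> w Ew; rewrite lee_fin sumr_ge0// => i _; exact: loss0.
  - by apply/measurable_EFinP; apply: measurable_sum => i.
  - by apply/measurable_EFinP; apply: measurable_L; rewrite leq_addl.
  - move=> w Ew; rewrite lee_fin -AE /compensated lerDr.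
    by case/andP: (M01 Ew (leq_addl n r)).
pose B := 7%:R * c0^-1 ^+ 2 + 1 : R.
have B0 : 0 <= B by rewrite addr_ge0// mulr_ge0// sqr_ge0.
have aeL : {ae P, forall w, E w -> cvgn (series (dL ^~ w))}.
  apply: (ae_cvg_series (u := dL) (B := B * 2)) => // [i w _|n].
    exact: normr_ge0.
  apply: (@le_trans _ _ (\int[P]_(w in E) \sum_(i < n) (dL i w)%:E)%E).
    rewrite le_eqVlt; apply/orP; left; apply/eqP.
    by apply: eq_integral => w _; rewrite sumEFin.
  rewrite ge0_integral_sum//; last first.
    by move=> i w _; rewrite lee_fin normr_ge0.
    by move=> i; apply/measurable_EFinP; exact: mdL.
  apply: (@le_trans _ _ (\sum_(i < n) (B * ((i + r)%:R ^+ 2)^-1)%:E)%E).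
    by apply: lee_sum => i _; apply: integral_compensated_cube; lia.
  rewrite sumEFin lee_fin -mulr_sumr ler_wpM2l//.
  by apply: le_trans (sum_inv_sq_le n r0) _; rewrite gerBl divr_ge0.
apply: filterS2 aeA aeL => w aeA aeL Ew; split; last first.
  have /cvg_ex[l hl] := aeA Ew; apply/cvg_ex; exists l; rewrite -(cvg_shiftn r).
  apply: cvg_trans hl; apply: near_eq_cvg; near=> n.
  by rewrite /= AE /series/= big_mkord.
have c1 : 0 <= c0^-1 by rewrite invr_ge0 ltW.
apply: (cvg_slow_cubes c1 r0); first by move=> n rn; exact: compensated_step.
pose u k := L ((k + r) ^ 3)%N w.
have -> : (fun k => L ((k + r) ^ 3)%N w) = (fun k => u 0%N + series (telescope u) k).
  by apply/funext => k; rewrite -eq_sum_telescope.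
apply: is_cvgD; first exact: is_cvg_cst.
by apply: normed_cvg; exact: aeL Ew.
Unshelve. all: by end_near. Qed.

End AlmostSureLimit.

(** * Measurability of pointwise limits *)

Lemma cvg_esups_einfs (R : realType) (u : (\bar R)^nat) :
  limn_esup u = limn_einf u -> u @ \oo --> limn_esup u.
Proof.
move=> ei; apply: (@squeeze_cvge _ _ _ _ (einfs u) _ (esups u)).
- near=> n; apply/andP; split.
    by apply: ereal_inf_lbound; exists n => //=.
  by apply: ereal_sup_ubound; exists n => //=.
- by rewrite ei limn_einf_lim; exact: is_cvg_einfs.
- by rewrite limn_esup_lim; exact: is_cvg_esups.
Unshelve. all: by end_near. Qed.

Section MeasurableLim.
Context d (T : measurableType d) (R : realType).

(** Where the sequence diverges, [limn] returns the default [point]; hence the set of convergence,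
    where limsup and liminf agree, is part of the description. *)
Lemma measurable_limn_ereal (f : nat -> T -> \bar R) :
  (forall n, measurable_fun setT (f n)) ->
  measurable_fun setT (fun x => limn (f ^~ x)).
Proof.
move=> mf; have ms := measurable_fun_limn_esup mf.
have mi : measurable_fun setT (fun x => limn_einf (f ^~ x)).
  rewrite (_ : (fun _ => _) = (fun x => - limn_esup (fun n => - f n x))%E).
    apply: measurableT_comp => //; apply: measurable_fun_limn_esup => n.
    exact: measurableT_comp.
  by apply/funext => x; rewrite /limn_einf /limn_esup /lime_inf /=.
rewrite (_ : (fun _ => _) = (fun x => if limn_esup (f ^~ x) == limn_einf (f ^~ x)
    then limn_esup (f ^~ x) else point)).
  by apply: measurable_fun_ifT => //; exact: measurable_fun_eqe.
apply/funext => x; case: eqP => [e|ne].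
  by apply/cvg_lim => //; exact: cvg_esups_einfs.
apply: dvgP => /cvg_ex[l /cvg_limn_einf_sup[e1 e2]].
by apply: ne; rewrite e1 e2.
Qed.

(** A real sequence that tends to infinity also gets the default value, so finiteness of the limsup
    has to be tested too. *)
Lemma measurable_limn_real (f : nat -> T -> R) :
  (forall n, measurable_fun setT (f n)) ->
  measurable_fun setT (fun x => limn (f ^~ x)).
Proof.
move=> mf; pose g n x := (f n x)%:E.
have mg n : measurable_fun setT (g n) by apply/measurable_EFinP; exact: mf.
have ms := measurable_fun_limn_esup mg.
have mi : measurable_fun setT (fun x => limn_einf (g ^~ x)).
  rewrite (_ : (fun _ => _) = (fun x => - limn_esup (fun n => - g n x))%E)//.
  apply: measurableT_comp => //; apply: measurable_fun_limn_esup => n.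
  exact: measurableT_comp.
rewrite (_ : (fun _ => _) = (fun x => if (limn_esup (g ^~ x) == limn_einf (g ^~ x))
    && (limn_esup (g ^~ x) \is a fin_num) then fine (limn_esup (g ^~ x)) else point)).
  apply: measurable_fun_ifT => //.
    apply: measurable_and; first exact: measurable_fun_eqe.
    by apply: (measurable_fun_bool true); exact: emeasurable_fin_num.
  exact: measurableT_comp.
apply/funext => x; case: ifPn => [/andP[/eqP e /fineK l]|ne].
  apply/cvg_lim => //; have := cvg_esups_einfs e.
  by rewrite -l => /fine_cvgP[].
apply: dvgP => /cvg_ex[l fl].
have gl : g ^~ x @ \oo --> l%:E by apply/fine_cvgP; split; [exact: nearW|].
have [e1 e2] := cvg_limn_einf_sup gl.
by move: ne; rewrite e1 e2 eqxx.
Qed.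

End MeasurableLim.

(** * From the share to the frequency *)

Section FrequencyLimit.
Context d (T : measurableType d) (R : realType) (P : probability T R).
Variables (alpha : R) (V : nat -> nat -> R) (Pi : nat -> T -> seq (seq nat)).
Hypothesis (alpha1 : alpha < 1) (hPi : EGP P alpha V Pi).
Variables (m r : nat) (m0 : (0 < m)%N).

Local Notation K := (num_classes Pi).
Local Notation D := (class_size Pi m).
Local Notation E := (record_event Pi m r).
Local Notation W n w := (weight alpha n (K n w)).
Local Notation M := (share alpha Pi m).
Local Notation A := (compensator alpha Pi m r).
Local Notation L := (compensated alpha Pi m r).
Local Notation X := (age_frequency R Pi m).
Let rp : random_partition Pi := egp_partition hPi.

Let mE : measurable E.
Proof. exact: (measurable_record hPi r m0). Qed.

Lemma measurable_age_frequency : measurable_fun setT X.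
Proof.
apply: measurable_limn_real => n.
by apply: (@measurable_fun_determined _ _ _ rp _ _ n) => w w' ->.
Qed.

Section Pathwise.
Variables (w : T) (Ew : E w).

Let W0 n : (r <= n)%N -> 0 < W n w.
Proof. by move=> rn; exact: (record_weight_gt0 alpha1 hPi m0 Ew rn). Qed.

Let n_gt0 n : (r <= n)%N -> 0 < n%:R :> R.
Proof. by move=> rn; rewrite ltr0n; have := record_gt0 rp m0 Ew; lia. Qed.

Let K_div_le n : (r <= n)%N -> 0 <= ((K n w)%:R / n%:R : R) <= 1.
Proof.
move=> rn; rewrite divr_ge0//= ler_pdivrMr ?n_gt0// mul1r ler_nat.
exact: num_classes_le.
Qed.

(* Each record at time i <= n costs the share at least delta / n once the share
   exceeds mu / 2, hence records have density zero wherever the total cost is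
   finite and the limiting share mu is positive. *)
Lemma num_classes_le_compensator n0 mu : (r <= n0)%N -> 0 < mu ->
  (forall n, (n0 <= n)%N -> mu / 2 <= M n w) ->
  forall n, (n0 <= n)%N ->
  (K n w)%:R <= (K n0 w)%:R +
    (A n w - A n0 w) * n%:R * (2 * (1 + `|alpha|) / (mu * (1 - alpha))).
Proof.
move=> rn0 mu0 hM n n0n; have a1 : 0 < 1 - alpha by rewrite subr_gt0.
have b0 : 0 < 1 + `|alpha| by rewrite ltr_wpDr.
set delta := 2 * _ / _.
have delta0 : 0 < delta by rewrite divr_gt0 ?mulr_gt0.
suff H j : (j <= n - n0)%N -> (K (n0 + j)%N w)%:R <= (K n0 w)%:R +
    (A (n0 + j)%N w - A n0 w) * n%:R * delta.
  by have := H (n - n0)%N (leqnn _); rewrite subnKC.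
elim: j => [_|j IH jn]; first by rewrite addn0 subrr !mul0r addr0.
have {}IH := IH (ltnW jn).
have rj : (r <= n0 + j)%N by lia.
have AS : A (n0 + j).+1 w = A (n0 + j)%N w + loss alpha Pi m (n0 + j) w.
  by rewrite /compensator big_nat_recr.
rewrite addnS (record_stepK rp m0 w) AS.
have -> : (A (n0 + j)%N w + loss alpha Pi m (n0 + j) w - A n0 w) * n%:R * delta =
    (A (n0 + j)%N w - A n0 w) * n%:R * delta +
    loss alpha Pi m (n0 + j) w * n%:R * delta by ring.
rewrite /loss; case: ifP => ow; last by rewrite !mul0r addr0.
rewrite -natr1 addrA; apply: lerD => //.
have rS : W (n0 + j).+1 w = W (n0 + j) w + 1 - alpha.
  by rewrite (record_weightS hPi m0) ow.
have W1 : 0 < W (n0 + j).+1 w by apply: W0; lia.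
rewrite -rS.
have Wle : W (n0 + j).+1 w <= (1 + `|alpha|) * n%:R.
  apply: le_trans (weight_le _ _) _; first exact: num_classes_le.
  by apply: ler_wpM2l; [exact: ltW|rewrite ler_nat; lia].
have nn : 0 < n%:R :> R by apply: n_gt0; lia.
apply: (@le_trans _ _ (mu / 2 * (1 - alpha) / ((1 + `|alpha|) * n%:R) * n%:R * delta)).
  rewrite le_eqVlt; apply/orP; left; apply/eqP; rewrite /delta; field.
  by rewrite !gt_eqF//; lra.
apply: ler_wpM2r; first exact: ltW.
apply: ler_wpM2r; first exact: ltW.
apply: ler_pM.
- by apply: mulr_ge0; [apply: divr_ge0 => //|]; exact: ltW.
- by rewrite invr_ge0; apply: mulr_ge0 => //; exact: ltW.
- by apply: ler_wpM2r; [exact: ltW|rewrite hM ?leq_addr].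
- by rewrite lef_pV2 ?posrE// mulr_gt0.
Qed.

(** D_n / n equals M_n (1 - alpha K_n / n) + alpha / n. If the limit of M_n is 0, boundedness of K_n
    / n suffices; if it is positive, [num_classes_le_compensator] shows that K_n / n tends to 0. *)
Lemma cvg_age_frequency : cvgn (L ^~ w) -> cvgn (A ^~ w) ->
  M ^~ w @ \oo --> X w.
Proof.
move=> /cvg_ex[/= l Ll] /cvg_ex[/= a Aa].
pose mu := l - a.
have Mmu : M ^~ w @ \oo --> mu.
  have -> : M ^~ w = (fun n => L n w - A n w).
    by apply/funext => n; rewrite /compensated addrK.
  exact: cvgB.
suff Dmu : (fun n => (D n w)%:R / n%:R : R) @ \oo --> mu.
  have -> : X w = mu by apply/cvg_lim.
  exact: Mmu.
have DE n : (r <= n)%N -> (D n w)%:R / n%:R =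
    M n w * (1 - alpha * ((K n w)%:R / n%:R)) + alpha * n%:R^-1.
  move=> rn; have w0 := W0 rn; have n0 := n_gt0 rn.
  rewrite /share; move: w0; rewrite /weight => w0; field.
  by rewrite !gt_eqF.
have nV : (fun n => n%:R^-1 : R) @ \oo --> (0 : R).
  rewrite -(cvg_shiftn 1); apply: cvg_trans (@cvg_harmonic R).
  by apply: near_eq_cvg; near=> n; rewrite /= addn1.
have mu0 : 0 <= mu.
  apply: (@closed_cvg _ _ _ eventually_filter (M ^~ w) (fun x => 0 <= x) _ _ _ Mmu).
    exact: closed_ge.
  near=> n; have rn : (r <= n)%N by near: n; exact: nbhs_infty_ge.
  by case/andP: (share_itv alpha1 hPi m0 Ew rn).
apply: (@cvg_trans _ ((fun n => M n w * (1 - alpha * ((K n w)%:R / n%:R))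
    + alpha * n%:R^-1) @ \oo)).
  apply: near_eq_cvg; near=> n; rewrite DE//.
  by near: n; exact: nbhs_infty_ge.
rewrite -[mu]addr0 -[X in _ + X](mulr0 alpha); apply: cvgD; last first.
  by apply: cvgM => //; exact: cvg_cst.
have [mu_eq0|mu_gt0] := eqVneq mu 0.
  rewrite mu_eq0; apply: norm_cvg0.
  apply: (@squeeze_cvgr _ _ _ _ (fun=> 0) (fun n => `|M n w| * (1 + `|alpha|))).
  - near=> n; rewrite normr_ge0/= normrM ler_wpM2l//.
    rewrite (le_trans (ler_normB _ _))// normr1 lerD2l normrM ler_piMr//.
    have rn : (r <= n)%N by near: n; exact: nbhs_infty_ge.
    by case/andP: (K_div_le rn) => h0 h1; rewrite ger0_norm.
  - exact: cvg_cst.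
  - rewrite -[X in _ --> X](mul0r (1 + `|alpha|)); apply: cvgM; last exact: cvg_cst.
    by rewrite -[X in _ --> X](@normr0 _ R); apply: cvg_norm; rewrite -mu_eq0.
suff Kn : (fun n => (K n w)%:R / n%:R : R) @ \oo --> (0 : R).
  rewrite -[X in _ --> X]mulr1; apply: cvgM => //.
  rewrite -[X in _ --> X]subr0 -[X in _ - X](mulr0 alpha).
  by apply: cvgB; [exact: cvg_cst|apply: cvgM => //; exact: cvg_cst].
have {}mu_gt0 : 0 < mu by rewrite lt0r mu_gt0.
have a1 : 0 < 1 - alpha by rewrite subr_gt0.
pose delta := 2 * (1 + `|alpha|) / (mu * (1 - alpha)).
have delta0 : 0 < delta.
  by rewrite divr_gt0 ?mulr_gt0// ltr_wpDr.
apply/cvgrPdist_le => e e0.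
have mu2 : 0 < mu / 2 by rewrite divr_gt0.
(* A n - A n0 is at most twice this amount and contributes e / 2 to K n / n after multiplication by
   delta; the remaining e / 2 is for K n0 / n. *)
have e4 : 0 < e / (4 * delta) by rewrite divr_gt0// mulr_gt0.
have [N1 _ hN1] := cvgr_dist_le _ _ Mmu _ mu2.
have [N2 _ hN2] := cvgr_dist_le _ _ Aa _ e4.
pose n0 := (r + N1 + N2)%N.
have rn0 : (r <= n0)%N by rewrite /n0; lia.
have Mn n : (n0 <= n)%N -> mu / 2 <= M n w.
  move=> n0n; have : `|mu - M n w| <= mu / 2.
    by apply: hN1; rewrite /= /n0 in n0n *; lia.
  by rewrite ler_distl; lra.
near=> n.
have n0n : (n0 <= n)%N by near: n; exact: nbhs_infty_ge.
have rn : (r <= n)%N by exact: leq_trans n0n.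
have nn := n_gt0 rn.
have Kle := num_classes_le_compensator rn0 mu_gt0 Mn n0n.
rewrite -/delta in Kle.
have hA k : (n0 <= k)%N -> `|a - A k w| <= e / (4 * delta).
  by move=> n0k; apply: hN2; rewrite /= /n0 in n0k *; lia.
have dA : (A n w - A n0 w) * delta <= e / 2.
  have -> : e / 2 = 2 * (e / (4 * delta)) * delta by field; rewrite gt_eqF.
  rewrite ler_wpM2r ?(ltW delta0)//.
  have := hA _ n0n; have := hA _ (leqnn n0); rewrite !ler_distl; lra.
have Kn0 : (K n0 w)%:R / n%:R <= e / 2.
  rewrite ler_pdivrMr//; apply: (@le_trans _ _ n0%:R).
    by rewrite ler_nat; exact: num_classes_le.
  rewrite mulrC -ler_pdivrMr ?divr_gt0//.
  by near: n; exact: nbhs_infty_ger.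
rewrite sub0r normrN ger0_norm; last by case/andP: (K_div_le rn).
apply: (@le_trans _ _ ((K n0 w)%:R / n%:R + (A n w - A n0 w) * delta)); last by lra.
rewrite ler_pdivrMr//; apply: le_trans Kle _.
rewrite le_eqVlt; apply/orP; left; apply/eqP; field.
by rewrite gt_eqF.
Unshelve. all: by end_near. Qed.

End Pathwise.

Lemma ae_cvg_age_frequency : (0 < r)%N ->
  {ae P, forall w, E w -> M ^~ w @ \oo --> X w}.
Proof.
move=> r0; apply: filterS (ae_cvg_compensated alpha1 hPi m0 r0) => w h Ew.
by have [hL hA] := h Ew; exact: cvg_age_frequency.
Qed.

(** Since W tends to infinity, each factor (D - alpha + i) / (W + i) has the same limit as the
    share. *)
Lemma cvg_rising_share p w : E w -> M ^~ w @ \oo --> X w ->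
  (fun n => rising_share alpha Pi m p n w) @ \oo --> X w ^+ p.
Proof.
move=> Ew MX; elim: p => [|p IH].
  rewrite expr0; apply: (@cvg_trans _ ((fun=> 1 : R) @ \oo)); last exact: cvg_cst.
  apply: near_eq_cvg; near=> n.
  by rewrite /rising_share /rising !big_ord0 divr1.
rewrite exprSr.
have -> : (fun n => rising_share alpha Pi m p.+1 n w) = (fun n =>
    rising_share alpha Pi m p n w * (((D n w)%:R - alpha + p%:R) / (W n w + p%:R))).
  by apply/funext => n; rewrite /rising_share !risingS invfM mulrACA.
apply: cvgM => //.
have W_inv : (fun n => (W n w)^-1) @ \oo --> (0 : R).
  have c0 : 0 < Num.min 1 (1 - alpha) by rewrite lt_min ltr01 subr_gt0.
  apply: (@squeeze_cvgr _ _ _ _ (fun=> 0)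
      (fun n => (Num.min 1 (1 - alpha))^-1 * (harmonic n.-1))).
  - near=> n; have rn : (r <= n)%N by near: n; exact: nbhs_infty_ge.
    have n0 : (0 < n)%N by have := record_gt0 rp m0 Ew; lia.
    have w0 := record_weight_gt0 alpha1 hPi m0 Ew rn.
    rewrite invr_ge0 (ltW w0)/= /harmonic prednK// -invfM.
    rewrite lef_pV2 ?posrE ?mulr_gt0 ?ltr0n//.
    exact: (record_weight_ge alpha1 hPi m0 Ew rn).
  - exact: cvg_cst.
  - rewrite -[X in _ --> X](mulr0 (Num.min 1 (1 - alpha))^-1).
    apply: cvgM; first exact: cvg_cst.
    rewrite -(cvg_shiftn 1); apply: cvg_trans (@cvg_harmonic R).
    by apply: near_eq_cvg; near=> n; rewrite /= addn1.
apply: (@cvg_trans _ ((fun n => (M n w + p%:R * (W n w)^-1) /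
    (1 + p%:R * (W n w)^-1)) @ \oo)).
  apply: near_eq_cvg; near=> n.
  have rn : (r <= n)%N by near: n; exact: nbhs_infty_ge.
  have w0 := record_weight_gt0 alpha1 hPi m0 Ew rn.
  have wp : 0 < W n w + p%:R by rewrite ltr_wpDr.
  by rewrite /share; field; rewrite !gt_eqF.
rewrite (_ : X w = (X w + p%:R * 0) / (1 + p%:R * 0)); last first.
  by rewrite mulr0 !addr0 divr1.
apply: cvgM; first by apply: cvgD => //; apply: cvgM => //; exact: cvg_cst.
apply: cvgV; first by rewrite mulr0 addr0 oner_neq0.
by apply: cvgD; [exact: cvg_cst|apply: cvgM => //; exact: cvg_cst].
Unshelve. all: by end_near. Qed.

Lemma age_frequency_itv w : E w -> M ^~ w @ \oo --> X w -> 0 <= X w <= 1.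
Proof.
move=> Ew MX; apply/andP; split.
- apply: (@closed_cvg _ _ _ eventually_filter (M ^~ w) (fun x => 0 <= x) _ _ _ MX).
    exact: closed_ge.
  near=> n; have rn : (r <= n)%N by near: n; exact: nbhs_infty_ge.
  by case/andP: (share_itv alpha1 hPi m0 Ew rn).
- apply: (@closed_cvg _ _ _ eventually_filter (M ^~ w) (fun x => x <= 1) _ _ _ MX).
    exact: closed_le.
  near=> n; have rn : (r <= n)%N by near: n; exact: nbhs_infty_ge.
  by case/andP: (share_itv alpha1 hPi m0 Ew rn).
Unshelve. all: by end_near. Qed.

Lemma rising_share_le1 p n w : E w -> (r <= n)%N -> rising_share alpha Pi m p n w <= 1.
Proof.
move=> Ew rn; have w0 := record_weight_gt0 alpha1 hPi m0 Ew rn.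
have c0 := class_weight_gt0 alpha1 hPi m0 Ew rn.
rewrite /rising_share ler_pdivrMr ?rising_gt0// mul1r.
apply: ler_prod => i _; rewrite addr_ge0 ?(ltW c0)//= lerD2r.
exact: (class_weight_le alpha1 hPi m0 Ew rn).
Qed.

Lemma cvg_integral_rising_share p : (0 < r)%N ->
  (\int[P]_(w in E) (rising_share alpha Pi m p n w)%:E @[n --> \oo] -->
   \int[P]_(w in E) (X w ^+ p)%:E)%E.
Proof.
(* The shift by r is there because the bounds on the share hold from time r on; the domination is by
   1. *)
move=> r0; pose f n w := (rising_share alpha Pi m p (n + r) w)%:E.
have mf n : measurable_fun E (f n).
  apply: measurable_funTS; apply/measurable_EFinP.
  apply: (@measurable_fun_determined _ _ _ rp _ _ (n + r)).
  exact: determined_rising_share.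
have mX : measurable_fun E (fun w => (X w ^+ p)%:E).
  apply: measurable_funTS; apply/measurable_EFinP; apply: measurable_funX.
  exact: measurable_age_frequency.
have ix : P.-integrable E (cst 1%:E) by exact: finite_measure_integrable_cst.
have aefX : {ae P, forall w, E w -> f ^~ w @ \oo --> (X w ^+ p)%:E}.
  apply: filterS (ae_cvg_age_frequency r0) => w h Ew; apply: cvg_EFin.
    exact: nearW.
  rewrite (cvg_shiftn r (fun n => rising_share alpha Pi m p n w)).
  exact: cvg_rising_share (h Ew).
have f1 : {ae P, forall w, forall n, E w -> (`|f n w| <= cst 1%:E w)%E}.
  apply: aeW => w n Ew; have rn : (r <= n + r)%N by rewrite leq_addl.
  have s0 := rising_share_ge0 alpha1 hPi m0 p Ew rn.
  by rewrite lee_fin (ger0_norm s0); exact: rising_share_le1.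
have [_ _ h] := dominated_convergence mE mf mX aefX ix f1.
by rewrite -(cvg_shiftn r).
Qed.

End FrequencyLimit.

(** * Moments of beta densities *)

Section IntegralComp.
Import HBNNSimple.

Lemma integral_comp_nnsfun d (T : measurableType d) (R : realType)
    (mu : {measure set T -> \bar R}) (h : T -> R) (g : T -> R)
    (s : {nnsfun R >-> R}) :
  measurable_fun setT h -> measurable_fun setT g -> (forall x, 0 <= g x) ->
  (\int[mu]_x (g x * s (h x))%:E =
   \sum_(y \in range s) y%:E * \int[mu]_(x in h @^-1` (s @^-1` [set y])) (g x)%:E)%E.
Proof.
move=> mh mg g0.
have ms y : measurable (h @^-1` (s @^-1` [set y])).
  by rewrite -[X in measurable X]setTI; apply: mh => //; exact: measurable_funPTI.
have mI y : measurable_fun setT (fun x => (\1_(s @^-1` [set y]) (h x) : R)).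
  apply: measurableT_comp => //; apply: measurable_indic; exact: measurable_funPTI.
pose F y x := (y * \1_(s @^-1` [set y]) (h x) * g x)%:E.
have F0 y x : (0 <= F y x)%E.
  rewrite /F lee_fin mulr_ge0//.
  by have := nnfun_muleindic_ge0 s y (h x); rewrite -EFinM lee_fin.
transitivity (\int[mu]_x \sum_(y \in range s) F y x)%E.
  apply: eq_integral => x _; rewrite (fimfunE s (h x)) !fsbig_finite//=.
  by rewrite mulrC mulr_suml sumEFin.
rewrite ge0_integral_fsum//; last first.
  move=> y; apply/measurable_EFinP; apply: measurable_funM => //.
  by apply: measurable_funM => //; exact: measurable_cst.
apply: eq_fsbigr => y _.
have [y0|y0] := leP 0 y; last first.
  have e : s @^-1` [set y] = set0.
    rewrite -subset0 => z /= sy; move: y0; rewrite -sy ltNge.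
    by rewrite fun_ge0.
  rewrite e preimage_set0 integral_set0 mule0 integral0_eq// => x _.
  by rewrite /F e indic0 mulr0 mul0r.
rewrite [in RHS]integral_mkcond -ge0_integralZl_EFin//; first last.
- by apply/(measurable_restrictT _ (ms y)); apply: measurable_funTS; apply/measurable_EFinP.
- by move=> x _; rewrite erestrict_ge0// => z _; rewrite lee_fin.
apply: eq_integral => x _; rewrite /F -mulrA EFinM; congr (_ * _)%E.
rewrite patchE indicE.
have -> : (x \in h @^-1` (s @^-1` [set y])) = (h x \in s @^-1` [set y]).
  by apply/idP/idP; rewrite !inE.
by case: ifP => _; rewrite ?mul1r ?mul0r.
Qed.

(* Both sides only depend on the measures A |-> \int_(h1 @^-1` A) g1 and
   A |-> \int_(h2 @^-1` A) g2. *)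
Lemma eq_integral_comp (R : realType)
    d1 (T1 : measurableType d1) (mu1 : {measure set T1 -> \bar R})
    d2 (T2 : measurableType d2) (mu2 : {measure set T2 -> \bar R})
    (h1 : T1 -> R) (h2 : T2 -> R) (g1 : T1 -> R) (g2 : T2 -> R) (f : R -> R) :
  measurable_fun setT h1 -> measurable_fun setT h2 ->
  measurable_fun setT g1 -> measurable_fun setT g2 ->
  (forall x, 0 <= g1 x) -> (forall x, 0 <= g2 x) ->
  measurable_fun setT f -> (forall x, 0 <= f x) ->
  (forall A, measurable A -> \int[mu1]_(x in h1 @^-1` A) (g1 x)%:E =
                             \int[mu2]_(x in h2 @^-1` A) (g2 x)%:E)%E ->
  (\int[mu1]_x (g1 x * f (h1 x))%:E = \int[mu2]_x (g2 x * f (h2 x))%:E)%E.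
Proof.
move=> mh1 mh2 mg1 mg2 g10 g20 mf f0 eqA.
have mfE : measurable_fun setT (EFin \o f) by exact/measurable_EFinP.
pose s := nnsfun_approx measurableT mfE.
have lim d (T : measurableType d) (mu : {measure set T -> \bar R})
    (h : T -> R) (g : T -> R) : measurable_fun setT h -> measurable_fun setT g ->
    (forall x, 0 <= g x) ->
    (\int[mu]_x (g x * f (h x))%:E = limn (fun n => \int[mu]_x (g x * s n (h x))%:E))%E.
  move=> mh mg g0; rewrite -monotone_convergence//.
  - apply: eq_integral => x _; apply/esym/cvg_lim => //.
    under eq_fun do rewrite EFinM.
    rewrite EFinM; apply: cvgeZl => //.
    apply: (cvg_nnsfun_approx measurableT mfE) => // z _.
    by rewrite lee_fin f0.
  - move=> n; apply/measurable_EFinP; apply: measurable_funM => //.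
    by apply: (measurableT_comp (f := s n)) => //; exact: measurable_funPT.
  - by move=> n x _; rewrite lee_fin mulr_ge0.
  - move=> x _ i j ij; rewrite lee_fin ler_wpM2l//.
    by have /lefP/(_ (h x)) := nd_nnsfun_approx measurableT mfE ij.
rewrite (lim _ _ mu1)// (lim _ _ mu2)//; congr (limn _); apply/funext => n.
rewrite !integral_comp_nnsfun//; apply: eq_fsbigr => y _; congr (_ * _)%E.
apply: eqA; exact: measurable_funPTI.
Qed.

End IntegralComp.

(** Up to its constant, the density of - log of a beta (a, b) variable: the image of x^(a-1)
    (1-x)^(b-1) dx under y = - log x. *)
Definition beta_kernel (R : realType) (a b y : R) : R :=
  expR (- y * a) * (1 - expR (- y)) `^ (b - 1).

Section BetaKernel.
Context (R : realType).
Local Notation mu := (@lebesgue_measure R).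
Implicit Types a b y : R.

Lemma onem_expRN_gt0 y : 0 < y -> 0 < 1 - expR (- y).
Proof. by move=> y0; rewrite subr_gt0 -expR0 ltr_expR oppr_lt0. Qed.

Lemma is_derive_expRNM a y :
  is_derive y 1 (fun y => expR (- y * a)) (- a * expR (- y * a)).
Proof.
have h : is_derive y (1 : R) (fun y : R => - y * a) (- a).
  apply: (is_derive_eq (is_deriveM (is_deriveN (is_derive_id y (1 : R)))
    (is_derive_cst a y (1 : R)))).
  by rewrite scaler0 add0r scalerN /GRing.scale/= mulr1.
rewrite mulrC; exact: (is_derive1_comp (is_derive_expR _) h).
Qed.

Lemma is_derive_beta_kernel a b y : 0 < y ->
  is_derive y 1 (beta_kernel a b)
    (- a * beta_kernel a b y + (b - 1) * beta_kernel (a + 1) (b - 1) y).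
Proof.
move=> y0; have D1 := is_derive_expRNM a y.
have D2 : is_derive y 1 (fun y : R => 1 - expR (- y)) (expR (- y)).
  have h := is_deriveB (is_derive_cst (1 : R) y (1 : R)) (is_derive_expRNM 1 y).
  rewrite (_ : (fun _ => _) = cst 1 - (fun y => expR (- y * 1))).
    by apply: (is_derive_eq h); rewrite mulr1 mulN1r opprK add0r.
  by apply/funext => z; rewrite !fctE mulr1.
have D3 := @is_derive1_comp R (fun x => x `^ (b - 1)) (fun y => 1 - expR (- y)) y
  _ _ (is_derive1_powR (b - 1) (onem_expRN_gt0 y0)) D2.
apply: (is_derive_eq (is_deriveM D1 D3)); rewrite /beta_kernel /GRing.scale/=.
have -> : - y * (a + 1) = - y * a + - y by ring.
by rewrite expRD; ring.
Qed.

Lemma continuous_beta_kernel a b y : 0 < y -> {for y, continuous (beta_kernel a b)}.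
Proof.
move=> y0; apply: differentiable_continuous; apply/derivable1_diffP.
exact: (@ex_derive _ _ _ _ _ _ _ (is_derive_beta_kernel a b y0)).
Qed.


Lemma beta_kernel_ge0 a b y : 0 <= beta_kernel a b y.
Proof. by rewrite mulr_ge0// ?expR_ge0// powR_ge0. Qed.

Lemma beta_kernelDr a b y : 0 < y ->
  beta_kernel a (b + 1) y = beta_kernel a b y - beta_kernel (a + 1) b y.
Proof.
move=> y0; have e0 := onem_expRN_gt0 y0.
rewrite /beta_kernel (_ : - y * (a + 1) = - y * a + - y); last by ring.
rewrite expRD (_ : b + 1 - 1 = (b - 1) + 1); last by ring.
rewrite powRD; last by rewrite (gt_eqF e0) implybT.
by rewrite powRr1 ?(ltW e0)//; ring.
Qed.

Lemma measurable_beta_kernel a b : measurable_fun setT (beta_kernel a b).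
Proof.
apply: measurable_funM.
  by apply: measurableT_comp => //; exact: measurable_funM.
apply: (measurableT_comp (measurable_powR (b - 1))).
apply: measurable_funB => //; apply: measurableT_comp => //.
Qed.

(** This is B(a, b), kept as an extended real so that the recursion below requires no proof of
    finiteness. *)
Definition beta_integral a b : \bar R :=
  (\int[mu]_(y in `]0%R, +oo[) (beta_kernel a b y)%:E)%E.

(** A compact exhaustion of the open half-line, avoiding 0 where the kernel is singular for b < 1.
    The left endpoint makes the boundary term there at most exp(- (n + 1) b). *)
Let S n : set (measurableTypeR R) := `[expR (- n.+1%:R), n.+1%:R]%classic.

Let S_gt0 n (y : R) : S n y -> 0 < y.
Proof.
by rewrite /S/= in_itv/= => /andP[h _]; exact: lt_le_trans (expR_gt0 _) h.
Qed.

Let S_lt n : expR (- n.+1%:R) < n.+1%:R :> R.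
Proof.
apply: (@lt_le_trans _ _ 1); last by rewrite ler1n.
by rewrite -expR0 ltr_expR oppr_lt0.
Qed.

Let cvg_expRN c : 0 < c -> (fun n => expR (- n.+1%:R * c)) @ \oo --> (0 : R).
Proof.
move=> c0; rewrite (_ : (fun _ => _) = (fun n => expR (- c) ^+ n.+1)).
  rewrite (cvg_shiftS (fun n => expR (- c) ^+ n)); apply: cvg_expr.
  by rewrite ger0_norm ?expR_ge0// -expR0 ltr_expR oppr_lt0.
by apply/funext => n; rewrite -expRM_natl mulrN mulNr.
Qed.

(** The fundamental theorem of calculus for the kernel with parameters a and b + 1, whose derivative
    is a + b times the kernel (a + 1, b) minus a times the kernel (a, b). *)
Let integral_S a b n : 0 < a -> 0 < b ->
  ((a + b)%:E * \int[mu]_(y in S n) (beta_kernel (a + 1) b y)%:E =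
   a%:E * \int[mu]_(y in S n) (beta_kernel a b y)%:E +
   (beta_kernel a (b + 1) n.+1%:R - beta_kernel a (b + 1) (expR (- n.+1%:R)))%:E)%E.
Proof.
move=> a0 b0; pose f y := (a + b) * beta_kernel (a + 1) b y - a * beta_kernel a b y.
have mS : measurable (S n) by exact: measurable_itv.
have cS c e : {within S n, continuous (beta_kernel c e)}.
  apply: derivable_within_continuous => y yS; apply: ex_derive.
  by apply: is_derive_beta_kernel; apply: S_gt0 yS.
have iS c e : mu.-integrable (S n) (fun y => (beta_kernel c e y)%:E).
  by apply: continuous_compact_integrable => //; exact: segment_compact.
have cf : {within S n, continuous f}.
  apply: derivable_within_continuous => y yS; have y0 : 0 < y by exact: S_gt0 yS.
  exact: (@ex_derive _ _ _ _ _ _ _ (is_deriveB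
    (is_deriveZ (a + b) (is_derive_beta_kernel (a + 1) b y0))
    (is_deriveZ a (is_derive_beta_kernel a b y0)))).
have iF : mu.-integrable (S n) (EFin \o f).
  by apply: continuous_compact_integrable => //; exact: segment_compact.
have dF y : 0 < y -> is_derive y 1 (beta_kernel a (b + 1)) (f y).
  move=> y0; apply: (is_derive_eq (is_derive_beta_kernel a (b + 1) y0)).
  rewrite beta_kernelDr// (_ : b + 1 - 1 = b); last by ring.
  by rewrite /f; ring.
have ftc : (\int[mu]_(y in S n) (f y)%:E =
    (beta_kernel a (b + 1) n.+1%:R)%:E - (beta_kernel a (b + 1) (expR (- n.+1%:R)))%:E)%E.
  apply: continuous_FTC2 => //.
    split.
    - move=> y; rewrite in_itv/= => /andP[y0 _]; apply: ex_derive.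
      by apply: dF; exact: lt_trans (expR_gt0 _) y0.
    - apply: cvg_at_right_filter; apply: continuous_beta_kernel; exact: expR_gt0.
    - by apply: cvg_at_left_filter; exact: continuous_beta_kernel.
  move=> y; rewrite in_itv/= => /andP[y0 _].
  have y1 : 0 < y by exact: lt_trans (expR_gt0 _) y0.
  by rewrite derive1E (@derive_val _ _ _ _ _ _ _ (dF _ y1)).
rewrite EFinB -ftc -(integralZl mS (iS _ _)) -(integralZl mS (iS _ _)).
rewrite -integralD//; last exact: integrableZl.
apply: eq_integral => y _; rewrite -!EFinM -EFinD /f; congr EFin; ring.
Qed.


Let bigcup_S : \bigcup_n S n = `]0, +oo[%classic.
Proof.
apply/seteqP; split=> [y [n _ /S_gt0 y0]|y]; rewrite /= in_itv/= andbT//.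
move=> y0; pose k := Num.truncn (Num.max y (- ln y)).
have : Num.max y (- ln y) < k.+1%:R by rewrite truncnS_gt.
rewrite gt_max => /andP[h1 h2]; exists k => //.
rewrite /S/= in_itv/= (ltW h1) andbT -[leRHS]lnK ?posrE// ler_expR.
by rewrite lerNl ltW.
Qed.

Let nondecreasing_S : nondecreasing_seq S.
Proof.
move=> i j ij; rewrite subsetEset => y; rewrite /S/= !in_itv/= => /andP[h1 h2].
have ij' : i.+1%:R <= j.+1%:R :> R by rewrite ler_nat.
by rewrite (le_trans _ h1) ?ler_expR ?lerN2// (le_trans h2).
Qed.

Let cvg_integral_S a b :
  (\int[mu]_(y in S n) (beta_kernel a b y)%:E @[n --> \oo] --> beta_integral a b)%E.
Proof.
rewrite /beta_integral -bigcup_S; apply: ge0_nondecreasing_set_cvg_integral.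
- exact: nondecreasing_S.
- by move=> i; exact: measurable_itv.
- move=> i; apply: measurable_funTS; apply/measurable_EFinP.
  exact: measurable_beta_kernel.
- by move=> i y _; rewrite lee_fin beta_kernel_ge0.
Qed.

Let boundary_cvg0 a b : 0 < a -> 0 < b ->
  (fun n => beta_kernel a (b + 1) n.+1%:R - beta_kernel a (b + 1) (expR (- n.+1%:R)))
    @ \oo --> (0 : R).
Proof.
move=> a0 b0; have h0 c y : 0 <= beta_kernel c (b + 1) y by exact: beta_kernel_ge0.
apply: (@squeeze_cvgr _ _ _ _ (fun n => - expR (- n.+1%:R * b))
    (fun n => expR (- n.+1%:R * a))).
- near=> n; apply/andP; split.
    rewrite (@le_trans _ _ (- beta_kernel a (b + 1) (expR (- n.+1%:R))))//; last first.
      by rewrite lerDr.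
    rewrite lerN2 /beta_kernel addrK [leRHS]expRM.
    rewrite (@le_trans _ _ ((1 - expR (- expR (- n.+1%:R))) `^ b))//.
      rewrite ler_piMl ?powR_ge0// -[leRHS]expR0 ler_expR mulNr oppr_le0.
      by rewrite mulr_ge0 ?expR_ge0 ?ltW.
    have e1 := onem_expRN_gt0 (expR_gt0 (- n.+1%:R)).
    apply: ge0_ler_powR; rewrite ?nnegrE ?expR_ge0 ?(ltW b0) ?(ltW e1)//.
    by have := expR_ge1Dx (- expR (- n.+1%:R : R)); lra.
  rewrite (@le_trans _ _ (beta_kernel a (b + 1) n.+1%:R))//; first by rewrite gerBl.
  have p1 : 1 `^ b = 1 :> R by rewrite powR1.
  rewrite /beta_kernel ler_piMr ?expR_ge0// addrK -[leRHS]p1.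
  have e0 := @onem_expRN_gt0 n.+1%:R (ltr0Sn _ _).
  by apply: ge0_ler_powR; rewrite ?nnegrE ?ler01 ?(ltW b0) ?(ltW e0)// gerBl expR_ge0.
- rewrite -[X in _ --> X]oppr0; apply: cvgN; exact: cvg_expRN.
- exact: cvg_expRN.
Unshelve. all: by end_near. Qed.

(** The functional equation of the Beta function, obtained from [integral_S] as the boundary terms
    vanish. *)
Lemma beta_integralS a b : 0 < a -> 0 < b ->
  ((a + b)%:E * beta_integral (a + 1) b = a%:E * beta_integral a b)%E.
Proof.
move=> a0 b0.
have h1 : ((a + b)%:E * \int[mu]_(y in S n) (beta_kernel (a + 1) b y)%:E
    @[n --> \oo] --> (a + b)%:E * beta_integral (a + 1) b)%E.
  by apply: cvgeZl => //; exact: cvg_integral_S.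
have h2 : (a%:E * \int[mu]_(y in S n) (beta_kernel a b y)%:E +
    (beta_kernel a (b + 1) n.+1%:R - beta_kernel a (b + 1) (expR (- n.+1%:R)))%:E
    @[n --> \oo] --> a%:E * beta_integral a b + 0%:E)%E.
  apply: cvgeD; first by rewrite fin_num_adde_defl.
    by apply: cvgeZl => //; exact: cvg_integral_S.
  by apply: cvg_EFin; [exact: nearW|exact: boundary_cvg0].
rewrite -[RHS]adde0; apply: (cvg_unique _ _ h2) => //.
apply: cvg_trans h1; apply: near_eq_cvg; near=> n.
by rewrite -integral_S.
Unshelve. all: by end_near. Qed.

Lemma beta_integral_rising a b p : 0 < a -> 0 < b ->
  ((rising (a + b) p)%:E * beta_integral (a + p%:R) b =
   (rising a p)%:E * beta_integral a b)%E.
Proof.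
move=> a0 b0; elim: p => [|p IH]; first by rewrite /rising !big_ord0 addr0.
rewrite !risingS (mulrC (rising a p)) !EFinM -!muleA -IH.
rewrite [RHS]muleCA; congr (_ * _)%E.
rewrite -natr1 addrA -beta_integralS ?ltr_wpDr//; congr (_%:E * _)%E.
by ring.
Qed.

(* The normalising constant enters only through the total mass being 1. *)
Lemma beta_density_moment a b C p : 0 < a -> 0 < b ->
  let f y := beta_kernel a b y * C * (0 < y)%R%:R in
  density_law f setT = 1%E ->
  (forall y, 0 <= f y) /\
  (\int[mu]_y (f y * expR (- y) ^+ p)%:E = (rising a p / rising (a + b) p)%:E)%E.
Proof.
move=> a0 b0 f; rewrite /density_law => f1.
have eqf (g : R -> R) q : (forall y, 0 < y -> g y = beta_kernel (a + q) b y * C) ->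
    (forall y, y <= 0 -> g y = 0) ->
    (\int[mu]_y (g y)%:E = \int[mu]_(y in `]0%R, +oo[) (beta_kernel (a + q) b y * C)%:E)%E.
  move=> g1 g0; rewrite [RHS]integral_mkcond; apply: eq_integral => y _.
  rewrite patchE; case: ifPn; rewrite ?notin_setE ?inE/= in_itv/= andbT.
    by move=> y0; rewrite g1.
  by move=> /negP; rewrite -leNgt => y0; rewrite g0.
(* A nonpositive constant would make the total mass nonpositive. *)
have C0 : 0 < C.
  rewrite ltNge; apply/negP => C0; have : (\int[mu]_y (f y)%:E <= 0)%E.
    have fN y : (0 <= (- f y)%:E)%E.
      by rewrite lee_fin oppr_ge0 mulr_le0_ge0// mulr_ge0_le0// beta_kernel_ge0.
    have -> : (\int[mu]_y (f y)%:E = \int[mu]_y - (- f y)%:E)%E.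
      by apply: eq_integral => y _; rewrite EFinN oppeK.
    by rewrite integral_ge0N// oppe_le0; apply: integral_ge0.
  by rewrite f1 lee_fin ler10.
have CI q : (\int[mu]_(y in `]0%R, +oo[) (beta_kernel (a + q) b y * C)%:E =
    C%:E * beta_integral (a + q) b)%E.
  rewrite -ge0_integralZl_EFin ?(ltW C0)//.
  - by apply: eq_integral => y _; rewrite mulrC EFinM.
  - by move=> y _; rewrite lee_fin beta_kernel_ge0.
  - apply: measurable_funTS; apply/measurable_EFinP; exact: measurable_beta_kernel.
split; first by move=> y; rewrite /f mulr_ge0 ?ler0n// mulr_ge0 ?beta_kernel_ge0 ?(ltW C0).
have I1 : (C%:E * beta_integral a b = 1)%E.
  rewrite -[a in LHS]addr0 -CI -f1; apply/esym/eqf => y y0; rewrite /f.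
    by rewrite addr0 y0 mulr1.
  by rewrite ltNge y0 mulr0.
rewrite (@eqf _ p%:R); first last.
- by move=> y y0; rewrite /f ltNge y0 mulr0 mul0r.
(* The factor exp(- p y) merely shifts the first parameter from a to a + p. *)
- move=> y y0; rewrite /f y0 mulr1 -expRM_natl /beta_kernel.
  rewrite (_ : - y * (a + p%:R) = - y * a + p%:R * - y); last by ring.
  by rewrite expRD; ring.
rewrite CI; have := beta_integral_rising p a0 b0.
have r0 : 0 < rising (a + b) p by rewrite rising_gt0// addr_gt0.
move=> h; have : (C%:E * ((rising (a + b) p)%:E * beta_integral (a + p%:R) b) =
    (rising a p)%:E)%E by rewrite h muleCA I1 mule1.
rewrite muleCA => {}h.
rewrite (mulrC (rising a p)) EFinM -h [RHS]muleA.
by rewrite -[X in _ = (X * _)%E]EFinM mulVf ?gt_eqF// mul1e.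
Qed.

End BetaKernel.

(** * The law of the sum *)

Section IndependentMoments.
Context d (T : measurableType d) (R : realType) (Q : probability T R).
Variables (f : R -> R).
Hypotheses (mf : measurable_fun setT f) (f0 : forall y, 0 <= f y).

(* kappa is the law of a real variable and e the mean of f under kappa, in the
   form that can be used for a variable on (T, Q) in presence of an independent
   factor g of integral c. *)
Definition has_mean (kappa : set R -> R) (e : R) : Prop :=
  forall (U g : T -> R) (c : R), measurable_fun setT U -> measurable_fun setT g ->
  (forall w, 0 <= g w) -> 0 <= c ->
  (forall A, measurable A ->
     \int[Q]_(w in U @^-1` A) (g w)%:E = (c * kappa A)%:E)%E ->
  (\int[Q]_w (g w * f (U w))%:E = (c * e)%:E)%E.

Lemma has_mean_density (pdf : R -> R) (e : R) :
  measurable_fun setT pdf -> (forall y, 0 <= pdf y) ->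
  density_law pdf setT = 1%E ->
  (\int[lebesgue_measure]_y (pdf y * f y)%:E = e%:E)%E ->
  has_mean (fun A => fine (density_law pdf A)) e.
Proof.
move=> mpdf pdf0 pdf1 pdfe U g c mU mg g0 c0 gU.
have mpdfE A : measurable A ->
    measurable_fun A (fun y : measurableTypeR R => (pdf y)%:E).
  by move=> mA; apply: measurable_funTS; apply/measurable_EFinP.
rewrite (@eq_integral_comp R _ _ Q _ _ (@lebesgue_measure R) U id g
  (fun y => c * pdf y) f)//; first last.
- move=> A mA; rewrite gU// preimage_id.
  have fA : density_law pdf A \is a fin_num.
    rewrite ge0_fin_numE; last by apply: integral_ge0 => y _; rewrite lee_fin.
    apply: (@le_lt_trans _ _ 1%E); last exact: ltry.
    rewrite -pdf1; apply: ge0_subset_integral => //; first exact: mpdfE.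
    by move=> y _; rewrite lee_fin.
  rewrite EFinM fineK// /density_law -ge0_integralZl_EFin//.
  + by move=> y _; rewrite lee_fin.
  + exact: mpdfE.
- by move=> y; rewrite mulr_ge0.
- by apply: measurable_funM => //; exact: measurable_cst.
have pf0 y : 0 <= pdf y * f y by rewrite mulr_ge0.
rewrite EFinM -pdfe -ge0_integralZl_EFin//.
- by apply: eq_integral => y _; rewrite -mulrA EFinM.
- by move=> y _; rewrite lee_fin.
- by apply/measurable_EFinP; exact: measurable_funM.
Qed.

Lemma has_mean_dirac0 : has_mean (fun A => fine (\d_(0 : R) A)) (f 0).
Proof.
move=> U g c mU mg g0 c0 gU.
rewrite (@eq_integral_comp R _ _ Q _ _ Q U (cst 0) g (cst c) f)//.
  transitivity ((c * f 0)%:E * Q setT)%E.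
    exact: (integral_cst Q measurableT (c * f 0)%:E).
  by rewrite probability_setT mule1.
move=> A mA; rewrite gU// diracE.
have [A0|A0] := boolP (0 \in A).
  rewrite (_ : cst 0 @^-1` A = setT); last first.
    by apply/seteqP; split=> // w _; move: A0; rewrite inE.
  transitivity (c%:E * Q setT)%E; first by rewrite probability_setT mule1 mulr1.
  exact: esym (integral_cst Q measurableT c%:E).
rewrite (_ : cst 0 @^-1` A = set0) ?integral_set0 ?mulr0//.
by rewrite -subset0 => w /=; move: A0; rewrite notin_setE.
Qed.

Definition rectangle (s : seq nat) (U : nat -> T -> R) (A : nat -> set R) : set T :=
  [set w | forall i, i \in s -> A i (U i w)].

Lemma measurable_rectangle s (U : nat -> T -> R) (A : nat -> set R) :
  (forall i, measurable_fun setT (U i)) -> (forall i, measurable (A i)) ->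
  measurable (rectangle s U A).
Proof.
move=> mU mA; elim: s => [|i s IH].
  by rewrite (_ : rectangle _ _ _ = setT)//; apply/seteqP; split.
rewrite (_ : rectangle _ _ _ = (U i @^-1` A i) `&` rectangle s U A).
  apply: measurableI => //; rewrite -[X in measurable X]setTI; exact: mU.
apply/seteqP; split=> w /=.
  move=> h; split; first by apply: h; rewrite mem_head.
  by move=> j js; apply: h; rewrite inE js orbT.
by move=> [h1 h2] j; rewrite inE => /orP[/eqP ->//|/h2].
Qed.

(** Induction on the list: the factor f (U i) joins the weight g, and [has_mean] for U i is applied
    to g times the indicator of the remaining rectangle. The weight in [has_mean] exists for this
    step. *)
Lemma integral_prod_indep (U : nat -> T -> R) (kappa : nat -> set R -> R)
    (e : nat -> R) (s : seq nat) : uniq s ->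
  (forall i, measurable_fun setT (U i)) ->
  (forall i A, i \in s -> 0 <= kappa i A) -> (forall i, i \in s -> has_mean (kappa i) (e i)) ->
  (forall i, i \in s -> 0 <= e i) ->
  forall (g : T -> R) (c : R), measurable_fun setT g -> (forall w, 0 <= g w) ->
  0 <= c ->
  (forall A, (forall i, measurable (A i)) ->
    \int[Q]_(w in rectangle s U A) (g w)%:E = (c * \prod_(i <- s) kappa i (A i))%:E)%E ->
  (\int[Q]_w (g w * \prod_(i <- s) f (U i w))%:E = (c * \prod_(i <- s) e i)%:E)%E.
Proof.
move=> us mU; elim: s us => [_|i s IH /= /andP[nis us]] k0 he e0 g c mg g0 c0 gA.
  have := gA (fun=> setT) (fun=> measurableT); rewrite !big_nil => <-.
  rewrite (_ : rectangle _ _ _ = setT); last by apply/seteqP; split.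
  by apply: eq_integral => w _; rewrite big_nil mulr1.
have mfU j : measurable_fun setT (fun w => f (U j w)) by exact: measurableT_comp.
rewrite big_cons mulrA.
rewrite (_ : (\int[Q]_w _)%E =
    (\int[Q]_w (g w * f (U i w) * \prod_(j <- s) f (U j w))%:E)%E); last first.
  by apply: eq_integral => w _; rewrite big_cons mulrA.
apply: IH => //.
- by move=> j A js; apply: k0; rewrite inE js orbT.
- by move=> j js; apply: he; rewrite inE js orbT.
- by move=> j js; apply: e0; rewrite inE js orbT.
- exact: measurable_funM.
- by move=> w; rewrite mulr_ge0.
- by rewrite mulr_ge0// e0// mem_head.
move=> A mA; have mD := measurable_rectangle s mU mA.
set D := rectangle s U A.
pose g' w := g w * \1_D w.
have mg' : measurable_fun setT g'.
  by apply: measurable_funM => //; exact: measurable_indic.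
have restrictE (B : set T) (h : T -> R) : measurable B ->
    (\int[Q]_(w in B `&` D) (h w)%:E = \int[Q]_(w in B) (h w * \1_D w)%:E)%E.
  move=> mB; rewrite integral_mkcondr; apply: eq_integral => w _.
  by rewrite patchE indicE; case: ifP => _; rewrite ?mulr1 ?mulr0.
rewrite -[in LHS](setTI D) restrictE//.
transitivity (\int[Q]_w (g' w * f (U i w))%:E)%E.
  by apply: eq_integral => w _; rewrite /g' mulrAC.
rewrite (he i (mem_head _ _) (U i) g' (c * \prod_(j <- s) kappa j (A j)))//.
- by congr EFin; rewrite mulrAC.
- by move=> w; rewrite /g' mulr_ge0// indicE ler0n.
- rewrite mulr_ge0// big_seq prodr_ge0// => j js.
  by apply: k0; rewrite inE js orbT.
move=> B mB; pose A' j := if j == i then B else A j.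
have mA' j : measurable (A' j) by rewrite /A'; case: ifP.
have mUB : measurable (U i @^-1` B) by rewrite -[X in measurable X]setTI; exact: mU.
rewrite /g' -restrictE//.
have -> : U i @^-1` B `&` D = rectangle (i :: s) U A'.
  apply/seteqP; split=> w /=.
    move=> [h1 h2] j; rewrite inE /A'; case: eqP => [->//|_ /= js].
    exact: h2.
  move=> h; split; first by have := h i (mem_head _ _); rewrite /A' eqxx.
  move=> j js; have := h j; rewrite inE js orbT => /(_ isT); rewrite /A'.
  by case: eqP => // ji; move: nis; rewrite -ji js.
rewrite gA// big_cons /A' eqxx; congr EFin; rewrite [kappa i B * _]mulrC mulrA; congr (_ * _ * _).
apply: eq_big_seq => j js; case: eqP => // ji.
by move: nis; rewrite -ji js.
Qed.

End IndependentMoments.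

(** * The law of the chain (K, Z) *)

Section PathLaw.
Context d (T : measurableType d) (R : realType) (Q : probability T R).
Variables (alpha : R) (r : nat).
Variables (Z : nat -> {RV Q >-> R}) (K : nat -> {RV Q >-> nat}).
Hypothesis hZ : Z_process alpha r K Z.

Local Notation path := (path_event r).
Local Notation K_ev k n := [set w | forall l, (r <= l <= n)%N -> K l w = k l].

Hypothesis K_step : forall n k, (r <= n)%N -> Q (K_ev k n.+1) != 0%E ->
  k n.+1 = k n \/ k n.+1 = (k n).+1.

(** The conditional law of Z_l given the two values of K at times l - 1 and l, made real-valued for
    use with [has_mean]. *)
Definition Z_law (k : nat -> nat) (l : nat) (A : set R) : R :=
  if k l == (k l.-1).+1 then fine (density_law (Z_pdf alpha l (k l.-1)) A)
  else fine (\d_(0 : R) A).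

Let KF := fun i => K i : T -> nat.
Let ZF := fun i => Z i : T -> R.

Lemma path_eventS n k (A : nat -> set R) : (r <= n)%N ->
  path n.+1 KF ZF k A =
  path n KF ZF k A `&` [set w | K n.+1 w = k n.+1 /\ A n.+1 (Z n.+1 w)].
Proof.
move=> rn; apply/seteqP; split=> w /=.
  move=> [h1 h2]; split.
    by split=> l hl; [apply: h1|apply: h2]; lia.
  by split; [apply: h1|apply: h2]; lia.
move=> [[h1 h2] [h3 h4]]; split=> l hl.
  have [->//|ln] := eqVneq l n.+1; apply: h1; lia.
have [->//|ln] := eqVneq l n.+1; apply: h2; lia.
Qed.

Lemma measurable_K_eq n v : measurable [set w | K n w = v].
Proof. by have := measurable_funPTI (K n) (I : measurable [set v]). Qed.

Lemma measurable_KZ n v (A : set R) : measurable A ->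
  measurable [set w | K n w = v /\ A (Z n w)].
Proof.
move=> mA; apply: measurableI; first exact: measurable_K_eq.
exact: (measurable_funPTI (Z n) mA).
Qed.

Lemma measurable_path n k (A : nat -> set R) : (r <= n)%N ->
  (forall i, measurable (A i)) -> measurable (path n KF ZF k A).
Proof.
move=> /subnKC <- mA; elim: (n - r)%N => [|j IH].
  rewrite addn0 (_ : path _ _ _ _ _ = [set w | K r w = k r]).
    exact: measurable_K_eq.
  apply/seteqP; split=> w /=; first by move=> [h _]; apply: h; rewrite leqnn.
  by move=> h; split=> l hl; [have -> : l = r by lia|lia].
rewrite addnS path_eventS ?leq_addr//; apply: measurableI => //.
exact: measurable_KZ.
Qed.

Lemma path_eventT n k : path n KF ZF k (fun=> setT) = K_ev k n.
Proof. by apply/seteqP; split=> [w []|w h]//; split. Qed.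

Lemma measurable_K_ev n k : (r <= n)%N -> measurable (K_ev k n).
Proof. by move=> rn; rewrite -path_eventT; exact: measurable_path. Qed.

Lemma path_sub_K_ev n k (A : nat -> set R) : path n KF ZF k A `<=` K_ev k n.
Proof. by move=> w []. Qed.

Lemma prob_K_evS n k : (r <= n)%N -> Q (K_ev k n.+1) != 0%E ->
  [/\ Q (K_ev k n) != 0%E, Q [set w | K n w = k n] != 0%E &
      Q [set w | K n w = k n /\ K n.+1 w = k n.+1] != 0%E].
Proof.
move=> rn h; have sub S : measurable S -> K_ev k n.+1 `<=` S -> Q S != 0%E.
  move=> mS sS; apply: contra_neq h => QS0; apply/eqP; rewrite -measure_le0 -QS0.
  by rewrite le_measure ?inE//; apply: measurable_K_ev; lia.
split; apply: sub.
- exact: measurable_K_ev.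
- by move=> w h' l hl; apply: h'; lia.
- exact: measurable_K_eq.
- by move=> w; apply; lia.
- by apply: measurableI; exact: measurable_K_eq.
- by move=> w h'; split; apply: h'; lia.
Qed.

Lemma Z_lawE n k (A : set R) : (r <= n)%N -> Q (K_ev k n.+1) != 0%E -> measurable A ->
  Q ([set w | K n.+1 w = k n.+1 /\ A (Z n.+1 w)] `&` [set w | K n w = k n]) =
  ((Z_law k n.+1 A)%:E * Q [set w | K n w = k n /\ K n.+1 w = k n.+1])%E.
Proof.
move=> rn h mA; have [_ _ h2] := prob_K_evS rn h.
rewrite -(@fine_cprob _ _ _ Q (Z n.+1 @^-1` A)).
- by congr (Q _); apply/seteqP; split=> w /=; [case=> -[]|case=> ? []].
- exact: (measurable_funPTI (Z n.+1) mA).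
- by apply: measurableI; exact: measurable_K_eq.
move=> h2'; rewrite /Z_law/=.
have [e|e] := K_step rn h.
  rewrite e ifF; last by apply/eqP; lia.
  rewrite e in h2; exact: (congr1 fine (zp_stay hZ (l := n.+1) rn mA h2)).
rewrite e eqxx; rewrite e in h2.
exact: (congr1 fine (zp_jump hZ (l := n.+1) rn mA h2)).
Qed.

(** Total mass 1 is read off from Q, by taking the full set in [Z_lawE] and cancelling a nonzero
    probability, instead of evaluating the Beta function. *)
Lemma Z_lawT n k : (r <= n)%N -> Q (K_ev k n.+1) != 0%E -> Z_law k n.+1 setT = 1.
Proof.
move=> rn h; have [_ _ h2] := prob_K_evS rn h.
have := Z_lawE rn h measurableT.
rewrite (_ : _ `&` _ = [set w | K n w = k n /\ K n.+1 w = k n.+1]); last first.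
  by apply/seteqP; split=> w /= [] [].
have mS : measurable [set w | K n w = k n /\ K n.+1 w = k n.+1].
  by apply: measurableI; exact: measurable_K_eq.
move: h2; set S := [set w | _ /\ _]; have fS := fin_num_measure Q S mS.
rewrite -(fineK fS) -EFinM eqe => h2 [h3].
by apply: (mulIf h2); rewrite mul1r -h3.
Qed.

(* The chain (K, Z) starts afresh from K_{l-1} at each step, so the law of a
   path factorises. *)
Lemma prob_path n k (A : nat -> set R) : (r <= n)%N -> (forall i, measurable (A i)) ->
  Q (path n KF ZF k A) =
  (Q (K_ev k n) * (\prod_(r.+1 <= l < n.+1) Z_law k l (A l))%:E)%E.
Proof.
move=> /subnKC <- mA; elim: (n - r)%N => [|j IH].
  rewrite addn0 big_geq// mule1; congr (Q _); apply/seteqP; split=> w /=; first by case.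
  by move=> h; split=> // l; lia.
rewrite addnS; move: (r + j)%N (leq_addr j r) IH => {j}n rn IH.
have [h0|h] := eqVneq (Q (K_ev k n.+1)) 0%E.
  rewrite h0 mul0e; apply/eqP; rewrite -measure_le0 -h0.
  rewrite le_measure ?inE//; last exact: path_sub_K_ev.
    by apply: measurable_path => //; lia.
  by apply: measurable_K_ev; lia.
have [h1 h2 h3] := prob_K_evS rn h.
have indep B : (forall i, measurable (B i)) ->
    (Q (path n.+1 KF ZF k B) * Q [set w | K n w = k n] =
     (Z_law k n.+1 (B n.+1))%:E * Q [set w | K n w = k n /\ K n.+1 w = k n.+1] *
     Q (path n KF ZF k B))%E.
  move=> mB; have := @zp_indep _ _ _ _ _ _ _ _ hZ n.+1 (k n.+1) k B rn mB.
  have pK : path n KF ZF k B `&` [set w | K n w = k n] = path n KF ZF k B.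
    by apply: setIidl => w [h4 _] /=; apply: h4; lia.
  by rewrite /cond_indep/= -Z_lawE// -setIA pK setIC -path_eventS// pK.
have mKn : measurable [set w | K n w = k n] by exact: measurable_K_eq.
have mKS : measurable [set w | K n w = k n /\ K n.+1 w = k n.+1].
  by apply: measurableI; exact: measurable_K_eq.
have mpn B : (forall i, measurable (B i)) -> measurable (path n KF ZF k B).
  exact: measurable_path.
have mpS B : (forall i, measurable (B i)) -> measurable (path n.+1 KF ZF k B).
  by apply: measurable_path; lia.
have iA := indep A mA.
(* With full sets the same identity describes the path of K alone; comparing the two eliminates the
   transition probability. *)
have := indep (fun=> setT) (fun=> measurableT); rewrite !path_eventT Z_lawT// mul1e.
have fin S : measurable S -> Q S = (fine (Q S))%:E.
  by move=> mS; rewrite fineK// fin_num_measure.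
rewrite big_nat_recr//=.
move: iA; rewrite IH.
rewrite (fin _ (mpS _ mA)) (fin _ mKn) (fin _ mKS) (fin _ (measurable_K_ev _ rn)).
rewrite (fin _ (@measurable_K_ev n.+1 k _)); last by lia.
rewrite -!EFinM => -[iA] [iT]; congr EFin.
have q0 : fine (Q [set w | K n w = k n]) != 0.
  by rewrite fine_eq0// fin_num_measure.
by apply: (mulIf q0); rewrite iA [RHS]mulrAC iT; ring.
Qed.

End PathLaw.

Lemma telescope_prod_div (F : fieldType) (f : nat -> F) m n : (m <= n)%N ->
  (forall k, (m <= k <= n)%N -> f k != 0) ->
  \prod_(m <= k < n) (f k / f k.+1) = f m / f n.
Proof.
move=> /subnKC <-; elim: (n - m)%N => [|j IH] f0.
  by rewrite addn0 big_geq// divff// f0// addn0 !leqnn.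
rewrite addnS big_nat_recr ?leq_addr//= IH; last by move=> k hk; apply: f0; lia.
rewrite mulrA divfK//; apply: f0; lia.
Qed.

(** * Moments of the partial sums along a path of K *)

Section TargetMoments.
Context d (T : measurableType d) (R : realType) (Q : probability T R).
Variables (alpha : R) (m r : nat).
Variables (Ystar Y Z : nat -> {RV Q >-> R}) (K : nat -> {RV Q >-> nat}).
Hypotheses (alpha1 : alpha < 1) (m0 : (0 < m)%N) (mr : (m <= r)%N).
Hypothesis hYstar : forall (j : nat) (A : set R), (2 <= j <= m)%N -> measurable A ->
  distribution Q (Ystar j) A = density_law (Ystar_pdf alpha j) A.
Hypothesis hY : forall (i : nat) (A : set R), (m < i <= r)%N -> measurable A ->
  distribution Q (Y i) A = density_law (Y_pdf alpha m i) A.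
Hypothesis hZ : Z_process alpha r K Z.
Hypothesis hindep : summands_indep m r Ystar Y K Z.

Local Notation K_ev k n := [set w | forall l, (r <= l <= n)%N -> K l w = k l].

Hypothesis K_step : forall n k, (r <= n)%N -> Q (K_ev k n.+1) != 0%E ->
  k n.+1 = k n \/ k n.+1 = (k n).+1.
Hypothesis K_bound : forall n k, (r <= n)%N -> Q (K_ev k n) != 0%E ->
  (0 < k n <= n)%N.

Variable p : nat.
Local Notation f := (fun y : R => expR (- y) ^+ p).

Let mf : measurable_fun setT f.
Proof.
by apply: measurable_funX; apply: measurableT_comp.
Qed.

Let f0 y : 0 <= f y.
Proof. by rewrite exprn_ge0// expR_ge0. Qed.

(** Common to the three families of summands: each continuous density is a constant times a beta
    kernel, the exponential one having b = 1. *)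
Let has_mean_beta (pdf : R -> R) a b C : 0 < a -> 0 < b ->
  (forall y, pdf y = beta_kernel a b y * C * (0 < y)%R%:R) ->
  density_law pdf setT = 1%E ->
  has_mean Q f (fun A => fine (density_law pdf A)) (rising a p / rising (a + b) p) /\
  (forall A, 0 <= fine (density_law pdf A)) /\ 0 <= rising a p / rising (a + b) p.
Proof.
move=> a0 b0 /funext pdfE; rewrite {}pdfE => pdf1.
have [pdf0 pdfe] := @beta_density_moment R a b C p a0 b0 pdf1.
split; last split.
- apply: has_mean_density => //.
  apply: measurable_funM.
    by apply: measurable_funM => //; exact: measurable_beta_kernel.
  rewrite (_ : (fun _ => _) = \1_`]0, +oo[%classic).
    by apply: measurable_indic; exact: measurable_itv.
  by apply/funext => y; rewrite indicE; congr (_%:R); rewrite mem_setE in_itv/= andbT.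
- by move=> A; apply: fine_ge0; apply: integral_ge0 => y _; rewrite lee_fin.
- by rewrite divr_ge0// ltW// rising_gt0// addr_gt0.
Qed.
(** One sequence for all three sums, so that [integral_prod_indep] applies to them at once. *)
Definition summand j : {RV Q >-> R} :=
  if (j <= m)%N then Ystar j else if (j <= r)%N then Y j else Z j.

Definition summand_law (k : nat -> nat) j (A : set R) : R :=
  if (j <= m)%N then fine (density_law (Ystar_pdf alpha j) A)
  else if (j <= r)%N then fine (density_law (Y_pdf alpha m j) A)
  else Z_law alpha k j A.

(** Written with the weights at consecutive times, so that products telescope. The terms up to m
    correspond to a path with a record at every time, those up to r to a path that then stays at m,
    the later ones to the actual path. *)
Definition summand_mean (k : nat -> nat) j : R :=
  if (j <= m)%N then
    rising (weight alpha j.-1 j.-1) p / rising (weight alpha j j) p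
  else if (j <= r)%N then
    rising (weight alpha j.-1 m) p / rising (weight alpha j m) p
  else path_factor alpha p j.-1 (k j.-1) (k j).

Lemma has_mean_summand k n j : (r <= n)%N -> Q (K_ev k n) != 0%E -> (2 <= j <= n)%N ->
  has_mean Q f (summand_law k j) (summand_mean k j) /\
  (forall A, 0 <= summand_law k j A) /\ 0 <= summand_mean k j.
Proof.
move=> rn Qn jn; have b0 : 0 < 1 - alpha by rewrite subr_gt0.
have jE : j.-1%:R = j%:R - 1 :> R by rewrite -subn1 natrB//; lia.
rewrite /summand_law /summand_mean; case: ifPn => [jm|jm].
  have a0 : 0 < weight alpha j.-1 j.-1 by apply: weight_gt0 => //; lia.
  rewrite (_ : weight alpha j j = weight alpha j.-1 j.-1 + (1 - alpha)).
    apply: (has_mean_beta (C := (Beta (j%:R - 1 - alpha * (j%:R - 1)) (1 - alpha))^-1)) => //.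
      move=> y; rewrite /Ystar_pdf /beta_kernel /weight jE; congr (_ * _ `^ _ * _ * _).
      by ring.
    rewrite -hYstar//; last by lia.
    exact: probability_setT.
  by rewrite /weight jE; ring.
case: ifPn => [jr|jr].
  have a0 : 0 < weight alpha j.-1 m by apply: weight_gt0 => //; lia.
  rewrite (_ : weight alpha j m = weight alpha j.-1 m + 1).
    apply: (has_mean_beta (C := j%:R - alpha * m%:R - 1)) => //.
      move=> y; rewrite /Y_pdf /beta_kernel /weight jE subrr powRr0 mulr1.
      by congr (_ * _); rewrite mulrC.
    rewrite -hY//; last by lia.
    exact: probability_setT.
  by rewrite /weight jE; ring.
have Qj : Q (K_ev k j) != 0%E.
  apply: contra_neq Qn => Qj0; apply/eqP; rewrite -measure_le0 -Qj0.
  rewrite le_measure ?inE//; [| |by move=> w h l hl; apply: h; lia].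
    exact: (measurable_K_ev Z K).
  by apply: (measurable_K_ev Z K); lia.
have rj : (r <= j.-1)%N by lia.
have jS : j = j.-1.+1 by lia.
have ZT : Z_law alpha k j setT = 1.
  by rewrite jS; apply: (Z_lawT hZ K_step) => //; rewrite -jS.
rewrite /path_factor; move: ZT; rewrite /Z_law.
have [kj|kj] := eqVneq (k j) (k j.-1).+1 => ZT; last first.
  split; last by split=> // A; rewrite diracE; case: (_ \in _).
  have -> : 1 = f 0 by rewrite oppr0 expR0 expr1n.
  exact: has_mean_dirac0.
have [Qj1 _ _] : [/\ Q (K_ev k j.-1) != 0%E, Q [set w | K j.-1 w = k j.-1] != 0%E &
    Q [set w | K j.-1 w = k j.-1 /\ K j.-1.+1 w = k j.-1.+1] != 0%E].
  by apply: (prob_K_evS Z) => //; rewrite -jS.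
have a0 : 0 < weight alpha j.-1 (k j.-1).
  by apply: weight_gt0 => //; apply: (@K_bound _ k).
rewrite -jS (_ : weight alpha j (k j) = weight alpha j.-1 (k j.-1) + (1 - alpha)).
  apply: (has_mean_beta
    (C := (Beta (j%:R - 1 - alpha * (k j.-1)%:R) (1 - alpha))^-1)) => //.
    move=> y; rewrite /Z_pdf /beta_kernel /weight jE; congr (_ * _ `^ _ * _ * _).
    by ring.
  by move: ZT; case: (density_law _ _) => [x /= ->|/eqP|/eqP]//; rewrite eq_sym oner_eq0.
by rewrite kj /weight jE -natr1; ring.
Qed.

(** On a fixed path the summands behave as independent ones: [hindep] and [prob_path] factorise the
    probability of every rectangle, and the indicator of the path is the weight. The first two
    blocks of means then telescope to the initial ratio. *)
Lemma integral_summands k n : (r <= n)%N ->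
  (\int[Q]_(w in K_ev k n) (\prod_(2 <= j < n.+1) f (summand j w))%:E =
   (rising (1 - alpha) p / rising (weight alpha r m) p *
    \prod_(r <= i < n) path_factor alpha p i (k i) (k i.+1))%:E * Q (K_ev k n))%E.
Proof.
move=> rn; have mK : measurable (K_ev k n) by exact: (measurable_K_ev Z K).
have mprod : measurable_fun setT (fun w => (\prod_(2 <= j < n.+1) f (summand j w))%:E).
  apply/measurable_EFinP; apply: measurable_prod => j _.
  exact: (measurableT_comp mf).
have [Q0|Qn] := eqVneq (Q (K_ev k n)) 0%E.
  rewrite Q0 mule0; apply: null_set_integral => //.
  exact: measurable_funTS.
have fQ := fin_num_measure Q _ mK.
set s := index_iota 2 n.+1.
have sP j : j \in s -> (2 <= j <= n)%N by rewrite mem_index_iota; lia.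
have split3 (F : nat -> R) : \prod_(j <- s) F j =
    \prod_(2 <= j < m.+1) F j * \prod_(m.+1 <= j < r.+1) F j *
    \prod_(r.+1 <= j < n.+1) F j.
  have [h1 h2 h3 h4] : [/\ 1 < m.+1, m < n.+1, m < r.+1 & r < n.+1]%N by split; lia.
  by rewrite /s (big_cat_nat h1 h2) (big_cat_nat h3 h4) /= mulrA.
transitivity (\int[Q]_w (\1_(K_ev k n) w * \prod_(j <- s) f (summand j w))%:E)%E.
  rewrite integral_mkcond; apply: eq_integral => w _.
  by rewrite patchE indicE; case: ifP => _; rewrite ?mul1r ?mul0r.
rewrite (@integral_prod_indep _ _ _ Q f mf f0 summand (summand_law k) (summand_mean k)
  s _ _ _ _ _ (\1_(K_ev k n)) (fine (Q (K_ev k n)))) //; first last.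
- move=> A mA.
  have -> : (\int[Q]_(w in rectangle s summand A) (\1_(K_ev k n) w)%:E =
      Q (K_ev k n `&` rectangle s summand A))%E.
    by rewrite integral_indic//; exact: measurable_rectangle.
  have RE : K_ev k n `&` rectangle s summand A =
      [set w | forall j, (2 <= j <= m)%N -> A j (Ystar j w)] `&`
      [set w | forall i, (m < i <= r)%N -> A i (Y i w)] `&`
      path_event r n (fun i => K i) (fun i => Z i) k A.
    apply/seteqP; split=> w /=.
      move=> [hk hr]; split.
        split=> j jm.
          have := hr j; rewrite mem_index_iota /summand ifT; last by lia.
          by apply; lia.
        have := hr j; rewrite mem_index_iota /summand ifF; last by lia.
        by rewrite ifT; [apply|]; lia.
      split=> // l hl; have := hr l; rewrite mem_index_iota /summand ifF; last by lia.
      by rewrite ifF; [apply|]; lia.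
    move=> [[h1 h2] [h3 h4]]; split=> // j /sP jn; rewrite /summand.
    case: ifPn => jm; first by apply: h1; lia.
    by case: ifPn => jr; [apply: h2|apply: h4]; lia.
  rewrite RE hindep// split3.
  rewrite (prob_path hZ K_step k rn mA).
  have prodE a b (F : nat -> \bar R) (G : nat -> R) :
      (forall j, (a <= j < b)%N -> F j = (G j)%:E) ->
      (\prod_(a <= j < b) F j)%E = (\prod_(a <= j < b) G j)%:E.
    by move=> FG; rewrite (big_morph EFin EFinM (erefl _)); apply: eq_big_nat.
  have finQ (W : {RV Q >-> R}) B : measurable B ->
      Q (W @^-1` B) = (fine (distribution Q W B))%:E.
    by move=> mB; rewrite fineK// fin_num_measure.
  rewrite (prodE _ _ _ (fun j => summand_law k j (A j))); last first.
    move=> j jm; have jm' : (2 <= j <= m)%N by lia.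
    by rewrite finQ// (hYstar jm')// /summand_law ifT//; lia.
  rewrite (prodE m.+1 _ _ (fun j => summand_law k j (A j))); last first.
    move=> j jm; have jm' : (m < j <= r)%N by lia.
    by rewrite finQ// (hY jm')// /summand_law ifF ?ifT//; lia.
  rewrite -[in LHS](fineK fQ) -!EFinM; congr EFin.
  have -> : \prod_(r.+1 <= l < n.+1) Z_law alpha k l (A l) =
      \prod_(r.+1 <= l < n.+1) summand_law k l (A l).
    by apply: eq_big_nat => l hl; rewrite /summand_law !ifF//; lia.
  by ring.
- exact: fine_ge0.
- by move=> j /sP jn; have [_ []] := has_mean_summand rn Qn jn.
- by move=> j /sP jn; have [] := has_mean_summand rn Qn jn.
- by move=> j A /sP jn; have [_ []] := has_mean_summand rn Qn jn.
- exact: iota_uniq.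
rewrite -[in RHS](fineK fQ) -EFinM mulrC; congr (_ * _)%:E.
have rise0 j l : (0 < l <= j)%N -> rising (weight alpha j l) p != 0.
  by move=> jl; rewrite gt_eqF// rising_gt0//; exact: weight_gt0.
rewrite split3 (big_add1 _ _ 1) (big_add1 _ _ m) (big_add1 _ _ r)/=.
have -> : \prod_(1 <= j < m) summand_mean k j.+1 =
    rising (1 - alpha) p / rising (weight alpha m m) p.
  (* The telescoping starts at time 1, with a single class. *)
  rewrite (_ : 1 - alpha = weight alpha 1 1); last by rewrite /weight mulr1.
  rewrite -[RHS](@telescope_prod_div _ (fun j => rising (weight alpha j j) p) 1 m)//.
    by apply: eq_big_nat => j jm; rewrite /summand_mean ifT//; lia.
  by move=> j jm; apply: rise0; lia.
have -> : \prod_(m <= j < r) summand_mean k j.+1 =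
    rising (weight alpha m m) p / rising (weight alpha r m) p.
  rewrite -[RHS](@telescope_prod_div _ (fun j => rising (weight alpha j m) p) m r)//.
    by apply: eq_big_nat => j jm; rewrite /summand_mean ifF ?ifT//; lia.
  by move=> j jm; apply: rise0; lia.
rewrite mulrA divfK; last by apply: rise0; lia.
congr (_ * _); apply: eq_big_nat => j jn.
by rewrite /summand_mean !ifF//; lia.
Qed.

End TargetMoments.

(** * A law on the unit interval is determined by its moments *)

Section MomentsDetermineLaw.
Context (R : realType).

Lemma bernoulli_ineq (y : R) N : 0 <= y <= 1 -> 1 - N%:R * y <= (1 - y) ^+ N.
Proof.
move=> /andP[y0 y1]; elim: N => [|N IH]; first by rewrite mul0r subr0 expr0.
rewrite exprSr; apply: (@le_trans _ _ ((1 - N%:R * y) * (1 - y))); last first.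
  by rewrite ler_wpM2r// subr_ge0.
have : 0 <= N%:R * (y * y) by rewrite !mulr_ge0.
by rewrite -[N.+1%:R]natr1; lra.
Qed.

(** With s = sqrt z, the product n s^n stays bounded by Bernoulli's inequality for 1 / s, and the
    other factor s^n tends to 0. *)
Lemma cvg_natM_expr (z : R) : 0 <= z < 1 -> (fun n => n%:R * z ^+ n) @ \oo --> (0 : R).
Proof.
move=> /andP[z0 z1]; have [->|zn0] := eqVneq z 0.
  apply: (@cvg_trans _ ((fun=> 0 : R) @ \oo)); last exact: cvg_cst.
  apply: near_eq_cvg; near=> n; rewrite expr0n.
  have n0 : (0 < n)%N by near: n; exact: nbhs_infty_gt.
  by rewrite gtn_eqF// mulr0.
have {zn0}z0 : 0 < z by rewrite lt0r zn0.
pose s := Num.sqrt z; have s0 : 0 < s by rewrite sqrtr_gt0.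
have s1 : s < 1 by rewrite -sqrtr1 ltr_sqrt.
pose h := s^-1 - 1; have h0 : 0 < h by rewrite subr_gt0 invf_gt1.
have sh : s = (1 + h)^-1 by rewrite /h addrC subrK invrK.
have h1 : 0 < 1 + h by rewrite addr_gt0.
have nh n : n%:R * s ^+ n <= h^-1.
  rewrite sh exprVn ler_pdivrMr ?exprn_gt0//.
  rewrite mulrC ler_pdivlMr//.
  elim: n => [|n IH]; first by rewrite mul0r expr0.
  rewrite exprS -natr1 mulrDl mul1r.
  have e1 : 1 <= (1 + h) ^+ n by rewrite exprn_ege1// lerDl ltW.
  have : h * 1 <= h * (1 + h) ^+ n by rewrite ler_wpM2l// ltW.
  by move: ((1 + h) ^+ n) IH => E IH; lra.
apply: (@squeeze_cvgr _ _ _ _ (fun=> 0) (fun n : nat => h^-1 * s ^+ n)).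
- near=> n; rewrite mulr_ge0 ?exprn_ge0 ?(ltW z0)//=.
  have -> : z = s * s by rewrite -expr2 sqr_sqrtr// ltW.
  by rewrite exprMn mulrA ler_wpM2r// exprn_ge0// ltW.
- exact: cvg_cst.
- rewrite -[X in _ --> X](mulr0 h^-1); apply: cvgM; first exact: cvg_cst.
  by apply: cvg_expr; rewrite ger0_norm ?(ltW s0).
Unshelve. all: by end_near. Qed.

(** Lies between n t^-n and 2 n t^-n. The extra factor n makes N t^n unbounded, while N x^n still
    tends to 0 for x < t. *)
Let N (t : R) n : nat := (n * (Num.truncn (t ^- n)).+1)%N.

(* (1 - x^n)^(N n) with N n ~ n t^-n tends to the indicator of x < t. *)
Lemma cvg_step_polynomial (t x : R) : 0 < t <= 1 -> 0 <= x <= 1 ->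
  (fun n => (1 - x ^+ n) ^+ N t n) @ \oo --> ((x < t)%R%:R : R).
Proof.
move=> /andP[t0 t1] /andP[x0 x1].
have tn0 n : 0 < t ^+ n by exact: exprn_gt0.
have xn n : 0 <= x ^+ n <= 1 by rewrite exprn_ge0//= exprn_ile1.
have N_ge n : n%:R <= (N t n)%:R * t ^+ n.
  rewrite /N natrM -mulrA ler_peMr// -ler_pdivrMr// mul1r.
  by rewrite ltW// truncnS_gt.
have N_le n : (N t n)%:R <= n%:R * (2 * t ^- n).
  rewrite /N natrM ler_wpM2l// -natr1.
  have : 1 <= t ^- n by rewrite invf_ge1// exprn_ile1// ltW.
  have : (Num.truncn (t ^- n))%:R <= t ^- n by rewrite truncn_le// invr_ge0 ltW.
  by lra.
have [xt|tx] := ltP x t.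
  (* Below t, Bernoulli's inequality bounds the power from below by 1 - N x^n, and N x^n <= 2 n (x /
     t)^n. *)
  apply: (@squeeze_cvgr _ _ _ _ (fun n : nat => 1 - 2 * (n%:R * (x / t) ^+ n)) (fun=> 1)).
  - near=> n; have /andP[xn0 xn1] := xn n.
    apply/andP; split; last by rewrite exprn_ile1 ?subr_ge0// gerBl.
    apply: le_trans (bernoulli_ineq (N t n) (xn n)).
    rewrite lerD2l lerN2; apply: (@le_trans _ _ (n%:R * (2 * t ^- n) * x ^+ n)).
      by rewrite ler_wpM2r.
    by rewrite expr_div_n le_eqVlt; apply/orP; left; apply/eqP; ring.
  - rewrite -[X in _ --> X]subr0 -[X in _ - X](mulr0 2).
    apply: cvgB; first exact: cvg_cst.
    apply: cvgM; first exact: cvg_cst.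
    by apply: cvg_natM_expr; rewrite divr_ge0 ?(ltW t0)//= ltr_pdivrMr// mul1r.
  - exact: cvg_cst.
(* From t on, t included, 1 - u <= exp(- u) and N x^n >= n give the bound exp(- n). *)
apply: (@squeeze_cvgr _ _ _ _ (fun=> 0) (fun n : nat => expR (- n%:R))).
- near=> n; have /andP[xn0 xn1] := xn n.
  rewrite exprn_ge0 ?subr_ge0//=.
  apply: (@le_trans _ _ (expR (- x ^+ n) ^+ N t n)).
    rewrite lerXn2r ?nnegrE ?subr_ge0 ?expR_ge0//.
    by have := expR_ge1Dx (- x ^+ n); lra.
  rewrite -expRM_natl ler_expR mulrN lerN2; apply: le_trans (N_ge n) _.
  by rewrite ler_wpM2l// lerXn2r ?nnegrE// ltW.
- exact: cvg_cst.
- exact: cvgn_expR.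
Unshelve. all: by end_near. Qed.

Let unit_itv : set R := `[0, 1]%classic.

(** The step polynomials are bounded by 1 on [0, 1] and converge pointwise to indicators of open
    rays. Dominated convergence therefore turns equal moments into equal masses of rays, which
    generate the Borel sets. *)
Lemma moments_unique (mu nu : {measure set R -> \bar R}) :
  (mu setT < +oo)%E -> (nu setT < +oo)%E ->
  mu (~` `[0, 1]%classic) = 0%E -> nu (~` `[0, 1]%classic) = 0%E ->
  (forall p, \int[mu]_(x in `[0%R, 1%R]) (x ^+ p)%:E =
             \int[nu]_(x in `[0%R, 1%R]) (x ^+ p)%:E)%E ->
  forall A, measurable A -> mu A = nu A.
Proof.
move=> fmu fnu mu0 nu0 mom.
have mI : measurable unit_itv by exact: measurable_itv.
have fin (m : {measure set R -> \bar R}) : (m setT < +oo)%E -> (m unit_itv < +oo)%E.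
  by move=> mT; apply: le_lt_trans mT; rewrite le_measure ?inE.
have bound (m : {measure set R -> \bar R}) (g : R -> R) : (m setT < +oo)%E ->
    measurable_fun setT g -> (forall x, unit_itv x -> `|g x| <= 1) ->
    m.-integrable unit_itv (EFin \o g).
  move=> mT mg g1; apply: measurable_bounded_integrable => //.
  - exact: fin.
  - exact: measurable_funTS.
  exists 1; split; first exact: num_real.
  by move=> M M1 x Ix; apply: le_trans (g1 x Ix) (ltW M1).
have polyE (m : {measure set R -> \bar R}) : (m setT < +oo)%E -> forall q : {poly R},
    (\int[m]_(x in unit_itv) (q.[x])%:E =
     \sum_(i < size q) (q`_i)%:E * \int[m]_(x in unit_itv) (x ^+ i)%:E)%E.
  move=> mT q.
  have iX i : m.-integrable unit_itv (fun x => (x ^+ i)%:E).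
    apply: (bound _ (fun x => x ^+ i)) => //.
    move=> x; rewrite /unit_itv/= in_itv/= => /andP[x0 x1].
    by rewrite ger0_norm ?exprn_ge0// exprn_ile1.
  transitivity (\int[m]_(x in unit_itv) \sum_(i < size q) ((q`_i)%:E * (x ^+ i)%:E))%E.
    apply: eq_integral => x _; rewrite horner_coef -sumEFin.
    by apply: eq_bigr => i _; rewrite EFinM.
  rewrite integral_sum//; last by move=> i; exact: integrableZl.
  by apply: eq_bigr => i _; rewrite integralZl.
have step (t : R) : 0 < t <= 1 -> mu (unit_itv `&` `]-oo, t[) = nu (unit_itv `&` `]-oo, t[).
  move=> t01; pose q n : {poly R} := (1 - 'X^n) ^+ N t n.
  have qE n x : (q n).[x] = (1 - x ^+ n) ^+ N t n by rewrite /q !hornerE.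
  have lim (m : {measure set R -> \bar R}) : (m setT < +oo)%E ->
      (\int[m]_(x in unit_itv) ((q n).[x])%:E @[n --> \oo] -->
       m (unit_itv `&` `]-oo, t[))%E.
    move=> mT.
    have mq n : measurable_fun unit_itv (fun x : R => ((q n).[x])%:E).
      apply: measurable_funTS; apply/measurable_EFinP.
      apply: (eq_measurable_fun (fun x : R => (1 - x ^+ n) ^+ N t n)).
        by move=> x _; rewrite qE.
      by apply: measurable_funX; apply: measurable_funB => //; exact: measurable_funX.
    have mi : measurable_fun unit_itv (fun x : R => (\1_(`]-oo, t[%classic) x : R)%:E).
      apply: measurable_funTS; apply/measurable_EFinP; apply: measurable_indic.
      exact: measurable_itv.
    have cq : {ae m, forall x, unit_itv x -> (fun n => ((q n).[x])%:E) @ \oo -->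
        ((\1_(`]-oo, t[%classic) x : R)%:E)}.
      apply: aeW => x; rewrite /unit_itv/= in_itv/= => x01; apply: cvg_EFin.
        exact: nearW.
      rewrite indicE mem_setE in_itv/=.
      apply: (@cvg_trans _ ((fun n => (1 - x ^+ n) ^+ N t n) @ \oo)).
        by apply: near_eq_cvg; near=> n; rewrite /= qE.
      exact: cvg_step_polynomial.
    have ig : m.-integrable unit_itv (cst 1%:E).
      by apply: (bound _ (cst 1)) => // x _; rewrite normr1.
    have dq : {ae m, forall x, forall n, unit_itv x -> (`|((q n).[x])%:E| <= cst 1%:E x)%E}.
      apply: aeW => x n; rewrite /unit_itv/= in_itv/= => /andP[x0 x1].
      have xn0 : 0 <= x ^+ n by exact: exprn_ge0.
      have xn1 : x ^+ n <= 1 by exact: exprn_ile1.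
      rewrite lee_fin qE ger0_norm ?exprn_ge0 ?subr_ge0//.
      by rewrite exprn_ile1 ?subr_ge0// gerBl.
    have [_ _] := dominated_convergence mI mq mi cq ig dq.
    have mt : measurable `]-oo, t[%classic by exact: measurable_itv.
    by rewrite (integral_indic m mI mt) setIC.
  have qeq n : (\int[mu]_(x in unit_itv) ((q n).[x])%:E =
                \int[nu]_(x in unit_itv) ((q n).[x])%:E)%E.
    by rewrite !polyE//; apply: eq_bigr => i _; rewrite mom.
  have h1 := lim mu fmu; have h2 := lim nu fnu.
  apply: (cvg_unique _ _ h2) => //.
  by apply: cvg_trans h1; apply: near_eq_cvg; near=> n; rewrite qeq.
have restr (m : {measure set R -> \bar R}) A : m (~` unit_itv) = 0%E -> measurable A ->
    m A = m (unit_itv `&` A).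
  move=> m0 mA; rewrite -[in LHS](setIT A) -(setUv unit_itv) setIUr measureU.
  - rewrite [X in (_ + X)%E](_ : _ = 0%E) ?addr0; first by rewrite setIC.
    apply/eqP; rewrite -measure_le0 -[leRHS]m0 le_measure ?inE//.
      by apply: measurableI => //; exact: measurableC.
    exact: measurableC.
  - exact: measurableI.
  - by apply: measurableI => //; exact: measurableC.
  - by rewrite setIACA setICr setI0.
have total : mu setT = nu setT.
  rewrite (restr mu)// (restr nu)// !setIT.
  have := mom 0%N; under eq_integral do rewrite expr0.
  under [X in _ = X -> _]eq_integral do rewrite expr0.
  by rewrite (integral_cst mu mI) (integral_cst nu mI) !mul1e.
have ray (t : R) : mu `]-oo, t[%classic = nu `]-oo, t[%classic.
  have mt : measurable `]-oo, t[%classic by exact: measurable_itv.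
  rewrite (restr mu)// (restr nu)//.
  have [t0|t0] := leP t 0.
    rewrite (_ : _ `&` _ = set0) ?measure0// -subset0 => x [].
    by rewrite /unit_itv/= !in_itv/= => /andP[x0 _] xt; have := lt_le_trans xt t0; lra.
  have [t1|t1] := leP t 1; first by apply: step; rewrite t0 t1.
  rewrite (_ : _ `&` _ = unit_itv); last first.
    apply: setIidl => x; rewrite /unit_itv/= !in_itv/= => /andP[_ x1].
    exact: le_lt_trans t1.
  by have := total; rewrite (restr mu)// (restr nu)// !setIT.
move=> A mA.
apply: (g_sigma_algebra_measure_unique (@RGenInftyO.G R) _
  (fun n => `]-oo, n%:R[%classic)) => //.
- by move=> _ [x ->]; exact: measurable_itv.
- by move=> n; exists n%:R.
- apply/seteqP; split=> // x _; exists (Num.truncn x).+1 => //=.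
  by rewrite in_itv/= truncnS_gt.
- move=> _ _ [x ->] [y ->]; exists (Num.min x y).
  apply/seteqP; split=> z /=; rewrite !in_itv/= lt_min.
    by move=> [-> ->].
  by move=> /andP[].
- by move=> _ [x ->]; exact: ray.
- move=> n; apply: le_lt_trans fmu; rewrite le_measure ?inE//; exact: measurable_itv.
- have : (@ocitv R).-sigma.-measurable A by exact: mA.
  by rewrite RGenInftyO.measurableE.
Unshelve. all: by end_near. Qed.

End MomentsDetermineLaw.

(** * Comparison of the moments *)

(** A finite path is encoded as a sequence, an element of a countable type, as [eq_integral_fibers]
    requires. *)
Lemma seq_path_eqP r j (F : nat -> nat) (s : seq nat) :
  [seq F l | l <- iota r j.+1] = s <->
  size s = j.+1 /\ forall l, (r <= l <= r + j)%N -> F l = nth 0%N s (l - r).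
Proof.
split=> [<-|[ss h]].
  split=> [|l hl]; first by rewrite size_map size_iota.
  rewrite (nth_map 0%N) ?size_iota; last by lia.
  by rewrite nth_iota; [rewrite subnKC; lia|lia].
apply: (@eq_from_nth _ 0%N); first by rewrite size_map size_iota ss.
move=> i; rewrite size_map size_iota => ij.
rewrite (nth_map 0%N) ?size_iota// nth_iota// h; last by lia.
by rewrite addKn.
Qed.

Section Comparison.
Context (R : realType) (d : measure_display) (T : measurableType d)
  (P : probability T R) (alpha : R) (V : nat -> nat -> R)
  (Pi : nat -> T -> seq (seq nat)).
Hypotheses (halpha : alpha < 1) (hPi : EGP P alpha V Pi).
Variables (m : nat) (hm : (1 <= m)%N) (r : nat).
Hypothesis hr : P (record_event Pi m r) != 0%E.
Context (d' : measure_display) (T' : measurableType d') (Q : probability T' R).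
Variables (Ystar Y Z : nat -> {RV Q >-> R}) (K : nat -> {RV Q >-> nat}).
Hypothesis hYstar : forall (j : nat) (A : set R), (2 <= j <= m)%N -> measurable A ->
  distribution Q (Ystar j) A = density_law (Ystar_pdf alpha j) A.
Hypothesis hY : forall (i : nat) (A : set R), (m < i <= r)%N -> measurable A ->
  distribution Q (Y i) A = density_law (Y_pdf alpha m i) A.
Hypothesis hK : forall (n : nat) (k : nat -> nat),
  Q [set w | forall l, (r <= l <= n)%N -> K l w = k l] =
  (cprob P [set w | forall l, (r <= l <= n)%N -> num_classes Pi l w = k l]
           (record_event Pi m r))%:E.
Hypothesis hZ : Z_process alpha r K Z.
Hypothesis hindep : summands_indep m r Ystar Y K Z.

Local Notation E := (record_event Pi m r).
Local Notation X := (age_frequency R Pi m).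
Local Notation K_ev k n := [set w | forall l, (r <= l <= n)%N -> K l w = k l].
Local Notation U := (summand m r Ystar Y Z).
Local Notation PE := (fine (P E)).
Let rp : random_partition Pi := egp_partition hPi.

Let mE : measurable E.
Proof. exact: (measurable_record hPi r hm). Qed.

Let PE_gt0 : 0 < PE.
Proof. by rewrite fine_gt0// lt0e hr measure_ge0/= ltey_eq fin_num_measure. Qed.

Let record_nonempty : exists w, E w.
Proof.
apply/not_existsP => nE; move: hr; rewrite (_ : E = set0) ?measure0 ?eqxx//.
by rewrite -subset0 => w /nE.
Qed.

Let r_gt0 : (0 < r)%N.
Proof. by have [w Ew] := record_nonempty; exact: (record_gt0 rp hm Ew). Qed.

Let mr : (m <= r)%N.
Proof. by have [w Ew] := record_nonempty; exact: (record_le rp hm Ew). Qed.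

Let mKP n k : (r <= n)%N -> measurable (K_path Pi r k n).
Proof.
move=> rn; apply: (@measurable_determined _ _ _ rp n).
exact: (determined_K_path hPi).
Qed.

Let hKE n k : (r <= n)%N -> (P (K_path Pi r k n `&` E) = PE%:E * Q (K_ev k n))%E.
Proof.
move=> rn; rewrite hK /cprob -/(K_path Pi r k n) -EFinM mulrC divfK ?gt_eqF//.
by rewrite fineK// fin_num_measure//; apply: measurableI => //; exact: mKP.
Qed.

(** A path charged by Q is realised by an actual partition in the record event, from which it
    inherits unit steps and bounds. *)
Let K_ev_nonempty n k : (r <= n)%N -> Q (K_ev k n) != 0%E ->
  exists w, E w /\ K_path Pi r k n w.
Proof.
move=> rn Qn; apply/not_existsP => nE; move/negP: Qn; apply; apply/eqP.
rewrite hK /cprob -/(K_path Pi r k n) (_ : _ `&` _ = set0).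
  by rewrite measure0 /= mul0r.
by rewrite -subset0 => w [h1 h2]; apply: (nE w).
Qed.

Let K_step n k : (r <= n)%N -> Q (K_ev k n.+1) != 0%E ->
  k n.+1 = k n \/ k n.+1 = (k n).+1.
Proof.
move=> rn Qn; have [||w [Ew h]] := @K_ev_nonempty n.+1 k; [by lia|by []|].
rewrite -(h n); last by lia.
rewrite -(h n.+1); last by lia.
by have := num_classesS rp n w; lia.
Qed.

Let K_bound n k : (r <= n)%N -> Q (K_ev k n) != 0%E -> (0 < k n <= n)%N.
Proof.
move=> rn Qn; have [w [Ew h]] := K_ev_nonempty rn Qn.
rewrite -(h n) ?rn ?leqnn// (num_classes_le rp) andbT num_classes_gt0//.
by have := r_gt0; lia.
Qed.

Definition partial_product n w : R := \prod_(2 <= j < n.+1) expR (- U j w).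

Let partial_productX p n w :
  partial_product n w ^+ p = \prod_(2 <= j < n.+1) expR (- U j w) ^+ p.
Proof. by rewrite /partial_product -prodrXl. Qed.

Let measurable_partial_product n : measurable_fun setT (partial_product n).
Proof.
apply: measurable_prod => j _; apply: measurableT_comp => //.
exact: measurableT_comp.
Qed.

Let partial_product_ge0 n w : 0 <= partial_product n w.
Proof. by rewrite prodr_ge0// => j _; exact: expR_ge0. Qed.

(** On each path both sides are the same product times the probability of the path, by
    [integral_path_share] and [integral_summands]; [eq_integral_fibers] sums over the paths. *)
Lemma integral_share_partial_product p n : (r <= n)%N ->
  (\int[P]_(w in E) (rising_share alpha Pi m p n w)%:E =
   \int[Q]_w (PE * partial_product n w ^+ p)%:E)%E.
Proof.
move=> rn; pose j := (n - r)%N; have nE : n = (r + j)%N by rewrite subnKC.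
pose h1 w := [seq num_classes Pi l w | l <- iota r j.+1].
pose h2 w := [seq (K l : T' -> nat) w | l <- iota r j.+1].
pose k (s : seq nat) l := nth 0%N s (l - r).
have h1E s : h1 @^-1` [set s] = if size s == j.+1 then K_path Pi r (k s) n else set0.
  case: eqP => ss; last first.
    by rewrite -subset0 => w /= /seq_path_eqP[].
  apply/seteqP; split=> w /=; rewrite nE; first by move=> /seq_path_eqP[_].
  by move=> h; apply/seq_path_eqP.
have h2E s : h2 @^-1` [set s] = if size s == j.+1 then K_ev (k s) n else set0.
  case: eqP => ss; last first.
    by rewrite -subset0 => w /= /seq_path_eqP[].
  apply/seteqP; split=> w /=; rewrite nE; first by move=> /seq_path_eqP[_].
  by move=> h; apply/seq_path_eqP.
have mS : measurable_fun setT (fun w => (rising_share alpha Pi m p n w)%:E).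
  apply/measurable_EFinP; apply: (@measurable_fun_determined _ _ _ rp _ _ n).
  exact: determined_rising_share.
have mW : measurable_fun setT (fun w => (PE * partial_product n w ^+ p)%:E).
  apply/measurable_EFinP; apply: measurable_funM => //; exact: measurable_funX.
apply: (@eq_integral_fibers _ _ _ _ P _ _ Q h1 h2) => //.
- by move=> s; rewrite h1E; case: ifP => // _; exact: mKP.
- move=> s; rewrite h2E; case: ifP => // _; exact: (measurable_K_ev Z K).
- exact: measurable_funTS.
- by move=> w Ew; rewrite lee_fin; exact: (rising_share_ge0 halpha hPi hm p Ew rn).
- by move=> w _; rewrite lee_fin (mulr_ge0 (ltW PE_gt0))// exprn_ge0.
move=> s; rewrite h1E h2E; case: eqP => _; last by rewrite !setI0 !integral_set0.
rewrite setTI.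
transitivity (\int[P]_(w in E) (path_share alpha Pi m r (k s) p n w)%:E)%E.
  rewrite integral_mkcondr; apply: eq_integral => w _.
  by rewrite patchE /path_share; case: asboolP => h; [rewrite mem_set|rewrite memNset].
rewrite (integral_path_share halpha hPi hm)// hKE//.
rewrite muleCA -(integral_summands halpha hm mr hYstar hY hZ hindep K_step K_bound)//.
under [RHS]eq_integral do rewrite EFinM.
rewrite ge0_integralZl_EFin ?(ltW PE_gt0)//.
- by congr (_ * _)%E; apply: eq_integral => w _; rewrite partial_productX.
- exact: (measurable_K_ev Z K).
- by move=> w _; rewrite lee_fin exprn_ge0.
- apply: measurable_funTS; apply/measurable_EFinP; exact: measurable_funX.
Qed.


Definition total_sum w : \bar R :=
  ((\sum_(2 <= j < m.+1) Ystar j w + \sum_(m.+1 <= i < r.+1) Y i w)%R%:E +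
   \sum_(r.+1 <= l <oo) (Z l w)%:E)%E.

Definition limit_product w : R := limn (partial_product ^~ w).

Lemma measurable_total_sum : measurable_fun setT total_sum.
Proof.
apply: emeasurable_funD.
  apply/measurable_EFinP; apply: measurable_funD; apply: measurable_sum => i;
    exact: measurable_funPT.
apply: measurable_limn_ereal => n.
under eq_fun do rewrite sumEFin.
by apply/measurable_EFinP; apply: measurable_sum => i; exact: measurable_funPT.
Qed.

Lemma measurable_limit_product : measurable_fun setT limit_product.
Proof. by apply: measurable_limn_real => n; exact: measurable_partial_product. Qed.

(** The law of Z_l is known only along paths of K, so its negativity is shown to be null on each
    path and then on the countable union of the paths. *)
Lemma ae_summand_ge0 : {ae Q, forall w j, (2 <= j)%N -> 0 <= U j w}.
Proof.
suff neg j : (2 <= j)%N -> Q (U j @^-1` `]-oo, 0[%classic) = 0%E.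
  have : forall j, {ae Q, forall w, (2 <= j)%N -> 0 <= U j w}.
    move=> j; have [j2|j2] := leqP 2 j; last by apply: aeW => w.
    have mU : measurable (U j @^-1` `]-oo, 0[%classic).
      by apply: measurable_funPTI; exact: measurable_itv.
    have /(negligibleP Q mU) := neg j j2.
    apply: negligibleS => w /= h; apply: contrapT => /negP hU; apply: h => _.
    by move: hU; rewrite /= in_itv/= -leNgt.
  by move=> h; apply: filterS (ae_foralln h) => w hw j; exact: hw.
move=> j2; have mneg : measurable (`]-oo, 0[%classic : set R) by exact: measurable_itv.
have pdf0 (pdf : R -> R) : (forall y, pdf y = pdf y * (0 < y)%R%:R) ->
    density_law pdf `]-oo, 0[%classic = 0%E.
  move=> pdfE; apply: integral0_eq => y; rewrite /= in_itv/= => y0.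
  by rewrite pdfE ltNge (ltW y0) mulr0.
have idem (y : R) : (0 < y)%R%:R * (0 < y)%R%:R = (0 < y)%R%:R :> R.
  by case: (0 < y); rewrite ?mulr1 ?mulr0.
rewrite /summand; case: ifPn => [jm|jm].
  rewrite -[LHS]/(distribution Q (Ystar j) _) hYstar ?j2 ?jm//; apply: pdf0 => y.
  by rewrite /Ystar_pdf -[RHS]mulrA idem.
case: ifPn => [jr|jr].
  rewrite -[LHS]/(distribution Q (Y j) _) hY ?jr ?andbT ?ltnNge//; apply: pdf0 => y.
  by rewrite /Y_pdf -[RHS]mulrA idem.
(* Only the coordinate j is constrained, so the factor at j kills the product in [prob_path]. *)
pose A i : set R := if i == j then `]-oo, 0[%classic else setT.
have mA i : measurable (A i) by rewrite /A; case: ifP.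
pose k (s : seq nat) l := nth 0%N s (l - r).
pose F i : set T' := oapp (fun s => path_event r j (fun i => K i) (fun i => Z i) (k s) A)
  set0 (unpickle i).
have rj : (r <= j)%N by lia.
have F0 i : Q.-negligible (F i).
  rewrite /F; case: (unpickle i) => [s|] /=; last exact: negligible_set0.
  apply/(negligibleP Q); first exact: (measurable_path Z K).
  apply: etrans (prob_path hZ K_step (k s) rj mA) _.
  rewrite (_ : \prod_(_ <= _ < _) _ = 0) ?mule0//.
  rewrite big_nat_recr/=; last by lia.
  rewrite [X in _ * X](_ : _ = 0) ?mulr0// /A eqxx /Z_law; case: ifP => _.
    by rewrite pdf0// => y; rewrite /Z_pdf -[RHS]mulrA idem.
  by rewrite diracE memNset//= in_itv/= ltxx.
have mU : measurable ((Z j : T' -> R) @^-1` `]-oo, 0[%classic).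
  by apply: measurable_funPTI.
apply: (negligibleP Q mU).1; apply: negligibleS (negligible_bigcup F0) => w /= Zw.
pose s := [seq (K l : T' -> nat) w | l <- iota r (j - r).+1].
exists (pickle s) => //; rewrite /F pickleK /=; split=> l hl.
  have /seq_path_eqP[_] : s = s by [].
  by rewrite subnKC// => ->.
by rewrite /A; case: eqP => [->|].
Qed.

Section Pathwise.
Variable w : T'.
Hypothesis U0 : forall j, (2 <= j)%N -> 0 <= U j w.

Lemma partial_product_le1 n : partial_product n w <= 1.
Proof.
rewrite /partial_product big_nat_cond; apply: prodr_ile1 => j /andP[/andP[j2 _] _].
by rewrite expR_ge0/= -expR0 ler_expR oppr_le0 U0.
Qed.

(** If the tail series diverges, the products tend to 0, and - log 0 = +oo agrees with the infinite
    sum. *)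
Lemma cvg_partial_product :
  partial_product ^~ w @ \oo --> limit_product w /\
  (- lne (limit_product w)%:E)%E = total_sum w.
Proof.
pose s := \sum_(2 <= j < m.+1) Ystar j w + \sum_(m.+1 <= i < r.+1) Y i w.
pose t n := \sum_(r.+1 <= l < n) Z l w.
pose L := (\sum_(r.+1 <= l <oo) (Z l w)%:E)%E.
have ppE n : (r <= n)%N -> partial_product n w = expR (- (s + t n.+1)).
  move=> rn; rewrite /partial_product -expR_sum; congr expR.
  rewrite sumrN; congr (- _).
  have [h1 h2 h3 h4] : [/\ 1 < m.+1, m < n.+1, m < r.+1 & r < n.+1]%N by split; lia.
  rewrite (big_cat_nat h1 h2) (big_cat_nat h3 h4) /= addrA; congr (_ + _ + _).
  - by apply: eq_big_nat => j jm; rewrite /summand ifT//; lia.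
  - by apply: eq_big_nat => j jm; rewrite /summand ifF ?ifT//; lia.
  - by apply: eq_big_nat => j jm; rewrite /summand !ifF//; lia.
have Z0 l : (r < l)%N -> 0 <= Z l w.
  by move=> rl; have := U0 (j := l); rewrite /summand !ifF; [apply|..]; lia.
have tL : (fun n => (t n)%:E) @ \oo --> L.
  rewrite (_ : (fun n => (t n)%:E) = (fun n => \sum_(r.+1 <= l < n) (Z l w)%:E)%E).
    by apply: is_cvg_nneseries => l rl _; rewrite lee_fin Z0.
  by apply/funext => n; rewrite sumEFin.
have L0 : (0 <= L)%E by apply: nneseries_ge0 => l rl _; rewrite lee_fin Z0.
have pp_cvg (u : R) : (fun n => expR (- (s + t n))) @ \oo --> u ->
    partial_product ^~ w @ \oo --> u.
  rewrite -(cvg_shiftS (fun n => expR (- (s + t n)))) => h; apply: cvg_trans h.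
  apply: near_eq_cvg; near=> n; rewrite /= ppE//.
  by near: n; exact: nbhs_infty_ge.
suff [u [hu lu]] : exists u, (fun n => expR (- (s + t n))) @ \oo --> u /\
    (- lne u%:E)%E = total_sum w.
  have -> : limit_product w = u by apply/cvg_lim => //; exact: pp_cvg.
  by split => //; exact: pp_cvg.
rewrite /total_sum -/s -/L; move: L0 tL; case: L => [l _ tl|_ ty|//].
  exists (expR (- (s + l))); split.
    move/fine_cvgP: tl => [_ tl].
    have stl : (fun n => - (s + t n)) @ \oo --> - (s + l).
      by apply: cvgN; apply: cvgD => //; exact: cvg_cst.
    exact: (cvg_comp _ _ stl (@continuous_expR R (- (s + l)))).
  by rewrite lne_EFin ?expR_gt0// expRK -EFinN opprK.
exists 0; split; last by rewrite le0_lneNy.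
have tr : (fun n => s + t n) @ \oo --> +oo.
  by apply: cvg_comp (cvg_addrl s); apply/cvgeryP.
exact: (cvg_comp _ _ tr (@cvgr_expR R)).
Unshelve. all: by end_near. Qed.


Lemma limit_product_itv : 0 <= limit_product w <= 1.
Proof.
have [h _] := cvg_partial_product; apply/andP; split.
- apply: (@closed_cvg _ _ _ eventually_filter (partial_product ^~ w)
    (fun x => 0 <= x) _ _ _ h); first exact: closed_ge.
  by near=> n; exact: partial_product_ge0.
- apply: (@closed_cvg _ _ _ eventually_filter (partial_product ^~ w)
    (fun x => x <= 1) _ _ _ h); first exact: closed_le.
  by near=> n; exact: partial_product_le1.
Unshelve. all: by end_near. Qed.

End Pathwise.

Lemma ae_age_frequency_itv : {ae P, forall w, E w -> 0 <= X w <= 1}.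
Proof.
apply: filterS (ae_cvg_age_frequency halpha hPi hm r_gt0) => w h Ew.
exact: (age_frequency_itv halpha hPi hm Ew (h Ew)).
Qed.

Lemma integral_age_frequency p :
  (\int[P]_(w in E) (X w ^+ p)%:E = \int[Q]_w (PE * limit_product w ^+ p)%:E)%E.
Proof.
have h1 := cvg_integral_rising_share halpha hPi hm (p := p) r_gt0.
have mW n : measurable_fun setT (fun w => (PE * partial_product n w ^+ p)%:E).
  apply/measurable_EFinP; apply: measurable_funM => //; exact: measurable_funX.
have mL : measurable_fun setT (fun w => (PE * limit_product w ^+ p)%:E).
  apply/measurable_EFinP; apply: measurable_funM => //; apply: measurable_funX.
  exact: measurable_limit_product.
have cW : {ae Q, forall w, setT w -> (fun n => (PE * partial_product n w ^+ p)%:E) @ \oo -->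
    (PE * limit_product w ^+ p)%:E}.
  apply: filterS ae_summand_ge0 => w h _; apply: cvg_EFin; first exact: nearW.
  apply: cvgM; first exact: cvg_cst.
  have [hc _] := cvg_partial_product h.
  by elim: p {h1 mW mL} => [|p IH]; [under eq_fun do rewrite expr0; exact: cvg_cst|
    rewrite exprS; under eq_fun do rewrite exprS; exact: cvgM].
have ig : Q.-integrable setT (cst PE%:E) by exact: finite_measure_integrable_cst.
have bW : {ae Q, forall w, forall n, setT w ->
    (`|(PE * partial_product n w ^+ p)%:E| <= cst PE%:E w)%E}.
  apply: filterS ae_summand_ge0 => w h n _.
  rewrite lee_fin ger0_norm ?mulr_ge0 ?exprn_ge0 ?(ltW PE_gt0)//.
  by rewrite ler_piMr ?(ltW PE_gt0)// exprn_ile1// partial_product_le1.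
have [_ _ h2] := dominated_convergence measurableT mW mL cW ig bW.
apply: (cvg_unique _ h1) => //; apply: cvg_trans h2.
apply: near_eq_cvg; near=> n; apply/esym/integral_share_partial_product.
by near: n; exact: nbhs_infty_ge.
Unshelve. all: by end_near. Qed.

(** As functions of B both sides are finite measures: the image by X of P restricted to the record
    event, and a multiple of the law of the limit product. They are carried by [0, 1] and have equal
    moments. *)
Lemma law_age_frequency (B : set R) : measurable B ->
  P (X @^-1` B `&` E) = (PE%:E * Q (limit_product @^-1` B))%E.
Proof.
move=> mB.
have mX := measurable_age_frequency hPi m.
have mL := measurable_limit_product.
have mXB (A : set R) : measurable A -> measurable (X @^-1` A).
  by move=> mA; rewrite -[X in measurable X]setTI; exact: mX.
have mLB (A : set R) : measurable A -> measurable (limit_product @^-1` A).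
  by move=> mA; rewrite -[X in measurable X]setTI; exact: mL.
have mI : measurable (`[0, 1]%classic : set R) by exact: measurable_itv.
pose c : {nonneg R} := NngNum (ltW PE_gt0).
pose mu0 := (pushforward (mrestr P mE) X : {measure set R -> \bar R}).
pose nu0 := (mscale c (pushforward Q limit_product) : {measure set R -> \bar R}).
pose mu := mu0 mX; pose nu := nu0 mL.
suff : mu B = nu B by [].
have QT : Q setT = 1%E by exact: probability_setT.
have aeI : Q (limit_product @^-1` (~` `[0, 1]%classic)) = 0%E.
  have mS : measurable (limit_product @^-1` (~` `[0, 1]%classic)).
    by apply: mLB; exact: measurableC.
  apply: (negligibleP Q mS).1; apply: negligibleS ae_summand_ge0 => w /= hw h.
  by apply: hw; rewrite /= in_itv/=; exact: limit_product_itv.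
have aeX : P (X @^-1` (~` `[0, 1]%classic) `&` E) = 0%E.
  have mS : measurable (X @^-1` (~` `[0, 1]%classic) `&` E).
    by apply: measurableI => //; apply: mXB; exact: measurableC.
  apply: (negligibleP P mS).1; apply: negligibleS ae_age_frequency_itv => w /= [hw Ew] h.
  by apply: hw; rewrite /= in_itv/=; exact: h.
(* The indicator makes the powers nonnegative on the whole line, as [eq_integral_comp] demands;
   almost surely it equals 1. *)
have mf p : measurable_fun setT (fun x : R => x ^+ p * \1_(`[0, 1]%classic) x).
  by apply: measurable_funM; [exact: measurable_funX|exact: measurable_indic].
have f0 p (x : R) : 0 <= x ^+ p * \1_(`[0, 1]%classic) x.
  rewrite indicE; case: (boolP (_ \in _)); rewrite ?mulr0// mulr1 inE/= in_itv/=.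
  by move=> /andP[x0 _]; rewrite exprn_ge0.
have patchI p (m' : {measure set R -> \bar R}) :
    (\int[m']_(x in `[0%R, 1%R]) (x ^+ p)%:E =
     \int[m']_x (cst 1 x * (x ^+ p * \1_(`[0, 1]%classic) x))%:E)%E.
  rewrite integral_mkcond; apply: eq_integral => x _.
  by rewrite patchE indicE mul1r; case: ifP => _; rewrite ?mulr1 ?mulr0.
apply: moments_unique => //.
- apply: (@le_lt_trans _ _ (P E)); last by rewrite ltey_eq fin_num_measure.
  by rewrite /mu/= /pushforward/mrestr preimage_setT setTI.
- rewrite /nu/= /mscale/= /pushforward preimage_setT QT mule1; exact: ltry.
- by rewrite /nu/= /mscale/= /pushforward aeI mule0.
move=> p; rewrite !patchI.
transitivity (\int[P]_w (\1_E w * (X w ^+ p * \1_(`[0, 1]%classic) (X w)))%:E)%E.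
  apply: esym; apply: (@eq_integral_comp R _ _ P _ _ mu X id (\1_E) (cst 1)
    (fun x => x ^+ p * \1_(`[0, 1]%classic) x)) => //.
  move=> A mA; rewrite (integral_indic P (mXB A mA) mE) preimage_id.
  by rewrite (integral_cst mu mA 1%:E) mul1e setIC.
transitivity (\int[Q]_w (cst PE w * (limit_product w ^+ p *
    \1_(`[0, 1]%classic) (limit_product w)))%:E)%E; last first.
  apply: (@eq_integral_comp R _ _ Q _ _ nu limit_product id (cst PE) (cst 1)
    (fun x => x ^+ p * \1_(`[0, 1]%classic) x)) => //.
    by move=> w; exact: ltW PE_gt0.
  move=> A mA; rewrite (integral_cst Q (mLB A mA) PE%:E) preimage_id.
  by rewrite (integral_cst nu mA 1%:E) mul1e.
have indE (x : R) : 0 <= x <= 1 -> \1_(`[0, 1]%classic) x = 1 :> R.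
  by move=> x01; rewrite indicE mem_set//= in_itv.
transitivity (\int[P]_(w in E) (X w ^+ p)%:E)%E.
  transitivity (\int[P]_(w in E) (X w ^+ p * \1_(`[0, 1]%classic) (X w))%:E)%E.
    rewrite [RHS]integral_mkcond; apply: eq_integral => w _.
    by rewrite patchE indicE; case: ifP => _; rewrite ?mul1r ?mul0r.
  apply: ae_eq_integral => //.
  - apply: measurable_funTS; apply/measurable_EFinP.
    exact: (measurableT_comp (mf p) mX).
  - by apply: measurable_funTS; apply/measurable_EFinP; exact: measurable_funX.
  - by apply: filterS ae_age_frequency_itv => w h Ew; rewrite indE ?mulr1//; exact: h.
rewrite integral_age_frequency; apply: ae_eq_integral => //.
- by apply/measurable_EFinP; apply: measurable_funM => //; exact: measurable_funX.
- apply/measurable_EFinP; apply: measurable_funM => //.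
  exact: (measurableT_comp (mf p) mL).
- apply: filterS ae_summand_ge0 => w h _.
  by rewrite indE ?mulr1//; exact: limit_product_itv.
Qed.

Lemma law_neg_log_age_frequency (A : set (\bar R)) : measurable A ->
  (cprob P [set w | A (- lne (X w)%:E)%E] E)%:E = Q [set w | A (total_sum w)].
Proof.
move=> mA; pose B := [set x : R | A (- lne x%:E)%E].
have mB : measurable B.
  (* [lne] is -oo on all nonpositive reals, so - [lne] is this piecewise function. *)
  have mphi : measurable_fun setT (fun x : R => if 0 < x then (- ln x)%:E else +oo%E).
    apply: measurable_fun_ifT; first exact: measurable_fun_ltr.
      by apply/measurable_EFinP; apply: measurableT_comp => //; exact: measurable_ln.
    exact: measurable_cst.
  have lneE (x : R) : (- lne x%:E)%E = if 0 < x then (- ln x)%:E else +oo%E.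
    by case: ltP => x0; [rewrite lne_EFin|rewrite le0_lneNy// lee_fin].
  have -> : B = setT `&` (fun x : R => if 0 < x then (- ln x)%:E else +oo%E) @^-1` A.
    by rewrite setTI /B; apply/seteqP; split=> x; rewrite /mkset lneE.
  exact: mphi.
have mLB : measurable (limit_product @^-1` B).
  by rewrite -[X in measurable X]setTI; exact: measurable_limit_product.
have mSA : measurable [set w | A (total_sum w)].
  by have := measurable_total_sum measurableT mA; rewrite setTI.
rewrite /cprob -[X in P (X `&` _)]/(X @^-1` B) law_age_frequency//.
have fL := fin_num_measure Q _ mLB.
rewrite -(fineK fL) -EFinM/= mulrAC mulfV ?gt_eqF// mul1r fineK//.
rewrite -(setIT (limit_product @^-1` B)) -(setIT [set w | A (total_sum w)]).
rewrite -(integral_indic Q measurableT mLB) -(integral_indic Q measurableT mSA).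
apply: ae_eq_integral => //.
- by apply/measurable_EFinP; exact: measurable_indic.
- by apply/measurable_EFinP; exact: measurable_indic.
apply: filterS ae_summand_ge0 => w h _; have [_ e] := cvg_partial_product h.
have eB : (limit_product @^-1` B) w = A (total_sum w) by rewrite /B /preimage/= e.
rewrite !indicE; suff -> : (w \in limit_product @^-1` B) = (w \in [set w | A (total_sum w)]) by [].
by apply/idP/idP; rewrite !inE eB.
Qed.

End Comparison.

Theorem proposition6 (R : realType)
  (d : measure_display) (T : measurableType d) (P : probability T R)
  (alpha : R) (V : nat -> nat -> R) (Pi : nat -> T -> seq (seq nat))
  (halpha : alpha < 1) (hPi : EGP P alpha V Pi)
  (m : nat) (hm : (1 <= m)%N)
  (r : nat) (hr : P (record_event Pi m r) != 0%E)
  (d' : measure_display) (T' : measurableType d') (Q : probability T' R)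
  (Ystar Y Z : nat -> {RV Q >-> R}) (K : nat -> {RV Q >-> nat})
  (hYstar : forall (j : nat) (A : set R), (2 <= j <= m)%N -> measurable A ->
     distribution Q (Ystar j) A = density_law (Ystar_pdf alpha j) A)
  (hY : forall (i : nat) (A : set R), (m < i <= r)%N -> measurable A ->
     distribution Q (Y i) A = density_law (Y_pdf alpha m i) A)
  (hK : forall (n : nat) (k : nat -> nat),
     Q [set w | forall l, (r <= l <= n)%N -> K l w = k l] =
     (cprob P [set w | forall l, (r <= l <= n)%N -> num_classes Pi l w = k l]
              (record_event Pi m r))%:E)
  (hZ : Z_process alpha r K Z)
  (hindep : summands_indep m r Ystar Y K Z)
  (A : set (\bar R)) (hA : measurable A) :
  (cprob P [set w | A (- lne (age_frequency R Pi m w)%:E)%E]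
           (record_event Pi m r))%:E =
  Q [set w | A ((\sum_(2 <= j < m.+1) Ystar j w
                 + \sum_(m.+1 <= i < r.+1) Y i w)%R%:E
                + \sum_(r.+1 <= l <oo) (Z l w)%:E)%E].
Proof.
exact: (law_neg_log_age_frequency halpha hPi hm hr hYstar hY hK hZ hindep hA).
Qed.
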